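(* Let $n\ge 4$. Any conformally flat space-like hypersurface $M$ ($\dim M=n$) in the Minkowski space $\mathbb{R}^{n+1}_1$, which is free of umbilical points, locally is a part of a canal space-like hypersurface.
   Context: A point of a hypersurface is umbilical if the shape operator there is a multiple of the identity. $\mathbb{R}^{n+1}_1$ is Minkowski space with scalar product of signature $(n,1)$; products of vectors are scalar products. A hypersurface of dimension $n$ is space-like if the induced metric is positive definite; it is conformally flat if this induced metric is (locally) conformally flat. A space-like hypersphere with center $z$ and radius $R>0$ is $\{Z:(Z-z)^2=-R^2\}$. A sphere of codimension two is an $(n-1)$-dimensional cross-section $S^{n-1}$ of a space-like hypersphere with a hyperplane. A canal space-like hypersurface is a space-like hypersurface $M=\{S^{n-1}(s)\}$, $s\in J\subset\mathbb R$, which is a one-parameter family of spheres of codimension two (spherical generators) such that the normals to $M$ at the points of any fixed generator pass through a fixed point.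
   Formalization: Generators of a canal hypersurface may be open pieces of spheres, and the fixed point may be at infinity (parallel normals), where the spheres may be planes of codimension two; the literal claim fails, e.g. for space-like cylinders over curved plane curves. *)

(* Defs.v *)
From HB Require Import structures.
From mathcomp Require Import all_boot all_order all_algebra.
From mathcomp Require Import all_classical all_reals.
From mathcomp Require Import topology normedtype derive.

Set Implicit Arguments.
Unset Strict Implicit.
Unset Printing Implicit Defensive.

Import Order.TTheory GRing.Theory Num.Theory.
Import numFieldNormedType.Exports.

Local Open Scope classical_set_scope.
Local Open Scope ring_scope.

(** Smoothness on a set [U], meant for open [U]: [smooth U f] is C^infinity. *)
Fixpoint Ck (R : realType) (V W : normedModType R) (k : nat)
    (U : set V) (f : V -> W) : Prop :=
  if k is k'.+1 then
    (forall x, U x -> differentiable f x) /\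
    (forall v, Ck k' U (fun x => 'D_v f x))
  else forall x, U x -> {for x, continuous f}.

Definition smooth (R : realType) (V W : normedModType R)
    (U : set V) (f : V -> W) : Prop := forall k, Ck k U f.

Section Minkowski.
Context (R : realType) (n : nat).
Implicit Types (x y z a d p c : 'rV[R]_n.+1) (M S H G : set 'rV[R]_n.+1).

(** Minkowski space is ['rV[R]_n.+1]; the last coordinate is the time one. *)
Definition mink x y : R :=
  \sum_(i < n) x ord0 (widen_ord (leqnSn n) i) * y ord0 (widen_ord (leqnSn n) i)
  - x ord0 ord_max * y ord0 ord_max.

(** [f] is a regular local parametrization of [M] over the open set [U]: a
    smooth immersion that is a homeomorphism from [U] onto a relatively open
    part of [M] (openness of the map onto its image is the last clause). *)
Definition parametrization M (U : set 'rV[R]_n) (f : 'rV[R]_n -> 'rV[R]_n.+1) :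
    Prop :=
  [/\ open U,
      smooth U f,
      forall u v, U u -> 'D_v f u = 0 -> v = 0,
      {in U &, injective f} &
      forall W, open W -> W `<=` U -> exists2 O, open O & f @` W = M `&` O].

Definition hypersurface M : Prop :=
  forall p, M p -> exists U f, parametrization M U f /\ (f @` U) p.

Definition tangent M p (w : 'rV[R]_n.+1) : Prop :=
  exists U f u v, [/\ parametrization M U f, U u, f u = p & w = 'D_v f u].

Definition normal_vector M p (x : 'rV[R]_n.+1) : Prop :=
  forall w, tangent M p w -> mink x w = 0.

Definition spacelike_hypersurface M : Prop :=
  hypersurface M /\ forall p w, tangent M p w -> w != 0 -> 0 < mink w w.

(** Around every point there are local coordinates in which the induced metric
    is a positive function times the Euclidean metric of R^n. *)
Definition conformally_flat M : Prop :=
  forall p, M p -> exists U f,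
    [/\ parametrization M U f, (f @` U) p &
        exists rho : 'rV[R]_n -> R, forall u, U u ->
          0 < rho u /\
          forall v w : 'rV[R]_n, mink ('D_v f u) ('D_w f u) =
                      rho u * \sum_(i < n) v ord0 i * w ord0 i].

(** Smooth unit normal field along a parametrization, as a function of the
    parameters; the normals of a space-like hypersurface are time-like. *)
Definition unit_normal_field (U : set 'rV[R]_n)
    (f xi : 'rV[R]_n -> 'rV[R]_n.+1) : Prop :=
  smooth U xi /\
  forall u, U u -> mink (xi u) (xi u) = -1 /\
                   forall v, mink (xi u) ('D_v f u) = 0.

(** By Weingarten's formula the shape operator at [f u] is the endomorphism
    ['D_v f u |-> - 'D_v xi u] of the tangent space. *)
Definition umbilical M p : Prop :=
  exists U f xi u lambda,
    [/\ parametrization M U f, unit_normal_field U f xi, U u, f u = p &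
        forall v, - 'D_v xi u = lambda *: 'D_v f u].

Definition hypersphere z (r : R) : set 'rV[R]_n.+1 :=
  [set x | mink (x - z) (x - z) = - r ^+ 2].

Definition hyperplane a (b : R) : set 'rV[R]_n.+1 := [set x | mink a x = b].

(** Section of a space-like hypersphere by a hyperplane. It is required to be
    nonempty and transversal ([x - z] is the normal of the hypersphere at [x]);
    this is what makes it (n-1)-dimensional, excluding the single point cut
    out by a tangent hyperplane. *)
Definition codim2_sphere S : Prop :=
  exists z r a b,
    [/\ 0 < r, S = hypersphere z r `&` hyperplane a b, S !=set0 &
        forall x, S x -> forall t : R, a <> t *: (x - z)].

(** Limit of the above for infinite radius: section of a space-like hyperplane
    (time-like normal [d]) by another, non-parallel, hyperplane. *)
Definition codim2_plane S : Prop :=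
  exists d e a b,
    [/\ mink d d < 0, S = hyperplane d e `&` hyperplane a b &
        forall t : R, a <> t *: d].

(** [G] is the part of [M] lying on the sphere [S], along which the normals of
    [M] pass through a fixed point. The point may be at infinity, i.e. the
    normals may be parallel, and only then may [S] be a sphere of infinite
    radius. This limit case has to be admitted: it occurs on the circles of
    extreme height of a rotation torus, and, in the present setting, for
    rotation hypersurfaces at critical points of the profile curve, for
    space-like cylinders over plane curves, and more generally wherever the
    principal curvature of multiplicity n-1 vanishes. *)
Definition spherical_generator M G S : Prop :=
  (codim2_sphere S /\
   exists c, forall p, G p -> normal_vector M p (c - p)) \/
  ((codim2_sphere S \/ codim2_plane S) /\
   exists2 d, d <> 0 & forall p, G p -> normal_vector M p d).

(** One-parameter family of spheres [S s], [s] in the interval [J]. The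
    generators are nonempty relatively open parts of the spheres [S s], not
    necessarily complete spheres, since the union of the complete ones is in
    general not regular everywhere. They are the level sets in [M] of a smooth
    parameter [sigma] without critical points on [M]. *)
Definition canal_hypersurface M : Prop :=
  spacelike_hypersurface M /\
  exists (J : set R) (S : R -> set 'rV[R]_n.+1) (sigma : 'rV[R]_n.+1 -> R),
    [/\ open J, is_interval J, sigma @` M = J,
        forall U f, parametrization M U f ->
          smooth U (sigma \o f) /\
          forall u, U u -> exists v, 'D_v (sigma \o f) u != 0 &
        forall s, J s ->
          let G := M `&` sigma @^-1` [set s] in
          (exists2 O, open O & G = S s `&` O) /\
          spherical_generator M G (S s)].

End Minkowski.

(* Main.v *)
From HB Require Import structures.
Require Import Defs.
From mathcomp Require Import all_boot all_order all_algebra.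
From mathcomp Require Import all_classical all_reals.
From mathcomp Require Import topology normedtype landau derive realfun.
From mathcomp Require Import sesquilinear ring lra.
Set Implicit Arguments.
Unset Strict Implicit.
Unset Printing Implicit Defensive.
Import Order.TTheory GRing.Theory Num.Theory.
Import numFieldNormedType.Exports.
Local Open Scope classical_set_scope.
Local Open Scope ring_scope.

(** Why the theorem holds.

    To a point x of Minkowski space associate the vector [lift x] = (1, x, x^2)
    of R x R^(n+1) x R. It is isotropic for the scalar product [Q], of signature
    (n+1, 2), and the hyperspheres and the space-like hyperplanes of Minkowski
    space are the vectors K with Q K K = -1, incidence of K and x being
    Q K (lift x) = 0. In a conformal chart f of M, with induced metric rho times
    the flat one, the rescaled lift F = rho^(-1/2) lift f induces exactly the
    flat metric of R^n ([light_frame_chart]). With N the tangent hyperplane of M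
    at f, seen as a vector with Q N N = -1, let H be the second fundamental form
    of F in the direction N.

    Commuting the third derivatives of F, which are constrained by the flatness
    of the metric, gives H(x,z) H(y,w) = H(x,w) H(y,z) for all orthogonal x, y,
    z, w ([second_form_gauss]). When n >= 4 this forces a form which is not a
    multiple of the flat product to be such a multiple plus a form of rank one
    ([rank_one_form]): there is a function Lam such that B = H - Lam dot has
    rank one. This is where the absence of umbilical points enters
    ([chart_umbilic]).

    The vector K = N + Lam F is the curvature hypersphere of the multiple
    principal curvature. Its derivative pairs with the derivatives of F to - B.
    It vanishes on the kernel of B, up to a multiple of F which is excluded by
    comparing the mixed second derivatives of K in two orthogonal directions of
    the kernel ([sphere_ker], a Codazzi argument). So K has rank one, and
    locally K = k(t(u)) for a curve k of hyperspheres ([rank_one_curve]).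
    Differentiating Q K (lift f) = 0 shows that M satisfies both equations
    Q (k t) (lift f) = 0 and Q (k' t) (lift f) = 0: it lies on the envelope of
    the family k.

    It remains to see that the envelope is a canal hypersurface near the given
    point p ([canal_from_curve], [envelope_canal]). Since Q k'' (lift p) is not
    zero, the second equation determines t as a function of x; the first one is
    then the equation of a smooth graph over the tangent hyperplane. At a point
    x with parameter s, the normal of the envelope is that of k(s), which passes
    through the center of k(s) or, if k(s) is a hyperplane, has the direction of
    its normal; and the level set of the parameter is an open part of the
    intersection of the pencil spanned by k(s) and the space-like vector k'(s),
    which is a sphere of codimension two, or a plane if k(s) is a hyperplane
    ([pencil_codim2]). *)

(** * Differentiation and smoothness *)
Section Calculus.
Context {R : realType}.
Implicit Types V W U : normedModType R.

(** Continuous linear and bilinear maps as properties of plain functions, so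
    that they apply to maps given by expressions, such as [fun v => 'D_v f x]. *)
Record clin {V W} (l : V -> W) : Prop := Clin {
  clin_linear : linear l;
  clin_continuous : continuous l }.

Record cbil {V W U} (q : V -> W -> U) : Prop := Cbil {
  cbil_l : forall y, linear (q^~ y);
  cbil_r : forall x, linear (q x);
  cbil_continuous : continuous (fun p : V * W => q p.1 p.2) }.

(** Finite dimension, in the form in which calculus uses it: vectors are
    determined by finitely many continuous coordinates. The [e i] may be
    dependent. *)
Definition has_frame W := exists m (e : 'I_m -> W) (c : 'I_m -> W -> R),
  (forall i, clin (c i)) /\ forall w, w = \sum_i c i w *: e i.

Lemma frame_eq W m (e : 'I_m -> W) (c : 'I_m -> W -> R) :
  (forall w, w = \sum_i c i w *: e i) ->
  forall w w', (forall i, c i w = c i w') -> w = w'.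
Proof.
by move=> ce w w' cw; rewrite (ce w) (ce w'); apply: eq_bigr => i _; rewrite cw.
Qed.

Lemma clinD V W (l : V -> W) : clin l -> forall x y, l (x + y) = l x + l y.
Proof. by move=> [ll _] x y; have := ll 1 x y; rewrite !scale1r. Qed.

Lemma clin0 V W (l : V -> W) : clin l -> l 0 = 0.
Proof. by move=> ll; apply: (addrI (l 0)); rewrite -(clinD ll) !addr0. Qed.

Lemma clinZ V W (l : V -> W) : clin l -> forall a x, l (a *: x) = a *: l x.
Proof.
by move=> ll a x; have := clin_linear ll a x 0; rewrite !addr0 (clin0 ll) addr0.
Qed.

Lemma clin_sum V W (l : V -> W) : clin l -> forall m (g : 'I_m -> V),
  l (\sum_i g i) = \sum_i l (g i).
Proof.
move=> ll m g; elim/big_ind2 : _ => [|x1 x2 y1 y2 <- <-|//].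
  exact: (clin0 ll).
by rewrite (clinD ll).
Qed.

Lemma clin_diff V W (l : V -> W) x : clin l ->
  differentiable l x /\ 'd l x = l :> (V -> W).
Proof.
move=> [ll lc].
pose lM := GRing.isLinear.Build _ _ _ _ _ ll.
pose L : {linear _ -> _} := HB.pack l lM.
split; first exact: (@linear_differentiable _ _ _ L).
exact: (@diff_lin _ _ _ L).
Qed.

Lemma derive_clin V W (l : V -> W) x v : clin l -> 'D_v l x = l v.
Proof. by move=> /(clin_diff x)[dl el]; rewrite deriveE// el. Qed.

Lemma cbil_diff V W U (q : V -> W -> U) p : cbil q ->
  differentiable (fun z => q z.1 z.2) p /\
  'd (fun z => q z.1 z.2) p = (fun z => q p.1 z.2 + q z.1 p.2) :> (V * W -> U).
Proof.
move=> [ql qr qc].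
have qb : bilinear_for
    (GRing.Scale.Law.clone _ _ *:%R _) (GRing.Scale.Law.clone _ _ *:%R _) q.
  by split=> [u|u] a x y /=; [exact: ql|exact: qr].
pose qM := bilinear_isBilinear.Build R V W U _ _ q qb.
pose B : {bilinear V -> W -> U} := HB.pack q qM.
split; first exact: (@differentiable_bilin _ _ _ _ B).
exact: (@diff_bilin _ _ _ _ B).
Qed.

Lemma derive_comp V W U (f : V -> W) (g : W -> U) x v :
  differentiable f x -> differentiable g (f x) ->
  'D_v (fun y => g (f y)) x = 'D_('D_v f x) g (f x).
Proof.
move=> df dg; rewrite !deriveE//; last exact: differentiable_comp.
by rewrite (_ : (fun y => g (f y)) = g \o f)// diff_comp.
Qed.

Lemma clin_derive V W (f : V -> W) x : differentiable f x ->
  clin (fun v => 'D_v f x).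
Proof.
move=> df; split.
  by move=> a u v; rewrite !deriveE// linearP.
rewrite (_ : (fun v => _) = 'd f x); first exact: diff_continuous.
by apply/funext => v; rewrite deriveE.
Qed.

Lemma differentiable_lin V W U (l : W -> U) (f : V -> W) x : clin l ->
  differentiable f x -> differentiable (fun y => l (f y)) x.
Proof.
by move=> /(@clin_diff _ _ l (f x))[dl _] df; exact: differentiable_comp.
Qed.

Lemma derive_lin V W U (l : W -> U) (f : V -> W) x v : clin l ->
  differentiable f x -> 'D_v (fun y => l (f y)) x = l ('D_v f x).
Proof.
move=> /(@clin_diff _ _ l (f x))[dl el] df.
by rewrite derive_comp// [LHS]deriveE// el.
Qed.

Lemma differentiable_bil V W U V' (q : V -> W -> U) (f : V' -> V) (g : V' -> W) x :
  cbil q -> differentiable f x -> differentiable g x ->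
  differentiable (fun y => q (f y) (g y)) x.
Proof.
move=> /(@cbil_diff _ _ _ q (f x, g x))[dq _] df dg.
have := differentiable_pair df dg => dp.
exact: (differentiable_comp dp dq).
Qed.

Lemma derive_bil V W U V' (q : V -> W -> U) (f : V' -> V) (g : V' -> W) x v :
  cbil q -> differentiable f x -> differentiable g x ->
  'D_v (fun y => q (f y) (g y)) x = q ('D_v f x) (g x) + q (f x) ('D_v g x).
Proof.
move=> qb df dg; have [dq eq] := cbil_diff (f x, g x) qb.
have dp := differentiable_pair df dg.
rewrite (_ : (fun y => q (f y) (g y)) =
  (fun z => q z.1 z.2) \o (fun y => (f y, g y)))//.
rewrite deriveE; last exact: differentiable_comp.
by rewrite diff_comp//= eq diff_pair//= -!deriveE// addrC.
Qed.

Lemma derive_fctD V W (f g : V -> W) x v :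
  differentiable f x -> differentiable g x ->
  'D_v (fun y => f y + g y) x = 'D_v f x + 'D_v g x.
Proof. by move=> df dg; rewrite -deriveD//; exact: diff_derivable. Qed.

Lemma differentiable_fctD V W (f g : V -> W) x :
  differentiable f x -> differentiable g x ->
  differentiable (fun y => f y + g y) x.
Proof. by move=> df dg; exact: differentiableD. Qed.

Lemma derive_eq_open V W (A : set V) (f g : V -> W) x v : open A -> A x ->
  (forall y, A y -> f y = g y) -> 'D_v f x = 'D_v g x.
Proof.
move=> oA Ax fg; apply: near_eq_derive; apply: (filterS fg).
exact: open_nbhs_nbhs.
Qed.

(** The remainder estimate itself: what one needs in order to modify a function
    away from a point, or to differentiate a function known by an equation. *)
Lemma differentiable_epsP V W (f : V -> W) x :
  differentiable f x <-> exists l : V -> W, clin l /\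
    forall e : R, 0 < e -> \forall h \near (0 : V),
      `|f (h + x) - f x - l h| <= e * `|h|.
Proof.
split=> [df|[l [[ll lc] lh]]].
  exists ('d f x); split.
    by split; [exact: linearP|exact: diff_continuous].
  move=> e e0; have := diff_locally df => /eqaddoP/(_ e e0).
  apply: filterS => h /=.
  by rewrite !fctE/= opprD addrA.
pose lM := GRing.isLinear.Build _ _ _ _ _ ll.
pose L : {linear _ -> _} := HB.pack l lM.
have fL : f \o shift x = cst (f x) + L +o_ (0 : V) id.
  apply/eqaddoP => e e0; have := lh e e0.
  by apply: filterS => h /=; rewrite !fctE/= opprD addrA.
have dE : 'd f x = L :> (V -> W) by apply: diff_unique.
by apply/diff_locallyP; rewrite dE.
Qed.

Lemma differentiable_eq_open V W (A : set V) (f g : V -> W) x : open A -> A x ->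
  (forall y, A y -> f y = g y) -> differentiable f x -> differentiable g x.
Proof.
move=> oA Ax fg /differentiable_epsP[l [ll lh]].
apply/differentiable_epsP; exists l; split=> // e e0.
have nA : \forall h \near (0 : V), A (h + x).
  have /nbhs_ballP[r /= r0 rA] : nbhs x A by exact: open_nbhs_nbhs.
  near=> h; apply: rA; rewrite -ball_normE/= opprD addrC -addrA addNr addr0.
  by rewrite normrN; near: h; exact: nbhs0_lt.
near=> h; rewrite -!fg//; near: h; first exact: lh.
exact: nA.
Unshelve. all: by end_near. Qed.

Lemma Ck_ext V W k (A : set V) (f g : V -> W) : open A ->
  (forall x, A x -> f x = g x) -> Ck k A f -> Ck k A g.
Proof.
move=> oA; elim: k f g => [|k IH] f g fg /=.
  move=> fc x Ax; have nA : nbhs x A by exact: open_nbhs_nbhs.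
  have /= fcx := fc x Ax.
  rewrite /prop_for /continuous_at -(fg x Ax).
  apply: cvg_trans fcx; apply: near_eq_cvg.
  by apply: filterS nA => y Ay; rewrite fg.
move=> [df Df]; split=> [x Ax|v].
  exact: differentiable_eq_open fg (df x Ax).
by apply: (IH _ _ _ (Df v)) => x Ax; exact: derive_eq_open fg.
Qed.

Lemma Ck_sub V W k (A B : set V) (f : V -> W) : B `<=` A -> Ck k A f -> Ck k B f.
Proof.
move=> BA; elim: k f => [|k IH] f /=; first by move=> fc x /BA /fc.
by move=> [df Df]; split=> [x /BA /df//|v]; exact: IH.
Qed.

Lemma CkS V W k (A : set V) (f : V -> W) : Ck k.+1 A f -> Ck k A f.
Proof.
elim: k f => [|k IH] f; first by move=> [df _] x /df/differentiable_continuous.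
by move=> [df Df]; split=> // v; apply: IH; exact: Df.
Qed.

Lemma Ck_cst V W k (A : set V) (w : W) : Ck k A (fun=> w).
Proof.
elim: k w => [|k IH] w /=; first by move=> x _; exact: cst_continuous.
split=> [x _|v]; first exact: differentiable_cst.
have -> : (fun x : V => 'D_v (fun=> w) x) = (fun=> 0) by apply/funext => x; exact: derive_cst.
exact: IH.
Qed.

Lemma CkD V W k (A : set V) (f g : V -> W) : open A ->
  Ck k A f -> Ck k A g -> Ck k A (fun x => f x + g x).
Proof.
move=> oA; elim: k f g => [|k IH] f g /=.
  by move=> cf cg x Ax; apply: continuousD; [exact: cf|exact: cg].
move=> [df Df] [dg Dg]; split=> [x Ax|v].
  exact: differentiable_fctD (df x Ax) (dg x Ax).
apply: Ck_ext (IH _ _ (Df v) (Dg v)) => // x Ax.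
by rewrite derive_fctD//; [exact: df|exact: dg].
Qed.

Lemma Ck_sum V W k (A : set V) m (f : 'I_m -> V -> W) : open A ->
  (forall i, Ck k A (f i)) -> Ck k A (fun x => \sum_i f i x).
Proof.
move=> oA; elim: m f => [|m IH] f Cf.
  by under eq_fun do rewrite big_ord0; exact: Ck_cst.
under eq_fun do rewrite big_ord_recl.
by apply: CkD => //; exact: IH.
Qed.

Lemma Ck_diff V W k (A : set V) (f : V -> W) : Ck k.+1 A f ->
  forall x, A x -> differentiable f x.
Proof. by case. Qed.

Lemma Ck_D V W k (A : set V) (f : V -> W) : Ck k.+1 A f ->
  forall v, Ck k A ('D_v f).
Proof. by case. Qed.

Lemma Ck_lin V W U k (A : set V) (l : W -> U) (f : V -> W) : open A -> clin l ->
  Ck k A f -> Ck k A (fun x => l (f x)).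
Proof.
move=> oA ll; elim: k f => [|k IH] f /=.
  move=> cf x Ax; apply: continuous_comp; first exact: cf.
  exact: clin_continuous.
move=> [df Df]; split=> [x Ax|v]; first exact: differentiable_lin (df x Ax).
apply: Ck_ext (IH _ (Df v)) => // x Ax.
by rewrite (derive_lin _ ll)//; exact: df.
Qed.

Lemma Ck_clin V W k (A : set V) (l : V -> W) : clin l -> Ck k A l.
Proof.
move=> ll; case: k => [|k]; first by move=> x _; exact: clin_continuous.
split=> [x _|v]; first exact: (clin_diff x ll).1.
have -> : (fun x => 'D_v l x) = (fun=> l v).
  apply/funext => x; have [d1 d2] := clin_diff x ll.
  by rewrite deriveE// d2.
exact: Ck_cst.
Qed.

Lemma Ck_bil V W U V' k (A : set V') (q : V -> W -> U) (f : V' -> V) (g : V' -> W) :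
  open A -> cbil q -> Ck k A f -> Ck k A g -> Ck k A (fun x => q (f x) (g x)).
Proof.
move=> oA qb; elim: k f g => [|k IH] f g.
  move=> cf cg x Ax.
  have /= := @continuous_comp _ _ _ (fun x => (f x, g x))
    (fun p : V * W => q p.1 p.2) x.
  apply; last exact: cbil_continuous.
  by apply: cvg_pair; [exact: cf|exact: cg].
move=> Cf Cg; have [df Df dg Dg] := And4 (Ck_diff Cf) (Ck_D Cf) (Ck_diff Cg) (Ck_D Cg); split=> [x Ax|v].
  exact: differentiable_bil (df x Ax) (dg x Ax).
have C1 := IH _ _ (Df v) (CkS Cg); have C2 := IH _ _ (CkS Cf) (Dg v).
apply: Ck_ext (CkD oA C1 C2) => // x Ax.
by rewrite (derive_bil _ qb)//; [exact: df|exact: dg].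
Qed.

Lemma cbil_scale V : cbil ( *:%R : R -> V -> V).
Proof.
split=> [y a u v|x a u v|]; last exact: scale_continuous.
  by rewrite scalerDl scalerA.
by rewrite scalerDr !scalerA mulrC.
Qed.

Lemma cbil_mul : cbil ( *%R : R -> R -> R).
Proof.
split=> [y a u v|x a u v|]; last exact: mul_continuous.
  by rewrite mulrDl -scalerAl.
by rewrite mulrDr -scalerAr.
Qed.

Lemma Ck_inv V k (A : set V) (f : V -> R) : open A ->
  (forall x, A x -> f x != 0) -> Ck k A f -> Ck k A (fun x => (f x)^-1).
Proof.
move=> oA f0; elim: k => [|k IH].
  by move=> cf x Ax; apply: continuousV; [exact: f0|exact: cf].
move=> Cf; have [df Df] := conj (Ck_diff Cf) (Ck_D Cf); split=> [x Ax|v].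
  by apply: differentiableV; [exact: df|exact: f0].
have C1 := IH (CkS Cf).
have C2 := Ck_bil oA cbil_mul (Ck_bil oA cbil_mul C1 C1) (Df v).
have C3 := Ck_bil oA cbil_mul (Ck_cst k A (-1 : R)) C2.
apply: Ck_ext C3 => // x Ax.
rewrite [RHS]deriveE; last by apply: differentiableV; [exact: df|exact: f0].
rewrite diffV ?f0//; last exact: df.
rewrite -[RHS]/(- f x ^- 2 * 'd f x v) -deriveE; last exact: df.
by rewrite mulN1r mulNr -invfM -expr2.
Qed.

Lemma Ck_sqrt V k (A : set V) (f : V -> R) : open A ->
  (forall x, A x -> 0 < f x) -> Ck k A f -> Ck k A (fun x => Num.sqrt (f x)).
Proof.
move=> oA f0.
have ds x : A x -> differentiable (Num.sqrt : R -> R) (f x).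
  by move=> Ax; apply/derivable1_diffP; have [] := is_derive1_sqrt (f0 x Ax).
elim: k => [|k IH].
  move=> cf x Ax; apply: continuous_comp; first exact: cf.
  exact: sqrt_continuous.
move=> Cf; have [df Df] := conj (Ck_diff Cf) (Ck_D Cf); split=> [x Ax|v].
  by apply: differentiable_comp; [exact: df|exact: ds].
have C1 := IH (CkS Cf).
have C2 : Ck k A (fun x => (Num.sqrt (f x))^-1).
  by apply: Ck_inv => // x Ax; rewrite gt_eqF// sqrtr_gt0 f0.
have C3 := Ck_bil oA cbil_mul (Ck_cst k A (2^-1 : R)) (Ck_bil oA cbil_mul C2 (Df v)).
apply: Ck_ext C3 => // x Ax.
rewrite (derive_comp (f := f) (g := Num.sqrt)); [|exact: df|exact: ds].
rewrite [RHS]deriveE; last exact: ds.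
rewrite -[X in 'd _ _ X]mulr1 -[X in 'd _ _ X]/('D_v f x *: (1 : R)) linearZ/=.
rewrite -deriveE; last exact: ds.
by rewrite derive_sqrt ?f0// invfM /GRing.scale/=; ring.
Qed.


(** The derivative of [fun x => g (f x)] is the derivative of [g] in a direction
    that varies with [x]; the definition of [Ck] speaks of fixed directions only.
    A frame of [W] turns it into a finite sum of products. *)
Lemma Ck_comp V W U k (A : set V) (B : set W) (f : V -> W) (g : W -> U) :
  has_frame W -> open A -> open B -> (forall x, A x -> B (f x)) ->
  Ck k A f -> Ck k B g -> Ck k A (fun x => g (f x)).
Proof.
move=> [m [e [c [cl ce]]]] oA oB AB; elim: k g => [|k IH] g.
  move=> cf cg x Ax; apply: continuous_comp; first exact: cf.
  exact: cg (AB _ Ax).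
move=> Cf Cg; have [dg Dg] := conj (Ck_diff Cg) (Ck_D Cg); have [df Df] := conj (Ck_diff Cf) (Ck_D Cf); split=> [x Ax|v].
  apply: (@differentiable_comp _ _ _ _ f g); first exact: df.
  exact: dg (AB _ Ax).
have C i : Ck k A (fun x => c i ('D_v f x) *: 'D_(e i) g (f x)).
  apply: Ck_bil => //; first exact: cbil_scale.
    exact: Ck_lin (Df v).
  by apply: (IH ('D_(e i) g)) => //; exact: CkS.
apply: Ck_ext (Ck_sum oA C) => // x Ax.
rewrite (derive_comp (f := f) (g := g)); [|exact: df|exact: dg (AB _ Ax)].
have cD := clin_derive (dg _ (AB _ Ax)).
rewrite {2}(ce ('D_v f x)) (clin_sum cD).
by apply: eq_bigr => i _; rewrite (clinZ cD).
Qed.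

Lemma has_frameR : has_frame R.
Proof.
exists 1%N, (fun=> 1), (fun=> id); split=> [i|w].
  by split=> //; move=> ?; exact: cvg_id.
by rewrite big_ord1 /GRing.scale/= mulr1.
Qed.

Lemma clin_coord m (i : 'I_m) : clin (fun x : 'rV[R]_m => x ord0 i).
Proof.
split=> [a u v|]; first by rewrite !mxE.
exact: coord_continuous.
Qed.

Lemma has_frame_rV m : has_frame 'rV[R]_m.
Proof.
exists m, (fun i => delta_mx ord0 i), (fun i (x : 'rV[R]_m) => x ord0 i).
by split=> [i|w]; [exact: clin_coord|exact: row_sum_delta].
Qed.

Lemma clin_fst V W : clin (fst : V * W -> V).
Proof. by split=> // x; exact: cvg_fst. Qed.

Lemma clin_snd V W : clin (snd : V * W -> W).
Proof. by split=> // x; exact: cvg_snd. Qed.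

Lemma clin_comp V W U (l : V -> W) (l' : W -> U) : clin l -> clin l' ->
  clin (fun x => l' (l x)).
Proof.
move=> ll ll'; split=> [a u v|x].
  by rewrite (clinD ll) (clinD ll') (clinZ ll) (clinZ ll').
by apply: continuous_comp; exact: clin_continuous.
Qed.

Lemma clin_mulr (c : R) : clin (fun x : R => c * x).
Proof.
split=> [a x y|x]; first by rewrite mulrDr -scalerAr.
by apply: cvgM; [exact: cvg_cst|exact: cvg_id].
Qed.

Lemma clin_inl V W : clin (fun x : V => (x, 0 : W)).
Proof.
split=> [a x y|x]; last by apply: cvg_pair; [exact: cvg_id|exact: cvg_cst].
by rewrite [RHS](_ : _ = (a *: x + y, a *: 0 + 0)) // scaler0 addr0.
Qed.

Lemma clin_inr V W : clin (fun x : W => (0 : V, x)).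
Proof.
split=> [a x y|x]; last by apply: cvg_pair; [exact: cvg_cst|exact: cvg_id].
by rewrite [RHS](_ : _ = (a *: 0 + 0, a *: x + y)) // scaler0 addr0.
Qed.

Lemma has_frame_pair V W : has_frame V -> has_frame W -> has_frame (V * W)%type.
Proof.
move=> [m [e [c [cl ce]]]] [m' [e' [c' [cl' ce']]]].
exists (m + m')%N, (fun i => match fintype.split i with
  | inl j => (e j, 0) | inr j => (0, e' j) end),
  (fun i x => match fintype.split i with
  | inl j => c j x.1 | inr j => c' j x.2 end).
split=> [i|[v w]].
  by case: fintype.splitP => j _;
    [exact: clin_comp (clin_fst _ _) (cl j)|exact: clin_comp (clin_snd _ _) (cl' j)].
rewrite big_split_ord/=.
under eq_bigr do rewrite (unsplitK (inl _)).
under [X in _ = _ + X]eq_bigr do rewrite (unsplitK (inr _)).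
rewrite {1}(ce v) {1}(ce' w).
have E1 := clin_inl V W; have E2 := clin_inr V W.
rewrite [LHS](_ : _ = (\sum_i c i v *: e i, 0) + (0, \sum_i c' i w *: e' i)); last first.
  by congr pair; rewrite /= ?addr0 ?add0r.
rewrite (clin_sum E1) (clin_sum E2).
by congr (_ + _); apply: eq_bigr => i _; [rewrite (clinZ E1)|rewrite (clinZ E2)].
Qed.

Lemma is_derive_line V W (f : V -> W) x v (r : R) :
  differentiable f (x + r *: v) ->
  is_derive r 1 (fun t : R => f (x + t *: v)) ('D_v f (x + r *: v)).
Proof.
move=> df; pose g (t : R) := x + t *: v.
have lg : clin (fun t : R => t *: v).
  split=> [a s t|t]; first by rewrite scalerDl scalerA.
  by apply: scalel_continuous.
have dg : differentiable g r.
  by apply: differentiable_fctD => //; have [] := clin_diff r lg.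
have eg : 'D_1 g r = v.
  have [d1 d2] := clin_diff r lg.
  by rewrite derive_fctD// derive_cst add0r deriveE// d2 scale1r.
split; first by apply: diff_derivable; exact: (@differentiable_comp _ _ _ _ g f).
by rewrite (derive_comp (f := g)) ?eg.
Qed.

Lemma line_MVT V (f : V -> R) x v :
  (forall r : R, 0 <= r <= 1 -> differentiable f (x + r *: v)) ->
  exists2 r : R, 0 < r < 1 & f (x + v) - f x = 'D_v f (x + r *: v).
Proof.
move=> df; pose g (t : R) := f (x + t *: v).
have D (r : R) : 0 <= r <= 1 -> is_derive r 1 g ('D_v f (x + r *: v)).
  by move=> r01; apply: is_derive_line; exact: df.
have D' (r : R) : r \in `]0, 1[%R -> is_derive r 1 g ('D_v f (x + r *: v)).
  by rewrite in_itv/= => /andP[r0 r1]; apply: D; rewrite !ltW.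
have [|r] := MVT (ltr01 : (0 : R) < 1) D'.
  apply: derivable_within_continuous => r; rewrite in_itv/= => /D [] //.
rewrite in_itv/= => r01; rewrite /g scale1r scale0r addr0 subr0 mulr1 => E.
by exists r.
Qed.

Lemma smooth_cont V W (A : set V) (f : V -> W) x : smooth A f -> A x ->
  {for x, continuous f}.
Proof. by move=> /(_ 0%N); apply. Qed.

Lemma smooth_diff V W (A : set V) (f : V -> W) x : smooth A f -> A x ->
  differentiable f x.
Proof. by move=> /(_ 1%N)[+ _]; apply. Qed.

Lemma smooth_D V W (A : set V) (f : V -> W) v : smooth A f -> smooth A ('D_v f).
Proof. by move=> sf k; exact: (sf k.+1).2. Qed.

Lemma smooth_nbhs V W (A : set V) (f : V -> W) x (B : set W) :
  smooth A f -> open A -> A x -> open B -> B (f x) ->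
  \forall y \near x, A y /\ B (f y).
Proof.
move=> sf oA Ax oB Bx; near=> y; split; near: y.
  exact: open_nbhs_nbhs.
by apply: (smooth_cont sf Ax); exact: open_nbhs_nbhs.
Unshelve. all: by end_near. Qed.

Lemma smooth_preimage V W (A : set V) (f : V -> W) (B : set W) :
  smooth A f -> open A -> open B -> open [set x | A x /\ B (f x)].
Proof.
move=> sf oA oB; rewrite openE => x /= [Ax Bx]; exact: (smooth_nbhs sf).
Qed.

(** By the mean value theorem, applied twice, the second difference quotient of
    [f] along [v] and [w] tends to ['D_w ('D_v f) u]; the quotient is symmetric
    in [v] and [w]. *)
Lemma clairaut_scalar V (A : set V) (f : V -> R) u x y : open A -> smooth A f ->
  A u -> 'D_x ('D_y f) u = 'D_y ('D_x f) u.
Proof.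
move=> oA sf Au.
have main v w : forall e : R, 0 < e -> \forall s \near (0 : R), 0 < s ->
   `|(f (u + s *: v + s *: w) - f (u + s *: v) - (f (u + s *: w) - f u)) / s ^+ 2
     - 'D_w ('D_v f) u| < e.
  move=> e e0.
  have sDv : smooth A ('D_v f) by exact: smooth_D.
  have sD : smooth A ('D_w ('D_v f)) by exact: smooth_D.
  have nA : \forall z \near u, A z /\ `|'D_w ('D_v f) u - 'D_w ('D_v f) z| < e.
    near=> z; split; near: z; first exact: open_nbhs_nbhs.
    by have /cvgrPdist_lt := smooth_cont sD Au; apply.
  have /nbhs_ballP[r /= r0 rA] := nA.
  near=> s => s0.
  have inA (a b : R) : 0 <= a <= 1 -> 0 <= b <= 1 ->
     ball u r (u + (a * s) *: v + (b * s) *: w).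
    move=> /andP[a0 a1] /andP[b0 b1]; rewrite -ball_normE/= opprD addrA opprD addrA.
    rewrite subrr add0r -opprD normrN.
    apply: (@le_lt_trans _ _ (s * (`|v| + `|w|))).
      rewrite mulrDr (le_trans (ler_normD _ _))// !normrZ.
      rewrite (ger0_norm a0) (ger0_norm b0) (ger0_norm (ltW s0)).
      by apply: lerD; apply: ler_wpM2r => //; rewrite ler_piMl ?(ltW s0).
    apply: (@le_lt_trans _ _ (s * (`|v| + `|w| + 1))).
      by rewrite ler_pM2l// lerDl.
    rewrite -ltr_pdivlMr; last by rewrite ltr_wpDl ?addr_ge0.
    apply: le_lt_trans (ler_norm s) _; near: s; apply: (@nbhs0_lt _ R^o).
    by rewrite divr_gt0// ltr_wpDl ?addr_ge0.
  pose g z := f (z + s *: w) - f z.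
  have dfA z : ball u r z -> differentiable f z.
    by move=> /rA[Az _]; exact: smooth_diff sf Az.
  have dfs z : differentiable f (z + s *: w) ->
     differentiable (fun t => f (t + s *: w)) z /\
     'D_(s *: v) (fun t => f (t + s *: w)) z = 'D_(s *: v) f (z + s *: w).
    move=> dz; have ds : differentiable (fun t : V => t + s *: w) z.
      exact: differentiable_fctD.
    split; first exact: (@differentiable_comp _ _ _ _ (fun t => t + s *: w) f).
    rewrite (derive_comp (f := fun t => t + s *: w))//.
    by rewrite derive_fctD// derive_id derive_cst addr0.
  have [a a01 Ea] : exists2 a : R, 0 < a < 1 &
      g (u + s *: v) - g u = 'D_(s *: v) g (u + a *: (s *: v)).
    apply: (@line_MVT V g u (s *: v)) => a a01; apply: differentiableB.
      apply: (dfs _ _).1; rewrite scalerA -[s *: w](scale1r) scalerA.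
      by apply: dfA; apply: inA => //; rewrite lexx ler01.
    apply: dfA; rewrite scalerA.
    by have := inA a 0; rewrite mul0r scale0r addr0; apply => //; rewrite lexx ler01.
  have a01' : 0 <= a <= 1 by case/andP: a01 => /ltW -> /ltW ->.
  have d1 : ball u r (u + a *: (s *: v) + s *: w).
    by have := inA a 1; rewrite mul1r scalerA; apply => //; rewrite lexx ler01.
  have d2 : ball u r (u + a *: (s *: v)).
    by have := inA a 0; rewrite mul0r scale0r addr0 scalerA; apply => //; rewrite lexx ler01.
  have [d3 e3] := dfs _ (dfA _ d1).
  have Eg : 'D_(s *: v) g (u + a *: (s *: v)) =
      s * ('D_v f (u + a *: (s *: v) + s *: w) - 'D_v f (u + a *: (s *: v))).
    rewrite /g deriveB; [|exact: diff_derivable|by apply: diff_derivable; exact: dfA].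
    by rewrite e3 !(clinZ (clin_derive (dfA _ _))) ?mulrBr.
  have [b b01 Eb] : exists2 b : R, 0 < b < 1 &
      'D_v f (u + a *: (s *: v) + s *: w) - 'D_v f (u + a *: (s *: v)) =
      'D_(s *: w) ('D_v f) (u + a *: (s *: v) + b *: (s *: w)).
    apply: (@line_MVT V ('D_v f) (u + a *: (s *: v)) (s *: w)) => b b01.
    apply: (smooth_diff sDv).
    by rewrite !scalerA; have [] := rA _ (inA a b a01' b01).
  have b01' : 0 <= b <= 1 by case/andP: b01 => /ltW -> /ltW ->.
  have [Ab nb] := rA _ (inA a b a01' b01').
  rewrite (_ : _ / _ = 'D_w ('D_v f) (u + (a * s) *: v + (b * s) *: w)); last first.
    rewrite -/(g (u + s *: v)) -/(g u) Ea Eg Eb -!scalerA.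
    rewrite (clinZ (clin_derive _)); last first.
      by apply: (smooth_diff sDv); rewrite !scalerA.
    move: ('D_w _ _) => q; rewrite -[s *: q]/(s * q) mulrA -expr2 mulrAC mulfV ?mul1r//.
    by rewrite expf_neq0// gt_eqF.
  by rewrite distrC.
apply/eqP; rewrite -subr_eq0 -normr_le0; apply/ler_addgt0Pl => e e0; rewrite addr0.
have e20 : 0 < e / 2 by rewrite divr_gt0.
pose P v w (s : R) := 0 < s ->
   `|(f (u + s *: v + s *: w) - f (u + s *: v) - (f (u + s *: w) - f u)) / s ^+ 2
     - 'D_w ('D_v f) u| < e / 2.
have N1 : nbhs (0 : R) (P y x) := main y x _ e20.
have N2 : nbhs (0 : R) (P x y) := main x y _ e20.
have N12 : nbhs (0 : R) (P y x `&` P x y) by exact: filterI.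
have /nbhs_ballP[r /= r0 rP] := N12.
pose s := r / 2.
have s0 : 0 < s by rewrite divr_gt0.
have [] : (P y x `&` P x y) s.
  apply: rP; rewrite -ball_normE/= sub0r normrN gtr0_norm//.
  by rewrite /s ltr_pdivrMr// ltr_pMr// ltr1n.
move=> /(_ s0) H1 /(_ s0) H2.
move: H1 H2.
rewrite (_ : f (u + s *: y + s *: x) - f (u + s *: y) - (f (u + s *: x) - f u) =
  f (u + s *: x + s *: y) - f (u + s *: x) - (f (u + s *: y) - f u)); last first.
  rewrite [u + s *: y + s *: x]addrAC.
  by move: (f _) (f (u + s *: y)) (f (u + s *: x)) (f u) => p1 p2 p3 p4; ring.
set q := _ / _ => H1 H2.
move: H1 H2; move: q ('D_y _ u) ('D_x _ u) => q p1 p2 H1 H2.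
rewrite (_ : p2 - p1 = (q - p1) - (q - p2)); last by ring.
rewrite (splitr e) (le_trans (ler_normB _ _))// addrC lerD// ltW//.
Unshelve. all: by end_near. Qed.

Lemma clairaut V W (A : set V) (f : V -> W) u x y : has_frame W -> open A ->
  smooth A f -> A u -> 'D_x ('D_y f) u = 'D_y ('D_x f) u.
Proof.
move=> [m [e [c [cl ce]]]] oA sf Au.
apply: (frame_eq ce) => i.
have E v w : c i ('D_v ('D_w f) u) = 'D_v ('D_w (fun t => c i (f t))) u.
  rewrite -(derive_lin _ (cl i)); last first.
    by apply: (@smooth_diff _ _ A) => //; exact: smooth_D.
  apply: (derive_eq_open _ oA Au) => t At; rewrite (derive_lin _ (cl i))//.
  exact: smooth_diff sf At.
rewrite !E; apply: (clairaut_scalar _ _ oA) => // k.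
by apply: Ck_lin => //; exact: sf.
Qed.

Lemma ball_line V (u x y : V) (r t : R) : ball u r x -> ball u r y ->
  0 <= t <= 1 -> ball u r (x + t *: (y - x)).
Proof.
rewrite -!ball_normE/= => ux uy /andP[t0 t1].
rewrite (_ : u - _ = (1 - t) *: (u - x) + t *: (u - y)); last first.
  rewrite scalerBl scale1r -addrA [- _ + _]addrC -scalerBr.
  have -> : u - y - (u - x) = x - y by rewrite opprB addrC addrA subrK.
  by rewrite opprD addrA -scalerN opprB.
have r0 : 0 < r by exact: le_lt_trans ux.
rewrite (le_lt_trans (ler_normD _ _))// !normrZ (ger0_norm t0) ger0_norm ?subr_ge0//.
have [->|tn0] := eqVneq t 0; first by rewrite subr0 mul1r mul0r addr0.
have tp : 0 < t by rewrite lt_neqAle eq_sym tn0.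
rewrite (_ : r = (1 - t) * r + t * r); last by ring.
by rewrite ler_ltD// ?ltr_pM2l// ler_wpM2l ?subr_ge0// ltW.
Qed.

(** Coordinatewise mean value theorem; it is the convexity of the ball that
    matters ([ball_line]). *)
Lemma derive0_cst V W (u : V) (r : R) (f : V -> W) : has_frame W ->
  (forall x, ball u r x -> differentiable f x) ->
  (forall x v, ball u r x -> 'D_v f x = 0) ->
  forall x y, ball u r x -> ball u r y -> f x = f y.
Proof.
move=> [m [e [c [cl ce]]]] df Df x y ux uy.
apply: (frame_eq ce) => i.
have [|t t01] := @line_MVT _ (fun z => c i (f z)) x (y - x).
  move=> t t01; apply: differentiable_lin => //.
  by apply: df; exact: ball_line.
have bt : ball u r (x + t *: (y - x)).
  by apply: ball_line => //; case/andP: t01 => /ltW -> /ltW ->.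
rewrite [x + (y - x)]addrC subrK (derive_lin _ (cl i)); last exact: df.
by rewrite Df// (clin0 (cl i)) => /subr0_eq.
Qed.

(** * The implicit function theorem *)
Lemma line_mono V (f : V -> R) (x e : V) (d a b : R) :
  (forall r : R, `|r| <= d -> differentiable f (x + r *: e) /\
     0 < 'D_e f (x + r *: e)) ->
  - d <= a -> a < b -> b <= d -> f (x + a *: e) < f (x + b *: e).
Proof.
move=> H da ab bd.
have inD t : 0 <= t <= 1 -> `|a + t * (b - a)| <= d.
  move=> /andP[t0 t1].
  have h1 : 0 <= t * (b - a) by rewrite mulr_ge0// subr_ge0 ltW.
  have h2 : t * (b - a) <= b - a by rewrite ler_piMl// subr_ge0 ltW.
  by rewrite ler_norml; apply/andP; split; lra.
have E t : x + a *: e + t *: ((b - a) *: e) = x + (a + t * (b - a)) *: e.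
  by rewrite scalerA -addrA -scalerDl.
have [|t /andP[t0 t1]] := @line_MVT _ f (x + a *: e) ((b - a) *: e).
  by move=> t t01; rewrite E; have [] := H _ (inD _ t01).
have E1 : x + a *: e + (b - a) *: e = x + b *: e.
  by rewrite -addrA -scalerDl [a + _]addrC subrK.
rewrite E E1 => /(canRL (subrK _)) ->.
have [|d1 d2] := H (a + t * (b - a)); first by apply: inD; rewrite !ltW.
by rewrite ltrDr (clinZ (clin_derive d1)) mulr_gt0 ?subr_gt0.
Qed.

Lemma clin_bounded V (l : V -> R) : clin l ->
  exists2 M : R, 0 < M & forall h, `|l h| <= M * `|h|.
Proof.
move=> [ll lc].
pose lM := GRing.isLinear.Build _ _ _ _ _ ll.
pose L : {linear _ -> _} := HB.pack l lM.
have [M M0 HM] := @linear_lipschitz _ _ _ L lc.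
by exists M.
Qed.

Lemma differentiable_eps V W (f : V -> W) x : differentiable f x ->
  forall e : R, 0 < e -> \forall h \near (0 : V),
      `|f (h + x) - f x - 'D_h f x| <= e * `|h|.
Proof.
move=> df e e0; have := diff_locally df => /eqaddoP/(_ e e0).
by apply: filterS => h /=; rewrite !fctE/= opprD addrA deriveE.
Qed.

(** Expanding [f] at [z := x + tau x *: e], the equation
    [f (y + tau y *: e) = 0] reads 'D_h f z + s al = o(|h| + |s|), where
    [s := tau (x + h) - tau x] and [al := 'D_e f z]. Continuity of [tau] makes
    [s] small, which first gives s = O(|h|), then s = - al^-1 'D_h f z + o(|h|). *)
Lemma implicit_diff V (f : V -> R) (e : V) (tau : V -> R) x :
  differentiable f (x + tau x *: e) -> 'D_e f (x + tau x *: e) != 0 ->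
  {for x, continuous tau} ->
  (\forall y \near x, f (y + tau y *: e) = 0) -> differentiable tau x.
Proof.
set z := x + tau x *: e => df De ct f0.
have cD := clin_derive df.
set al := 'D_e f z in De *.
have [M M0 HM] := clin_bounded cD.
apply/differentiable_epsP; exists (fun h => - al^-1 * 'D_h f z); split.
  exact: clin_comp cD (clin_mulr _).
move=> ep ep0.
have al0 : 0 < `|al| by rewrite normr_gt0.
pose C : R := 2 * (M + 1) / `|al|.
have C0 : 0 <= C by rewrite divr_ge0 ?mulr_ge0 ?addr_ge0 ?ltW.
(* At most 1 to compare e1 * |h| with |h|; the second bound absorbs the term in
   |s| into |s| * |al| / 2, which gives |s| <= C * |h|; the third is what the
   final estimate then asks for. *)
pose e1 : R := Num.min 1 (Num.min (`|al| / (2 * (`|e| + 1)))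
                                   (ep * `|al| / (1 + C * `|e|))).
have e10 : 0 < e1.
  have c1 : 0 < 1 + C * `|e| by rewrite ltr_pwDl// mulr_ge0.
  have c2 : 0 < `|e| + 1 by rewrite ltr_wpDl.
  by rewrite !lt_min ltr01/= !divr_gt0 ?mulr_gt0.
have := differentiable_eps df e10 => nH.
pose k (h : V) := h + (tau (h + x) - tau x) *: e.
have ck : k h @[h --> (0 : V)] --> (0 : V).
  have E0 : (0 : V) + (tau x - tau x) *: e = 0 by rewrite subrr scale0r addr0.
  rewrite -[X in _ --> X]E0; apply: cvgD; first exact: cvg_id.
  apply: cvgZr_tmp; apply: cvgB; last exact: cvg_cst.
  have : tau (h + x) @[h --> (0 : V)] --> tau (0 + x).
    apply: (@continuous_comp _ _ _ (fun h : V => h + x) tau).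
      by apply: cvgD; [exact: cvg_id|exact: cvg_cst].
    by rewrite add0r.
  by rewrite add0r.
have nS : \forall h \near (0 : V), f (h + x + tau (h + x) *: e) = 0.
  have : h + x @[h --> (0 : V)] --> (0 : V) + x.
    by apply: cvgD; [exact: cvg_id|exact: cvg_cst].
  by rewrite add0r => cx; exact: (cx _ f0).
have nk := ck _ nH.
near=> h.
have nkh : `|f (k h + z) - f z - 'D_(k h) f z| <= e1 * `|k h| by near: h.
have nSh : f (h + x + tau (h + x) *: e) = 0 by near: h.
have fz : f z = 0 by exact: nbhs_singleton f0.
have kz : k h + z = h + x + tau (h + x) *: e.
  by rewrite /k /z scalerBl addrACA subrK.
move: nkh; rewrite kz nSh fz subrr sub0r normrN (clinD cD) (clinZ cD) -/al.
set s := tau (h + x) - tau x; rewrite /GRing.scale/= => nkh.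
have kh : `|k h| <= `|h| + `|s| * `|e|.
  by rewrite /k (le_trans (ler_normD _ _))// normrZ.
have e11 : e1 <= 1 by rewrite ge_min lexx.
have e12 : e1 * `|e| <= `|al| / 2.
  have : e1 <= `|al| / (2 * (`|e| + 1)) by rewrite !ge_min lexx orbT.
  rewrite ler_pdivlMr ?mulr_gt0 ?ltr_wpDl// => H.
  rewrite ler_pdivlMr//; apply: le_trans H.
  by rewrite -mulrA ler_pM2l// mulrC ler_pM2l// lerDl.
have e13 : e1 * (1 + C * `|e|) <= ep * `|al|.
  have : e1 <= ep * `|al| / (1 + C * `|e|) by rewrite !ge_min lexx !orbT.
  by rewrite ler_pdivlMr// ltr_pwDl// mulr_ge0.
have b1 : `|s| * `|al| <= M * `|h| + e1 * (`|h| + `|s| * `|e|).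
  rewrite -normrM (_ : s * al = ('D_h f z + s * al) - 'D_h f z); last by ring.
  rewrite (le_trans (ler_normB _ _))// addrC lerD//.
  by rewrite (le_trans nkh)// ler_wpM2l// ltW.
have b2 : `|s| <= C * `|h|.
  rewrite /C mulrAC ler_pdivlMr//.
  have h0 : 0 <= `|h| by [].
  have s0 : 0 <= `|s| by [].
  have : `|s| * (e1 * `|e|) <= `|s| * (`|al| / 2) by exact: ler_wpM2l.
  have : e1 * `|h| <= `|h| by exact: ler_piMl.
  move: b1; lra.
rewrite -/s (_ : s - _ = al^-1 * ('D_h f z + s * al)); last by field.
rewrite normrM normfV ler_pdivrMl// mulrA [`|al| * _]mulrC.
rewrite (le_trans nkh)// (le_trans (ler_wpM2l (ltW e10) kh))//.
apply: le_trans (_ : e1 * (1 + C * `|e|) * `|h| <= _); last exact: ler_wpM2r.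
rewrite -mulrA ler_pM2l// mulrDl mul1r lerD2l mulrAC.
exact: ler_wpM2r.
Unshelve. all: by end_near. Qed.

(** The zeros of [f] on the lines of direction [e], without splitting the space:
    if ['D_e f] does not vanish at a zero [x0], each line of direction [e] near
    [x0] has exactly one zero near [x0]. It exists by the intermediate value
    theorem, is unique and depends continuously on the line because [f] is
    strictly monotone along it, and is differentiable by [implicit_diff]; the
    formula for the derivative then gives smoothness by induction. The function
    [tau] measures the way from a point to the zero on its line. *)
Lemma implicit_function V (A : set V) (f : V -> R) (x0 e : V) : has_frame V ->
  open A -> A x0 -> smooth A f -> f x0 = 0 -> 'D_e f x0 != 0 ->
  exists (B : set V) (d : R) (tau : V -> R),
    [/\ open B, B x0, 0 < d, smooth B tau &
     forall x, B x -> `|tau x| < d /\ forall r : R, `|r| < d ->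
       [/\ A (x + r *: e), 'D_e f (x + r *: e) != 0 &
           f (x + r *: e) = 0 <-> r = tau x]].
Proof.
move=> frV oA Ax0.
(* Replacing [f] by [- f], it increases along [e]. *)
wlog De : f / 0 < 'D_e f x0.
  move=> wl sf f0 De0; have [De|De|] := ltgtP ('D_e f x0) 0; last 2 first.
  - exact: wl.
  - by move=> E; move: De0; rewrite E eqxx.
  have sNf : smooth A (fun x => - f x).
    move=> k; have C := Ck_bil oA cbil_mul (Ck_cst k A (-1 : R)) (sf k).
    by apply: Ck_ext C => // x _; rewrite mulN1r.
  have DN x : A x -> 'D_e (fun y => - f y) x = - 'D_e f x.
    by move=> Ax; rewrite deriveN//; apply: diff_derivable; exact: smooth_diff Ax.
  have [|||B [d [tau [oB Bx d0 st H]]]] := wl (fun x => - f x) _ sNf _ _.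
  - by rewrite DN// oppr_gt0.
  - by rewrite f0 oppr0.
  - by rewrite DN// oppr_eq0.
  exists B, d, tau; split=> // x /H[t0 Hx]; split=> // r /Hx[Ar Dr fr].
  split=> //; first by move: Dr; rewrite DN// oppr_eq0.
  by rewrite -fr; split=> [->|/eqP]; [rewrite oppr0|rewrite oppr_eq0 => /eqP].
move=> sf f0 _.
have sD : smooth A ('D_e f) by exact: smooth_D.
have oP : open [set x | A x /\ [set y : R | 0 < y] ('D_e f x)].
  by apply: (smooth_preimage sD oA); exact: open_gt.
have /nbhs_ballP[eta /= eta0 etaP] : nbhs x0 [set x | A x /\ 0 < 'D_e f x].
  by apply: open_nbhs_nbhs; split.
pose d : R := eta / (2 * (`|e| + 1)).
have e1 : 0 < `|e| + 1 by rewrite ltr_wpDl.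
have d0 : 0 < d by rewrite divr_gt0// mulr_gt0.
have inP x r : ball x0 (eta / 2) x -> `|r| <= d ->
    A (x + r *: e) /\ 0 < 'D_e f (x + r *: e).
  move=> bx rd; apply: etaP; rewrite -ball_normE/=.
  rewrite opprD addrA (le_lt_trans (ler_normB _ _))// normrZ [ltRHS]splitr.
  apply: ltr_leD; first by move: bx; rewrite -ball_normE.
  apply: le_trans (_ : d * (`|e| + 1) <= _).
    by apply: ler_pM => //; rewrite lerDl.
  by rewrite /d invfM mulrA mulfVK ?gt_eqF.
have b0 : ball x0 (eta / 2) x0 by apply: ballxx; rewrite divr_gt0.
have H x : ball x0 (eta / 2) x -> forall r : R, `|r| <= d ->
    differentiable f (x + r *: e) /\ 0 < 'D_e f (x + r *: e).
  move=> bx r rd; have [Ar Dr] := inP _ _ bx rd; split=> //.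
  exact: smooth_diff Ar.
have dd : `|d| <= d by rewrite gtr0_norm.
have Ndd : `|- d| <= d by rewrite normrN.
have cline x (r : R) : ball x0 (eta / 2) x -> `|r| <= d ->
    {for x, continuous (fun y => f (y + r *: e))}.
  move=> bx rd; apply: (@continuous_comp _ _ _ (fun y => y + r *: e) f).
    by apply: cvgD; [exact: cvg_id|exact: cvg_cst].
  by apply: (smooth_cont sf); have [] := inP _ _ bx rd.
pose B := [set x | ball x0 (eta / 2) x /\
  (0 < f (x + d *: e) /\ f (x + (- d) *: e) < 0)].
have oB : open B.
  rewrite openE => x /= [bx [fp fn]].
  near=> y; split; first by near: y; apply: open_nbhs_nbhs; split => //; exact: ball_open.
  split; near: y.
    by have /cvgr_gt := cline _ _ bx dd; apply.
  by have /cvgr_lt := cline _ _ bx Ndd; apply.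
have Bx0 : B x0.
  have E0 : f (x0 + 0 *: e) = 0 by rewrite scale0r addr0.
  by split=> //; rewrite -E0; split;
    apply: line_mono (H _ b0) _ _ _ => //; rewrite ?oppr_le0 ?oppr_lt0 ?(ltW d0).
have ex x : B x -> exists2 r : R, `|r| < d & f (x + r *: e) = 0.
  move=> [bx [fp fn]].
  have dd' : - d <= d by rewrite ge0_cp ?ltW.
  have [||r] := @IVT R (fun r => f (x + r *: e)) (- d) d 0 dd'.
  - apply: derivable_within_continuous => r; rewrite in_itv/= -ler_norml => rd.
    by have [df _] := H _ bx _ rd; have [] := is_derive_line df.
  - by rewrite ge_min le_max (ltW fp) (ltW fn) orbT.
  rewrite in_itv/= => /andP[r1 r2] fr; exists r => //.
  rewrite ltr_norml !lt_neqAle r1 r2 !andbT; apply/andP; split.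
    by apply/eqP => E; move: fn; rewrite E fr ltxx.
  by apply/eqP => E; move: fp; rewrite -E fr ltxx.
pose tau x := xget 0 [set r : R | `|r| < d /\ f (x + r *: e) = 0].
have tauP x : B x -> `|tau x| < d /\ f (x + tau x *: e) = 0.
  move=> /ex[r rd fr]; rewrite /tau.
  by case: xgetP => [? -> //|/(_ r)]; case.
have mono x (a b : R) : B x -> - d <= a -> a < b -> b <= d ->
    f (x + a *: e) < f (x + b *: e).
  by move=> [bx _]; exact: line_mono (H _ bx).
have tauE x (r : R) : B x -> `|r| < d -> f (x + r *: e) = 0 <-> r = tau x.
  move=> Bx rd; have [td ft] := tauP _ Bx; split=> [fr|->//].
  move: rd td; rewrite !ltr_norml => /andP[r1 r2] /andP[t1 t2].
  have [rt|tr|//] := ltgtP r (tau x).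
    by have := mono x _ _ Bx (ltW r1) rt (ltW t2); rewrite fr ft ltxx.
  by have := mono x _ _ Bx (ltW t1) tr (ltW r2); rewrite fr ft ltxx.
have ct x : B x -> {for x, continuous tau}.
  move=> Bx; have [td ft] := tauP _ Bx.
  apply/cvgrPdist_lt => ep ep0.
  pose m : R := Num.min ep (d - `|tau x|).
  have m0 : 0 < m by rewrite lt_min ep0 subr_gt0.
  have tm (r : R) : `|r| <= m -> `|tau x + r| <= d.
    rewrite le_min => /andP[_ rm]; rewrite (le_trans (ler_normD _ _))//.
    by rewrite -lerBrDl.
  have mm : `|m| <= m by rewrite gtr0_norm.
  have Nmm : `|- m| <= m by rewrite normrN.
  have [tm1 tm2] := (tm _ mm, tm _ Nmm).
  have m1 : 0 < f (x + (tau x + m) *: e).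
    rewrite -ft; apply: mono => //; last by move: tm1; rewrite ler_norml => /andP[].
      by move: td; rewrite ltr_norml => /andP[/ltW].
    by rewrite ltrDl.
  have m2 : f (x + (tau x - m) *: e) < 0.
    rewrite -[ltRHS]ft; apply: mono => //; first by move: tm2; rewrite ler_norml => /andP[].
      by rewrite ltrBlDr ltrDl.
    by move: td; rewrite ltr_norml => /andP[_ /ltW].
  near=> y.
  have By : B y by near: y; exact: open_nbhs_nbhs.
  have [tyd fy] := tauP _ By.
  have y1 : 0 < f (y + (tau x + m) *: e).
    by near: y; have /cvgr_gt := cline _ _ Bx.1 tm1; apply.
  have y2 : f (y + (tau x - m) *: e) < 0.
    by near: y; have /cvgr_lt := cline _ _ Bx.1 tm2; apply.
  apply: lt_le_trans (_ : m <= _); last by rewrite ge_min lexx.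
  have := And3 tyd tm1 tm2; rewrite ltr_norml !ler_norml => -[/andP[ty1 ty2] /andP[q1 q2] /andP[q3 q4]].
  rewrite ltr_norml; apply/andP; split.
    rewrite ltrBrDr addrC ltrBlDr; rewrite ltNge; apply/negP => le1.
    have [E|lt1] : tau y = tau x + m \/ tau x + m < tau y.
    + by move: le1; rewrite le_eqVlt => /orP[/eqP ->|]; [left|right].
    + by move: y1; rewrite -E fy ltxx.
    by have := mono y _ _ By q1 lt1 (ltW ty2); rewrite fy ltNge (ltW y1).
  rewrite ltrBlDl -ltrBlDr ltNge; apply/negP => le1.
  have [E|lt1] : tau y = tau x - m \/ tau y < tau x - m.
  + by move: le1; rewrite le_eqVlt => /orP[/eqP ->|]; [left|right].
  + by move: y2; rewrite -E fy ltxx.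
  by have := mono y _ _ By (ltW ty1) lt1 q4; rewrite fy ltNge (ltW y2).
have td1 x : B x -> `|tau x| <= d by move=> /tauP[/ltW].
have Az x : B x -> A (x + tau x *: e) by move=> Bx; have [] := inP _ _ Bx.1 (td1 _ Bx).
have Dz x : B x -> 'D_e f (x + tau x *: e) != 0.
  by move=> Bx; have [_ /lt0r_neq0] := inP _ _ Bx.1 (td1 _ Bx).
have dt x : B x -> differentiable tau x.
  move=> Bx; apply: (@implicit_diff _ f e tau x); [|exact: Dz|exact: ct|].
    exact: smooth_diff (Az _ Bx).
  near=> y; apply: (tauP _ _).2; near: y; exact: open_nbhs_nbhs.
have Dt x v : B x -> 'D_v tau x =
    - ('D_e f (x + tau x *: e))^-1 * 'D_v f (x + tau x *: e).
  move=> Bx; have dtx := dt _ Bx; set z := x + tau x *: e.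
  have dte : differentiable (fun y => tau y *: e) x.
    exact: (differentiable_bil (cbil_scale V)).
  have dg : differentiable (fun y => y + tau y *: e) x by exact: differentiable_fctD.
  have Dg : 'D_v (fun y => y + tau y *: e) x = v + 'D_v tau x *: e.
    rewrite derive_fctD// derive_id; congr (_ + _).
    by rewrite (derive_bil _ (cbil_scale V))// derive_cst scaler0 addr0.
  have dfz : differentiable f z by exact: smooth_diff (Az _ Bx).
  have := derive_comp v dg dfz; rewrite Dg (clinD (clin_derive dfz)) (clinZ (clin_derive dfz)).
  rewrite (@derive_eq_open _ _ B _ (fun=> 0))// ?derive_cst; last first.
    by move=> y By; have [_] := tauP _ By.
  rewrite /GRing.scale/= => E; have Dz0 := Dz _ Bx; rewrite -/z in Dz0 *.
  have -> : 'D_v f z = - ('D_v tau x * 'D_e f z).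
    by apply/eqP; rewrite -subr_eq0 opprK -E.
  by field.
have st : smooth B tau.
  elim=> [|k IH]; first exact: ct.
  split; first exact: dt.
  move=> v.
  have C1 : Ck k B (fun y => y + tau y *: e).
    apply: CkD => //; last by apply: (Ck_bil oB (cbil_scale V)) => //; exact: Ck_cst.
    by apply: Ck_clin; split=> // ?; exact: cvg_id.
  have C2 : Ck k B (fun y => 'D_e f (y + tau y *: e)).
    exact: (Ck_comp frV oB oA Az C1 (sD k)).
  have C3 : Ck k B (fun y => 'D_v f (y + tau y *: e)).
    exact: (Ck_comp frV oB oA Az C1 (smooth_D v sf k)).
  have C4 : Ck k B (fun y => ('D_e f (y + tau y *: e))^-1) by exact: Ck_inv.
  have C5 := Ck_bil oB cbil_mul (Ck_cst k B (-1 : R)) (Ck_bil oB cbil_mul C4 C3).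
  by apply: Ck_ext C5 => // y By; rewrite Dt// mulN1r mulNr.
exists B, d, tau; split=> // x Bx; split; first by have [] := tauP _ Bx.
move=> r rd; have [Ar Dr] := inP _ _ Bx.1 (ltW rd); split=> //.
  by rewrite gt_eqF.
exact: tauE.
Unshelve. all: by end_near. Qed.
End Calculus.

(** * Symmetric forms satisfying a Gauss equation *)
Section Dot.
Context {R : realType} {n : nat}.
Implicit Types x y z v w : 'rV[R]_n.

Definition dot v w : R := \sum_(i < n) v ord0 i * w ord0 i.

Lemma dotC v w : dot v w = dot w v.
Proof. by apply: eq_bigr => i _; rewrite mulrC. Qed.

Lemma dotDl u v w : dot (u + v) w = dot u w + dot v w.
Proof. by rewrite -big_split/=; apply: eq_bigr => i _; rewrite mxE mulrDl. Qed.

Lemma dotZl a v w : dot (a *: v) w = a * dot v w.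
Proof. by rewrite /dot mulr_sumr; apply: eq_bigr => i _; rewrite mxE mulrA. Qed.

Lemma dotDr u v w : dot w (u + v) = dot w u + dot w v.
Proof. by rewrite !(dotC w) dotDl. Qed.

Lemma dotZr a v w : dot w (a *: v) = a * dot w v.
Proof. by rewrite !(dotC w) dotZl. Qed.

Lemma dot_ge0 v : 0 <= dot v v.
Proof. by apply: sumr_ge0 => i _; rewrite -expr2 sqr_ge0. Qed.

Lemma dot_eq0 v : (dot v v == 0) = (v == 0).
Proof.
apply/idP/eqP => [|->]; last by rewrite /dot big1// => i _; rewrite mxE mul0r.
rewrite psumr_eq0 => [/allP H|i _]; last by rewrite -expr2 sqr_ge0.
apply/rowP => i; rewrite mxE; have /= := H i (mem_index_enum _).
by rewrite -expr2 sqrf_eq0 => /eqP.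
Qed.

Lemma dot_gt0 v : v != 0 -> 0 < dot v v.
Proof. by move=> v0; rewrite lt_neqAle dot_ge0 eq_sym dot_eq0 v0. Qed.

Lemma dot_delta v i : dot v (delta_mx 0 i) = v ord0 i.
Proof.
rewrite /dot (bigD1 i)//= mxE !eqxx mulr1 big1 ?addr0// => j ji.
by rewrite mxE (negbTE ji) andbF mulr0.
Qed.

Lemma exists_orthogonal k (g : 'I_k -> 'rV[R]_n) : (k < n)%N ->
  exists2 q, dot q q = 1 & forall j, dot q (g j) = 0.
Proof.
move=> kn; pose M : 'M[R]_(n, k) := \matrix_(i, j) g j ord0 i.
have : kermx M != 0.
  rewrite -mxrank_eq0 mxrank_ker -lt0n subn_gt0.
  exact: leq_ltn_trans (rank_leq_col _) kn.
case/rowV0Pn => q /sub_kermxP qM q0.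
have qp := dot_gt0 q0.
exists ((Num.sqrt (dot q q))^-1 *: q) => [|j].
  rewrite dotZl dotZr mulrA -invfM -expr2 sqr_sqrtr ?ltW// mulVf// gt_eqF//.
rewrite dotZl; have := congr1 (fun A : 'rV_k => A ord0 j) qM.
rewrite !mxE => E; rewrite [dot q (g j)](_ : _ = 0) ?mulr0//.
by rewrite -[RHS]E; apply: eq_bigr => i _; rewrite mxE.
Qed.

Record symform (B : 'rV[R]_n -> 'rV[R]_n -> R) : Prop := Symform {
  symfC : forall x y, B x y = B y x;
  symfD : forall x y z, B (x + y) z = B x z + B y z;
  symfZ : forall a x z, B (a *: x) z = a * B x z }.

(** The Gauss equation for orthogonal arguments. There the metric part of the
    curvature drops out, so that adding a multiple of [dot] to [B] preserves the
    property. *)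
Definition gauss_form (B : 'rV[R]_n -> 'rV[R]_n -> R) := forall x y z w,
  dot x y = 0 -> dot x z = 0 -> dot x w = 0 -> dot y z = 0 -> dot y w = 0 ->
  dot z w = 0 -> B x z * B y w = B x w * B y z.

Section RankOne.
Variable (B : 'rV[R]_n -> 'rV[R]_n -> R).
Hypotheses (n4 : (4 <= n)%N) (sB : symform B) (gB : gauss_form B).
Let BC := symfC sB.
Let BD := symfD sB.
Let BZ := symfZ sB.
Let BDr x y z : B z (x + y) = B z x + B z y.
Proof. by rewrite !(BC z) BD. Qed.
Let BZr a x z : B z (a *: x) = a * B z x.
Proof. by rewrite !(BC z) BZ. Qed.
Let BE := (BD, BZ, BDr, BZr).
Let dotE := (dotDl, dotZl, dotDr, dotZr).

Let orth3 x y z : exists2 q, dot q q = 1 &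
  [/\ dot q x = 0, dot q y = 0 & dot q z = 0].
Proof.
have [q q1 qg] := exists_orthogonal
  (fun j : 'I_3 => nth 0 [:: x; y; z] j) n4.
exists q => //; split; [exact: (qg ord0)| |].
  by have := qg (inord 1); rewrite inordK.
by have := qg (inord 2); rewrite inordK.
Qed.

(* The relation assumed at [p], the vanishing of a minor of [B], spreads to all
   [y] orthogonal to [a] and [b]: if [y] has length [s] and is orthogonal to [p],
   then [y + s *: p] and [y - s *: p] are orthogonal, and the Gauss equation for
   these two and [a], [b] compares the minors at [y] and at [p]. *)
Let perp a b p : dot a a = 1 -> dot b b = 1 -> dot p p = 1 ->
  dot a b = 0 -> dot a p = 0 -> dot b p = 0 -> B a b != 0 ->
  B p p * B a b = B p a * B p b ->
  forall y z, dot y a = 0 -> dot y b = 0 -> dot z a = 0 -> dot z b = 0 ->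
  B y z * B a b = B y a * B z b.
Proof.
move=> aa bb pp ab ap bp Bab Bp.
have orth y z : dot y a = 0 -> dot y b = 0 -> dot z a = 0 -> dot z b = 0 ->
    dot y z = 0 -> B y z * B a b = B y a * B z b.
  move=> ya yb za zb yz.
  have := @gB z a y b; rewrite (dotC a y) (dotC z y).
  move=> /(_ za yz zb ya ab yb) E.
  by rewrite BC E (BC a) mulrC.
have diag y : dot y a = 0 -> dot y b = 0 -> dot y p = 0 ->
    B y y * B a b = B y a * B y b.
  move=> ya yb yp; pose s := Num.sqrt (dot y y).
  have ss : s * s = dot y y by rewrite -expr2 sqr_sqrtr// dot_ge0.
  have := @gB (y + s *: p) a (y + (- s) *: p) b.
  rewrite !dotE (dotC p a) (dotC p b) (dotC a y) (dotC p y) ya yb yp ap bp pp ab.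
  rewrite !(mulr0, addr0, add0r) => /(_ erefl).
  have -> : dot y y + s * (- s * 1) = 0 by rewrite -ss; ring.
  move=> /(_ erefl erefl erefl erefl erefl).
  rewrite !BE.
  have E1 := orth y p ya yb (etrans (dotC _ _) ap) (etrans (dotC _ _) bp) yp.
  have E2 := orth p y (etrans (dotC _ _) ap) (etrans (dotC _ _) bp) ya yb (etrans (dotC _ _) yp).
  rewrite (BC p y) in E2 *; rewrite (BC a y) (BC a p) => E.
  have : B y y * B a b - B y a * B y b = s * s * (B p p * B a b - B p a * B p b).
    have := congr1 (fun t => t * s) E1; have := congr1 (fun t => t * s) E2.
    move: E; move: (B y y) (B y p) (B p p) (B y a) (B y b) (B p a) (B p b) (B a b).
    move=> *; lra.
  by rewrite Bp subrr mulr0 => /subr0_eq.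
move=> y z ya yb za zb.
have diag' v : dot v a = 0 -> dot v b = 0 -> B v v * B a b = B v a * B v b.
  move=> va vb; pose c := dot v p; pose v' := v + (- c) *: p.
  have v'a : dot v' a = 0 by rewrite !dotE va (dotC p) ap mulr0 addr0.
  have v'b : dot v' b = 0 by rewrite !dotE vb (dotC p) bp mulr0 addr0.
  have v'p : dot v' p = 0 by rewrite !dotE pp mulr1 subrr.
  have ve : v = c *: p + v' by rewrite addrC /v' scaleNr subrK.
  have E1 := orth v' p v'a v'b (etrans (dotC _ _) ap) (etrans (dotC _ _) bp) v'p.
  have E2 := orth p v' (etrans (dotC _ _) ap) (etrans (dotC _ _) bp) v'a v'b (etrans (dotC _ _) v'p).
  have E3 := diag _ v'a v'b v'p.
  clearbody v'; rewrite ve !BE; have := congr1 ( *%R (c * c)) Bp.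
  by have := congr1 ( *%R c) E1; have := congr1 ( *%R c) E2; move: E3; lra.
have [->|y0] := eqVneq y 0.
  by rewrite -(scale0r 0) !BZ !mul0r.
pose c := dot z y / dot y y; pose z' := z + (- c) *: y.
have yy0 : dot y y != 0 by rewrite dot_eq0.
have z'a : dot z' a = 0 by rewrite !dotE za ya mulr0 addr0.
have z'b : dot z' b = 0 by rewrite !dotE zb yb mulr0 addr0.
have yz' : dot y z' = 0 by rewrite !dotE /c (dotC y z) mulNr mulfVK// subrr.
have ze : z = c *: y + z' by rewrite addrC /z' scaleNr subrK.
have E1 := orth _ _ ya yb z'a z'b yz'.
have E2 := diag' _ ya yb.
by clearbody z'; rewrite ze !BE; have := congr1 ( *%R c) E2; move: E1; lra.
Qed.

(* The same with one argument equal to [a]; [q] is orthogonal to [a], [b], [z],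
   which takes dimension four at least, and the orthogonal pair is [a + q], [a - q]. *)
Let side a b p : dot a a = 1 -> dot b b = 1 -> dot p p = 1 ->
  dot a b = 0 -> dot a p = 0 -> dot b p = 0 -> B a b != 0 ->
  B p p * B a b = B p a * B p b ->
  forall z, dot z a = 0 -> dot z b = 0 -> B a z * B a b = B a a * B z b.
Proof.
move=> aa bb pp ab ap bp Bab Bp z za zb.
have P := perp aa bb pp ab ap bp Bab Bp.
have [q qq [qa qb qz]] := orth3 a b z.
have G s : s * s = 1 ->
    (B a a - B q q) * B b z = (B a z + s * B q z) * (B a b - s * B q b).
  move=> ss; have := @gB (a + s *: q) b (a + (- s) *: q) z.
  rewrite !dotE (dotC a q) (dotC b q) (dotC a z) (dotC b z) (dotC b a) ab qa qb qz za zb aa qq.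
  rewrite !(mulr0, addr0, add0r) => /(_ erefl).
  have -> : 1 + s * (- s * 1) = 0 by rewrite mulr1 mulrN ss subrr.
  move=> /(_ erefl erefl erefl erefl erefl).
  rewrite !BE (BC q a) (BC b a) (BC b q) => E.
  by have := congr1 (fun t => t * (B q q * B b z)) ss; move: E; lra.
have G1 := G 1 (mulr1 1); have G2 := G (-1) ltac:(by rewrite mulrNN mulr1).
have Pq := P q q qa qb qa qb; have Pqz := P q z qa qb za zb.
have Pzq := P z q za zb qa qb.
have : B a b * (B a a * B z b - B a z * B a b) = 0.
  have : B a a * B b z - B q q * B b z = B a z * B a b - B q z * B q b by lra.
  rewrite (BC b z) => E.
  have -> : B a b * (B a a * B z b - B a z * B a b) =
    B a b * (B q q * B z b - B q z * B q b).
    by congr (_ * _); lra.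
  have -> : B a b * (B q q * B z b - B q z * B q b) =
     (B q q * B a b) * B z b - (B q z * B a b) * B q b by ring.
  by rewrite Pq Pqz; ring.
by move=> /eqP; rewrite mulf_eq0 (negbTE Bab) subr_eq0 => /eqP ->.
Qed.

(** From dimension four on, a Gauss form with one nonzero entry [B a b] off the
    diagonal has rank one as soon as it satisfies the rank one relation once, at
    a unit vector [p] orthogonal to [a] and [b]. Adding a multiple of [dot] to a
    Gauss form makes that relation true, and leaves [B a b] unchanged. *)
Lemma rank_one_form a b p : dot a a = 1 -> dot b b = 1 -> dot p p = 1 ->
  dot a b = 0 -> dot a p = 0 -> dot b p = 0 -> B a b != 0 ->
  B p p * B a b = B p a * B p b ->
  forall y z, B y z * B a b = B y a * B z b.
Proof.
move=> aa bb pp ab ap bp Bab Bp.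
have P := perp aa bb pp ab ap bp Bab Bp.
have S1 := side aa bb pp ab ap bp Bab Bp.
have S2 : forall z, dot z a = 0 -> dot z b = 0 -> B b z * B a b = B b b * B z a.
  move=> z za zb; have := side bb aa pp; rewrite (BC b a) (dotC b a).
  by move=> /(_ ab bp ap Bab); rewrite [B p b * _]mulrC => /(_ Bp z zb za).
have S3 : B a b * B a b = B a a * B b b.
  have [q qq [qa qb qp]] := orth3 a b p.
  have pa : dot p a = 0 by rewrite dotC.
  have pb : dot p b = 0 by rewrite dotC.
  (* Four orthogonal vectors, as all of [a], [b], [p], [q] are unit vectors. *)
  have := @gB (a + p) (b + q) (a + (-1) *: p) (b + (-1) *: q).
  rewrite !dotE (dotC a q) (dotC b q) (dotC p q) (dotC b a) aa bb pp qq ab ap bp pa pb qa qb qp.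
  rewrite !(mulr0, addr0, add0r, mulr1, mulN1r, oppr0, subrr) => /(_ erefl erefl erefl erefl erefl erefl).
  rewrite !BE (BC q b) (BC p a) (BC b a) (BC q a) (BC p b) (BC q p).
  have Ppp := P p p pa pb pa pb; have Pqq := P q q qa qb qa qb.
  have Ppq := P p q pa pb qa qb; have Pqp := P q p qa qb pa pb.
  have Sp := S1 p pa pb; have Sq := S1 q qa qb.
  have Tp := S2 p pa pb; have Tq := S2 q qa qb.
  rewrite (BC p a) in Ppp Ppq Tp; rewrite (BC q a) in Pqq Pqp Tq.
  rewrite (BC p b) in Ppp Pqp Sp; rewrite (BC q b) in Pqq Ppq Sq; rewrite (BC q p) in Pqp.
  move: Bab Ppp Pqq Ppq Pqp Sp Sq Tp Tq.
  move: (B a a) (B a b) (B b b) (B p p) (B q q) (B p q) (B a p) (B a q) (B b p) (B b q).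
  move=> kaa kab kbb kpp kqq kpq kap kaq kbp kbq k0 Ppp Pqq Ppq Pqp Sp Sq Tp Tq E.
  have E1 : kaa * kqq = kaq * kaq.
    apply: (mulfI k0); have -> : kab * (kaa * kqq) = kaa * (kqq * kab) by ring.
    by rewrite Pqq mulrCA [kaa * _]mulrC mulrA -mulrA [_ * kaa]mulrC -Sq; ring.
  have E2 : kbb * kpp = kbp * kbp.
    apply: (mulfI k0); have -> : kab * (kbb * kpp) = kbb * (kpp * kab) by ring.
    by rewrite Ppp mulrA -Tp; ring.
  have E3 : kpp * kqq = kpq * kpq.
    apply: (mulfI k0); apply: (mulfI k0).
    have -> : kab * (kab * (kpp * kqq)) = (kpp * kab) * (kqq * kab) by ring.
    have -> : kab * (kab * (kpq * kpq)) = (kpq * kab) * (kpq * kab) by ring.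
    by rewrite {1}Ppq Pqp Ppp Pqq; ring.
  have E4 : kab * kpq = kbp * kaq by rewrite mulrC Pqp mulrC.
  move: E; lra.
move=> y z.
pose y' := y + (- dot y a) *: a + (- dot y b) *: b.
pose z' := z + (- dot z a) *: a + (- dot z b) *: b.
have dec v : v = dot v a *: a + dot v b *: b +
    (v + (- dot v a) *: a + (- dot v b) *: b).
  rewrite [RHS]addrC !scaleNr -addrA [dot v a *: a + _]addrC addrA.
  by rewrite addrA subrK subrK.
have da v : dot (v + (- dot v a) *: a + (- dot v b) *: b) a = 0.
  by rewrite !dotE aa (dotC b a) ab mulr0 mulr1 addr0 subrr.
have db v : dot (v + (- dot v a) *: a + (- dot v b) *: b) b = 0.
  by rewrite !dotE bb ab mulr0 mulr1 addr0 subrr.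
have Pyz := P y' z' (da y) (db y) (da z) (db z).
have Sz := S1 z' (da z) (db z).
have Ty := S2 y' (da y) (db y).
rewrite (dec y) (dec z) -/y' -/z'; clearbody y' z'; move: (dot y a) (dot y b) (dot z a) (dot z b).
move=> c1 c2 c3 c4; rewrite !BE (BC b a).
move: Pyz Sz Ty; rewrite (BC b y') (BC b z').
move: S3; move: (B a a) (B a b) (B b b) (B y' z') (B y' a) (B y' b) (B z' a) (B z' b).
rewrite (BC a z').
move=> kaa kab kbb kyz kya kyb kza kzb S3 Pyz Sz Ty.
have := congr1 ( *%R (c1 * c4)) S3; have := congr1 ( *%R c1) Sz.
by have := congr1 ( *%R c4) Ty; move: Pyz; lra.
Qed.
End RankOne.

(** A form that vanishes on orthogonal pairs is a multiple of [dot]: for two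
    orthogonal vectors of the same length, their sum and difference are
    orthogonal, so that [B] takes the same value on them. *)
Lemma nonscalar_form (B : 'rV[R]_n -> 'rV[R]_n -> R) : (0 < n)%N -> symform B ->
  ~ (exists l, forall x y, B x y = l * dot x y) ->
  exists a b, [/\ dot a a = 1, dot b b = 1, dot a b = 0 & B a b != 0].
Proof.
move=> n0 sB nB; apply: contrapT => nab; apply: nB.
have [BC BD BZ] := sB.
have BDr x y z : B z (x + y) = B z x + B z y by rewrite !(BC z) BD.
have BZr a x z : B z (a *: x) = a * B z x by rewrite !(BC z) BZ.
have B0l z : B 0 z = 0 by rewrite -(scale0r 0) BZ mul0r.
have orth x y : dot x y = 0 -> B x y = 0.
  move=> xy; have [->|x0] := eqVneq x 0; first exact: B0l.
  have [->|y0] := eqVneq y 0; first by rewrite BC B0l.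
  apply: contrapT => /eqP Bxy; apply: nab.
  have unit v : v != 0 -> exists2 c : R, c != 0 & dot (c *: v) (c *: v) = 1.
    move=> v0; have vp := dot_gt0 v0; exists (Num.sqrt (dot v v))^-1.
      by rewrite invr_neq0// gt_eqF// sqrtr_gt0.
    rewrite dotZl dotZr mulrA -invfM -expr2 sqr_sqrtr ?ltW// mulVf// gt_eqF//.
  have [c c0 cx] := unit _ x0; have [d d0 dy] := unit _ y0.
  exists (c *: x), (d *: y); split=> //; first by rewrite dotZl dotZr xy !mulr0.
  by rewrite BZ BZr !mulf_neq0.
have [e e1 _] := exists_orthogonal (fun j : 'I_0 => 0) n0.
exists (B e e).
have diag v : B v v = B e e * dot v v.
  pose c := dot v e; pose v' := v + (- c) *: e.
  have v'e : dot v' e = 0 by rewrite dotDl dotZl e1 mulr1 subrr.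
  have ve : v = c *: e + v' by rewrite addrC /v' scaleNr subrK.
  have E1 := orth _ _ v'e.
  pose s := Num.sqrt (dot v' v').
  have ss : s * s = dot v' v' by rewrite -expr2 sqr_sqrtr// dot_ge0.
  have E2 : B v' v' = B e e * dot v' v'.
    clearbody v'; have := orth (v' + s *: e) (v' + (- s) *: e).
    rewrite !(dotDl, dotDr, dotZl, dotZr) (dotC e v') v'e e1 -ss.
    rewrite !(mulr0, addr0, add0r, mulr1) mulrN subrr => /(_ erefl).
    rewrite !(BD, BDr, BZ, BZr) (BC e v') E1 !(mulr0, addr0, add0r) => E.
    by move: E; lra.
  clearbody v'.
  rewrite ve !(BD, BDr, BZ, BZr) !(dotDl, dotDr, dotZl, dotZr).
  by rewrite (BC e v') E1 (dotC e v') v'e e1 E2; ring.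
move=> x y; have := diag (x + y).
by rewrite !(BD, BDr) !(dotDl, dotDr) (diag x) (diag y) (BC y x) (dotC y x); lra.
Qed.
End Dot.

(** * The scalar product of Minkowski space *)
Section MinkAlg.
Context {R : realType} {n : nat}.
Implicit Types x y z w v : 'rV[R]_n.+1.

Definition eta : 'rV[R]_n.+1 := \row_i (if i == ord_max then -1 else 1).

Lemma minkE x y : mink x y = \sum_i eta ord0 i * (x ord0 i * y ord0 i).
Proof.
rewrite big_ord_recr/= /mink; congr (_ + _).
  apply: eq_bigr => i _; rewrite mxE ifF ?mul1r//.
  by apply/negbTE; rewrite neq_ltn /= ltn_ord.
by rewrite mxE eqxx mulN1r.
Qed.

Lemma minkC x y : mink x y = mink y x.
Proof. by rewrite !minkE; apply: eq_bigr => i _; rewrite [y _ _ * _]mulrC. Qed.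

Lemma minkDl x y z : mink (x + y) z = mink x z + mink y z.
Proof.
rewrite !minkE -big_split/=; apply: eq_bigr => i _.
by rewrite [(x + y) _ _]mxE mulrDl mulrDr.
Qed.

Lemma minkZl a x z : mink (a *: x) z = a * mink x z.
Proof.
rewrite !minkE mulr_sumr; apply: eq_bigr => i _.
by rewrite [(a *: x) _ _]mxE; ring.
Qed.

Lemma minkDr x y z : mink z (x + y) = mink z x + mink z y.
Proof. by rewrite !(minkC z) minkDl. Qed.

Lemma minkZr a x z : mink z (a *: x) = a * mink z x.
Proof. by rewrite !(minkC z) minkZl. Qed.

Lemma minkNl x z : mink (- x) z = - mink x z.
Proof. by rewrite -scaleN1r minkZl mulN1r. Qed.

Lemma minkNr x z : mink z (- x) = - mink z x.
Proof. by rewrite !(minkC z) minkNl. Qed.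

Lemma mink0l z : mink 0 z = 0.
Proof. by rewrite -(scale0r 0) minkZl mul0r. Qed.

Lemma mink0r z : mink z 0 = 0.
Proof. by rewrite minkC mink0l. Qed.

Lemma mink_suml m (g : 'I_m -> 'rV[R]_n.+1) z :
  mink (\sum_i g i) z = \sum_i mink (g i) z.
Proof.
by elim/big_ind2 : _ => [|x1 x2 y1 y2 <- <-|//]; [exact: mink0l|rewrite minkDl].
Qed.

Definition mink_lin := (minkDl, minkDr, minkZl, minkZr, minkNl, minkNr).

Lemma mink_continuous : continuous (fun p : 'rV[R]_n.+1 * 'rV[R]_n.+1 => mink p.1 p.2).
Proof.
have -> : (fun p : 'rV[R]_n.+1 * 'rV[R]_n.+1 => mink p.1 p.2) =
  (fun p => \sum_i eta ord0 i * (p.1 ord0 i * p.2 ord0 i)).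
  by apply/funext => p; rewrite minkE.
have C : Ck 0 setT (fun p : ('rV[R]_n.+1 * 'rV[R]_n.+1)%type =>
    \sum_i eta ord0 i * (p.1 ord0 i * p.2 ord0 i)).
  apply: (Ck_sum openT) => i.
  apply: (Ck_bil openT cbil_mul (Ck_cst _ _ _)).
  apply: (Ck_bil openT cbil_mul); apply: Ck_clin.
    exact: clin_comp (clin_fst _ _) (clin_coord i).
  exact: clin_comp (clin_snd _ _) (clin_coord i).
by move=> p; exact: C.
Qed.

Lemma cbil_mink : cbil (@mink R n).
Proof.
split=> [z a x y|z a x y|]; [by rewrite minkDl minkZl|by rewrite minkDr minkZr|].
exact: mink_continuous.
Qed.

(** A family of [n.+1] vectors whose Gram matrix is diagonal without zeros on
    the diagonal is a basis: take determinants in the formula for the Gram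
    matrix. *)
Lemma mink_nondeg (g : 'I_n.+1 -> 'rV[R]_n.+1) y :
  (forall i j, i != j -> mink (g i) (g j) = 0) ->
  (forall i, mink (g i) (g i) != 0) ->
  (forall i, mink y (g i) = 0) -> y = 0.
Proof.
move=> goff gdiag yg.
pose G : 'M[R]_n.+1 := \matrix_(i, j) g i ord0 j.
pose E := diag_mx eta.
have GG : G *m E *m G^T = diag_mx (\row_i mink (g i) (g i)).
  apply/matrixP => i j; rewrite !mxE.
  have -> : \sum_k (G *m E) i k * G^T k j = mink (g i) (g j).
    rewrite minkE; apply: eq_bigr => k _.
    by rewrite mul_mx_diag !mxE; ring.
  by have [->|ij] := eqVneq i j; [rewrite mulr1n|rewrite mulr0n goff].
have uG : G^T \in unitmx.
  have : \det (G *m E *m G^T) != 0.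
    rewrite GG det_diag; apply/prodf_neq0 => i _.
    by rewrite mxE.
  by rewrite det_mulmx mulf_eq0 negb_or => /andP[_]; rewrite unitmxE unitfE.
have : y *m E *m G^T = 0.
  apply/rowP => j; rewrite !mxE -[RHS](yg j) minkE.
  by apply: eq_bigr => k _; rewrite mul_mx_diag !mxE; ring.
move/(congr1 (mulmx^~ (invmx G^T))); rewrite mulmxK// mul0mx => yE.
apply/rowP => i; have := congr1 (fun A : 'rV_n.+1 => A ord0 i) yE.
rewrite mul_mx_diag !mxE; case: ifP => _; last by rewrite mulr1.
by rewrite mulrN1 => /eqP; rewrite oppr_eq0 => /eqP.
Qed.

Lemma conformal_frame_nondeg (T : 'rV[R]_n -> 'rV[R]_n.+1) nu (rho : R) y :
  (forall v w : 'rV[R]_n, mink (T v) (T w) = rho * dot v w) ->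
  (forall v : 'rV[R]_n, mink (T v) nu = 0) -> mink nu nu = -1 -> rho != 0 ->
  (forall v : 'rV[R]_n, mink y (T v) = 0) -> mink y nu = 0 -> y = 0.
Proof.
move=> TT Tn nn r0 yT yn.
pose g (i : 'I_n.+1) := if unlift ord0 i is Some k then T (delta_mx 0 k) else nu.
apply: (@mink_nondeg g) => [i j|i|i].
- rewrite /g; case: unliftP => [i' ->|->]; case: unliftP => [j' ->|->] // ij.
  + have ij' : j' != i' by apply: contraNneq ij => ->.
    by rewrite TT dot_delta mxE eqxx /= (negbTE ij') mulr0.
  + by rewrite minkC.
- rewrite /g; case: unliftP => [i' _|_].
    by rewrite TT dot_delta mxE !eqxx mulr1.
  by rewrite nn oppr_eq0 oner_eq0.
by rewrite /g; case: unliftP => [i' _|_].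
Qed.

(** The reverse Cauchy-Schwarz inequality, from the usual one for the space
    components. *)
Lemma mink_timelike_orth v w : mink v v < 0 -> mink v w = 0 -> w != 0 ->
  0 < mink w w.
Proof.
pose sp x : 'rV[R]_n := \row_i x ord0 (widen_ord (leqnSn n) i).
have mE x y : mink x y = dot (sp x) (sp y) - x ord0 ord_max * y ord0 ord_max.
  by rewrite /mink; congr (_ - _); apply: eq_bigr => i _; rewrite !mxE.
rewrite !mE; set a := sp v; set b := sp w.
move: (erefl (v ord0 ord_max)) (erefl (w ord0 ord_max)).
move: {2 3}(v ord0 ord_max) {2 3}(w ord0 ord_max) => al be -> eb.
rewrite eb => vv /subr0_eq vw w0.
(* The squared norm of the part of [b] orthogonal to [a] is not negative. *)
have CS : dot a b * dot a b <= dot a a * dot b b.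
  have [->|a0] := eqVneq a 0.
    by rewrite -(scale0r 0) !dotZl !mul0r.
  have ap := dot_gt0 a0.
  have := dot_ge0 (dot a a *: b + (- dot a b) *: a).
  rewrite !(dotDl, dotDr, dotZl, dotZr) (dotC b a) => H.
  have : 0 <= dot a a * (dot a a * dot b b - dot a b * dot a b) by move: H; lra.
  by rewrite pmulr_rge0// subr_ge0.
have [b0|b0] := eqVneq b 0.
  have bb : dot b b = 0 by rewrite b0 -(scale0r 0) dotZl mul0r.
  have ab : dot a b = 0 by rewrite b0 -(scale0r 0) dotZr mul0r.
  have be0 : be = 0.
    move: vw; rewrite ab => /esym/eqP; rewrite mulf_eq0 => /orP[/eqP al0|/eqP//].
    by have := dot_ge0 a; move: vv; rewrite al0; lra.
  case/eqP: w0; apply/rowP => i; rewrite mxE.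
  case: (unliftP ord_max i) => [j ->|->]; last by rewrite eb.
  have := congr1 (fun A : 'rV_n => A ord0 j) b0; rewrite !mxE.
  congr (w ord0 _ = 0); apply: val_inj => /=.
  by rewrite /bump leqNgt ltn_ord.
have bp := dot_gt0 b0.
rewrite subr_gt0.
have aa := dot_ge0 a.
have al2 : 0 < al * al by lra.
rewrite -(ltr_pM2l al2).
have -> : al * al * (be * be) = dot a b * dot a b by rewrite vw; ring.
by rewrite (le_lt_trans CS)// ltr_pM2r//; lra.
Qed.
End MinkAlg.

(** * Hyperspheres as vectors *)
Section Lift.
Context {R : realType} {n : nat}.
Implicit Types x y z w v : 'rV[R]_n.+1.

(** Polyspherical coordinates: the vector (l, Y, m) stands for the hypersphere
    or hyperplane of equation m - 2 Y.x + l x.x = 0. *)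
Definition polyspherical : normedModType R := (R * 'rV[R]_n.+1 * R)%type.
Notation LV := polyspherical.
Implicit Types K L M : LV.

Lemma has_frame_polyspherical : has_frame LV.
Proof.
apply: has_frame_pair; last exact: has_frameR.
by apply: has_frame_pair; [exact: has_frameR|exact: has_frame_rV].
Qed.

(** Normalized so that [Q K (lift x) = 0] is the equation of the hypersphere [K];
    if [K] is not a hyperplane, its center is Y / l and its squared radius is
    [- Q K K / l ^+ 2]. *)
Definition Q K L : R := mink K.1.2 L.1.2 - 2^-1 * (K.1.1 * L.2 + K.2 * L.1.1).
Definition lift x : LV := (1, x, mink x x).

(** The derivative of [lift] at [x] in the direction [y]. *)
Definition dlift x y : LV := (0, y, 2 * mink x y).

(** The normal of [K] at [x]. At a common point of [K] and [L], the product of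
    their normals is [Q K L] ([mink_grad]). *)
Definition grad K x := K.1.2 - K.1.1 *: x.

Lemma QC K L : Q K L = Q L K.
Proof. by rewrite /Q minkC; ring. Qed.

Lemma QDl K L M : Q (K + L) M = Q K M + Q L M.
Proof. by rewrite /Q /= minkDl; ring. Qed.

Lemma QZl a K M : Q (a *: K) M = a * Q K M.
Proof. by rewrite /Q /= minkZl /GRing.scale/=; ring. Qed.

Lemma QDr K L M : Q M (K + L) = Q M K + Q M L.
Proof. by rewrite !(QC M) QDl. Qed.

Lemma QZr a K M : Q M (a *: K) = a * Q M K.
Proof. by rewrite !(QC M) QZl. Qed.

Lemma Q0l K : Q 0 K = 0.
Proof. by rewrite -(scale0r 0) QZl mul0r. Qed.

Lemma cbil_Q : cbil Q.
Proof.
split=> [M a K L|M a K L|]; [by rewrite QDl QZl|by rewrite QDr QZr|].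
pose c11 (p : LV) := p.1.1; pose c12 (p : LV) := p.1.2; pose c2 (p : LV) := p.2.
have l11 : clin c11 by exact: clin_comp (clin_fst _ _) (clin_fst _ _).
have l12 : clin c12 by exact: clin_comp (clin_fst _ _) (clin_snd _ _).
have l2 : clin c2 by exact: clin_snd.
have F (W : normedModType R) (l : LV -> W) : clin l ->
    Ck 0 setT (fun p : LV * LV => l p.1) /\ Ck 0 setT (fun p : LV * LV => l p.2).
  move=> ll; split; apply: Ck_clin; [exact: clin_comp (clin_fst _ _) ll|].
  exact: clin_comp (clin_snd _ _) ll.
have C1 := Ck_bil openT cbil_mink (F _ _ l12).1 (F _ _ l12).2.
have C2 := Ck_bil openT cbil_mul (F _ _ l11).1 (F _ _ l2).2.
have C3 := Ck_bil openT cbil_mul (F _ _ l2).1 (F _ _ l11).2.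
have C4 := CkD openT C1 (Ck_bil openT cbil_mul (Ck_cst 0 setT (- 2^-1 : R))
  (CkD openT C2 C3)).
move=> p; have := C4 p I; rewrite /Q.
by congr ({for _, continuous _}); apply/funext => q; congr (_ + _); exact: mulNr.
Qed.

Lemma Q_lift x y : Q (lift x) (lift y) = - 2^-1 * mink (x - y) (x - y).
Proof. by rewrite /Q /= !mink_lin (minkC y x); field. Qed.

Lemma Q_dlift x y z : Q (dlift x y) (dlift x z) = mink y z.
Proof. by rewrite /Q /=; ring. Qed.

Lemma Q_lift_dlift x y : Q (lift x) (dlift x y) = 0.
Proof. by rewrite /Q /=; field. Qed.

Lemma Q_lift0 x : Q (lift x) (lift x) = 0.
Proof. by rewrite Q_lift subrr mink0l mulr0. Qed.

Lemma Q_dliftE K x y : Q K (dlift x y) = mink (grad K x) y.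
Proof. by rewrite /Q /grad /= !mink_lin; field. Qed.

(** The normal of [K] at [x] is orthogonal to the directions tangent to [K]. If
    these leave no room for it, it vanishes, and [K] is the point sphere of [x]. *)
Lemma Q_decomp K x : Q K (lift x) = 0 ->
  (forall y, (forall w, Q K (dlift x w) = 0 -> mink y w = 0) -> y = 0) ->
  K = K.1.1 *: lift x.
Proof.
move=> Kx H; have g0 : grad K x = 0.
  by apply: H => w; rewrite Q_dliftE.
have E1 : K.1.2 = K.1.1 *: x by apply/eqP; rewrite -subr_eq0; apply/eqP.
move: Kx; case: K E1 g0 H => -[a Y] b /= -> _ _; rewrite /Q /= minkZl => E.
rewrite -[RHS]/(a * 1, a *: x, a * mink x x) mulr1; congr pair.
by move: E; lra.
Qed.

Lemma mink_grad K L x : mink (grad K x) (grad L x) =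
  Q K L - K.1.1 * Q L (lift x) - L.1.1 * Q K (lift x).
Proof. by rewrite /grad /Q /= !mink_lin (minkC x); field. Qed.

Lemma hypersphere_lift K x (z := (K.1.1)^-1 *: K.1.2) : K.1.1 != 0 ->
  mink (x - z) (x - z) = - 2 * Q K (lift x) / K.1.1 + Q K K / K.1.1 ^+ 2.
Proof.
by move=> l0; rewrite /z /Q /= !mink_lin (minkC x); field.
Qed.

Definition pencil_sphere K L : set 'rV[R]_n.+1 :=
  [set x | Q K (lift x) = 0 /\ Q L (lift x) = 0].

(** The hyperplane that cuts [K] along the pencil is the member of the pencil
    with first coordinate zero. Transversality comes from the member
    [L + t *: K] orthogonal to [K]: its normal [N] is orthogonal to [grad K x],
    and not isotropic, while the normal of the hyperplane is a combination of
    the two in which [N] has the nonzero coefficient [K.1.1]. *)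
Lemma pencil_codim2_sphere K L m q : K.1.1 != 0 -> 0 < m -> 0 < q ->
  Q K K = - m -> forall t : R, Q K (L + t *: K) = 0 -> Q (L + t *: K) (L + t *: K) = q ->
  (exists x, pencil_sphere K L x) -> codim2_sphere (pencil_sphere K L).
Proof.
move=> l0 m0 q0 KK t KL LL ne.
pose z := (K.1.1)^-1 *: K.1.2; pose r := Num.sqrt m / `|K.1.1|.
pose a := K.1.1 *: L.1.2 - L.1.1 *: K.1.2.
pose b := 2^-1 * (K.1.1 * L.2 - L.1.1 * K.2).
have r2 : r ^+ 2 = m / K.1.1 ^+ 2.
  by rewrite /r expr_div_n sqr_sqrtr ?ltW// real_normK// num_real.
have ab x : mink a x - b = K.1.1 * Q L (lift x) - L.1.1 * Q K (lift x).
  by rewrite /a /b /Q /= !mink_lin; field.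
exists z, r, a, b; split => //.
- by rewrite divr_gt0 ?sqrtr_gt0 ?normr_gt0.
- apply/seteqP; split=> x /=; rewrite /hypersphere /hyperplane /=.
    move=> [Kx Lx]; have := ab x; rewrite hypersphere_lift// Kx Lx KK r2.
    rewrite !mulr0 mul0r subrr add0r mulNr => /subr0_eq.
    by split.
  rewrite hypersphere_lift// KK r2 => -[Kx ax].
  have Kx0 : Q K (lift x) = 0.
    have : 2 * Q K (lift x) / K.1.1 = 0 by move: Kx; rewrite !mulNr; lra.
    by move=> /eqP; rewrite !mulf_eq0 invr_eq0 (negbTE l0) pnatr_eq0/= orbF => /eqP.
  have := ab x; rewrite ax Kx0 mulr0 subr0 subrr => /esym/eqP.
  by rewrite mulf_eq0 (negbTE l0)/= => /eqP.
move=> x [Kx Lx] s E.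
have xz : x - z = - (K.1.1)^-1 *: grad K x.
  rewrite /grad /z scalerBr scalerA mulNr mulVf// scaleN1r opprK scaleNr.
  by rewrite addrC.
have ag : a = K.1.1 *: grad (L + t *: K) x - (L + t *: K).1.1 *: grad K x.
  rewrite /grad /a /=; set l := K.1.1; set Y := K.1.2.
  rewrite !scalerBr !scalerDr !scalerDl !scalerA.
  rewrite /GRing.scale /= -/l.
  apply/rowP => i; rewrite !mxE; ring.
pose N := grad (L + t *: K) x.
have NN : mink N N = q.
  by rewrite mink_grad LL !(QDl, QZl) Kx Lx; ring.
have NK : mink (grad K x) N = 0.
  by rewrite mink_grad KL !(QDl, QZl) Kx Lx; ring.
rewrite -/N in ag; clearbody N; move: (grad K x) NK ag xz => G NK ag xz.
have := congr1 (fun v => mink v N) E; rewrite ag xz !mink_lin NN NK.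
rewrite !mulr0 subr0 => /eqP; rewrite mulf_eq0 (negbTE l0)/= => /eqP q00.
by move: q0; rewrite q00 ltxx.
Qed.

Lemma pencil_sphere_comb K L (t : R) :
  pencil_sphere (L + t *: K) K = pencil_sphere K L.
Proof.
apply/seteqP; split=> x; rewrite /pencil_sphere /= QDl QZl.
  by move=> [E Kx]; split=> //; move: E; rewrite Kx mulr0 addr0.
by move=> [-> ->]; rewrite mulr0 addr0.
Qed.

(** If [K] is a hyperplane but [L] is not, the intersection is a sphere cut out
    by a true hypersphere of the pencil which is space-like, [L + t *: K] for
    large [t]. If both are hyperplanes, it is a plane of codimension two. *)
Lemma pencil_codim2 K L : Q K K = -1 -> Q K L = 0 -> 0 < Q L L ->
  (exists x, pencil_sphere K L x) ->
  codim2_sphere (pencil_sphere K L) \/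
  K.1.1 = 0 /\ codim2_plane (pencil_sphere K L).
Proof.
move=> KK KL LL ne.
have [l0|l0] := eqVneq K.1.1 0; last first.
  left; apply: (@pencil_codim2_sphere _ _ 1 (Q L L) _ _ _ _ 0) => //;
  by rewrite scale0r addr0.
have [l1|l1] := eqVneq L.1.1 0.
  right; split=> //; exists K.1.2, (2^-1 * K.2), L.1.2, (2^-1 * L.2).
  have KE : mink K.1.2 K.1.2 = -1 by move: KK; rewrite /Q l0; lra.
  have KLE : mink K.1.2 L.1.2 = 0 by move: KL; rewrite /Q l0 l1; lra.
  have LE : 0 < mink L.1.2 L.1.2 by move: LL; rewrite /Q l1; lra.
  split; first by rewrite KE ltrN10.
    apply/seteqP; split=> x; rewrite /pencil_sphere /hyperplane /= /Q /= l0 l1;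
    by move=> [? ?]; split; lra.
  by move=> t E; move: LE; rewrite {1}E minkZl KLE mulr0 ltxx.
left.
(* Any [t] with [t ^+ 2 > q] makes [L + t *: K] space-like. *)
pose q := Q L L; pose t := q + 1.
have lt1 : (L + t *: K).1.1 != 0 by rewrite /= l0 scaler0 addr0.
rewrite -(pencil_sphere_comb K L t).
have LKt : Q (L + t *: K) (L + t *: K) = q - t ^+ 2.
  by rewrite !(QDl, QZl, QDr, QZr) (QC L K) KL KK -/q; ring.
pose m := t ^+ 2 - q.
have m0 : 0 < m by rewrite /m /t /q; move: LL; nra.
(* [K + s *: (L + t *: K)] is orthogonal to [L + t *: K], of norm [q / m]. *)
pose s := - t / m.
have sE : Q (L + t *: K) (K + s *: (L + t *: K)) = 0.
  rewrite QDr QZr LKt QDl QZl KK (QC L) KL /s -[q - _]opprB -/m.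
  by rewrite add0r mulrN1 mulrN mulfVK ?gt_eqF// opprK addNr.
apply: (@pencil_codim2_sphere _ _ m (q / m) _ _ _ _ s) => //.
- by rewrite divr_gt0.
- by rewrite LKt /m opprB.
- rewrite QDl QZl sE mulr0 addr0 QDr QZr KK QDr QZr KL KK /s /m.
  by rewrite add0r mulrN1; field; rewrite -/m gt_eqF.
by rewrite pencil_sphere_comb.
Qed.
End Lift.

(** * Directional derivatives *)

(** The directional derivative under an opaque head: comparing derivatives of
    one map in two different directions must not unfold the limits that define
    them. *)
HB.lock Definition dir (R : realType) (V W : normedModType R) (v : V)
  (f : V -> W) (x : V) : W := 'D_v f x.

Section Dir.
Context {R : realType}.
Implicit Types V W U : normedModType R.

Lemma dirE V W v (f : V -> W) : dir v f = 'D_v f.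
Proof. by rewrite dir.unlock. Qed.

Lemma dirEx V W v (f : V -> W) x : dir v f x = 'D_v f x.
Proof. by rewrite dirE. Qed.

Lemma smooth_dir V W (U : set V) (f : V -> W) v : smooth U f -> smooth U (dir v f).
Proof. by rewrite dirE; exact: smooth_D. Qed.

Lemma dir_eq_open V W (A : set V) (f g : V -> W) x v : open A -> A x ->
  (forall y, A y -> f y = g y) -> dir v f x = dir v g x.
Proof. by rewrite !dirE; exact: derive_eq_open. Qed.

Lemma dir_cst V W (x v : V) (w : W) : dir v (fun=> w) x = 0.
Proof. by rewrite dirE; exact: derive_cst. Qed.

Lemma dir_bil V W U V' (q : V -> W -> U) (f : V' -> V) (g : V' -> W) x v :
  cbil q -> differentiable f x -> differentiable g x ->
  dir v (fun y => q (f y) (g y)) x = q (dir v f x) (g x) + q (f x) (dir v g x).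
Proof. by rewrite !dirE => qb; exact: derive_bil. Qed.

Lemma dirD V W (f g : V -> W) x v : differentiable f x -> differentiable g x ->
  dir v (fun y => f y + g y) x = dir v f x + dir v g x.
Proof. by rewrite !dirE; exact: derive_fctD. Qed.

Lemma dirN V W (f : V -> W) x v : differentiable f x ->
  dir v (fun y => - f y) x = - dir v f x.
Proof. by rewrite !dirE => df; apply: deriveN; exact: diff_derivable. Qed.

Lemma dir_addl V W (f : V -> W) x v w : differentiable f x ->
  dir (v + w) f x = dir v f x + dir w f x.
Proof. by rewrite !dirE => df; rewrite (clinD (clin_derive df)). Qed.

Lemma dir_scale V W (f : V -> W) x a v : differentiable f x ->
  dir (a *: v) f x = a *: dir v f x.
Proof. by rewrite !dirE => df; rewrite (clinZ (clin_derive df)). Qed.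

Lemma dir_clairaut V W (A : set V) (f : V -> W) u x y : has_frame W -> open A ->
  smooth A f -> A u -> dir x (dir y f) u = dir y (dir x f) u.
Proof. by rewrite !dirE; exact: clairaut. Qed.

Lemma dir_comp V W U (f : V -> W) (g : W -> U) x v :
  differentiable f x -> differentiable g (f x) ->
  dir v (fun y => g (f y)) x = dir (dir v f x) g (f x).
Proof. by rewrite !dirE; exact: derive_comp. Qed.

Lemma dir_clin V W (l : V -> W) x v : clin l -> dir v l x = l v.
Proof. by rewrite dirE; exact: derive_clin. Qed.
End Dir.

(** * Curvature hyperspheres of flat light-like immersions *)
Section Riesz.
Context {R : realType} {n : nat}.

Lemma symform_riesz (B : 'rV[R]_n -> 'rV[R]_n -> R) y : symform B ->
  exists g, forall x, B x y = dot x g.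
Proof.
move=> [BC BD BZ]; exists (\row_i B (delta_mx 0 i) y) => x.
rewrite {1}[x]row_sum_delta /dot.
have -> : B (\sum_j x 0 j *: delta_mx 0 j) y = \sum_j B (x 0 j *: delta_mx 0 j) y.
  elim/big_ind2 : _ => [|x1 x2 y1 y2 <- <-|//]; last by rewrite BD.
  by rewrite -(scale0r 0) BZ mul0r.
by apply: eq_bigr => i _; rewrite BZ mxE.
Qed.
End Riesz.

Section Mobius.
Context {R : realType} {n : nat}.
Notation V := 'rV[R]_n.
Variables (LV : normedModType R) (Q : LV -> LV -> R).
Hypotheses (has_frame_LV : has_frame LV) (cbil_Q : cbil Q)
  (QC : forall K L, Q K L = Q L K).

Lemma qDl K L M : Q (K + L) M = Q K M + Q L M.
Proof. by have := cbil_l cbil_Q M 1 K L; rewrite !scale1r. Qed.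

Lemma q0l M : Q 0 M = 0.
Proof. by apply: (addrI (Q 0 M)); rewrite -qDl !addr0. Qed.

Lemma qZl a K M : Q (a *: K) M = a * Q K M.
Proof. by have := cbil_l cbil_Q M a K 0; rewrite !addr0 q0l addr0. Qed.

Lemma qDr K L M : Q M (K + L) = Q M K + Q M L.
Proof. by rewrite !(QC M) qDl. Qed.

Lemma qZr a K M : Q M (a *: K) = a * Q M K.
Proof. by rewrite !(QC M) qZl. Qed.

(** Moving frame of an immersion [F] into the light cone of [Q] with flat induced
    metric. Only these products, not the coordinates of the ambient space,
    matter for the curvature hypersphere. The last condition holds because [F],
    [N] and the derivatives of [F] span a hyperplane, whose orthogonal complement
    is then the line of [F]. *)
Record light_frame (U : set V) (F N : V -> LV) : Prop := LightFrame {
  lf_open : open U;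
  lf_F : smooth U F;
  lf_N : smooth U N;
  lf_FF : forall u, U u -> Q (F u) (F u) = 0;
  lf_dF : forall u v w, U u -> Q (dir v F u) (dir w F u) = dot v w;
  lf_NN : forall u, U u -> Q (N u) (N u) = -1;
  lf_NF : forall u, U u -> Q (N u) (F u) = 0;
  lf_NdF : forall u v, U u -> Q (N u) (dir v F u) = 0;
  lf_span : forall u X, U u -> Q X (F u) = 0 -> Q X (N u) = 0 ->
    (forall v, Q X (dir v F u) = 0) -> exists c, X = c *: F u }.

Definition second_form (F N : V -> LV) u x y := Q (dir x (dir y F) u) (N u).

Lemma smooth_Q (X : normedModType R) (U : set X) (A B : X -> LV) : open U -> smooth U A -> smooth U B ->
  smooth U (fun u => Q (A u) (B u)).
Proof. by move=> oU sA sB k; exact: (Ck_bil oU cbil_Q). Qed.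

Lemma derive_Q_cst (X : normedModType R) (U : set X) (A B : X -> LV) c u v : open U -> U u ->
  smooth U A -> smooth U B -> (forall u, U u -> Q (A u) (B u) = c) ->
  Q (dir v A u) (B u) = - Q (A u) (dir v B u).
Proof.
move=> oU Uu sA sB AB.
have := dir_eq_open v oU Uu AB; rewrite dir_cst.
rewrite (dir_bil _ cbil_Q); [|exact: smooth_diff sA Uu|exact: smooth_diff sB Uu].
by move=> /eqP; rewrite addr_eq0 => /eqP.
Qed.

Section Frame.
Variables (U : set V) (F N : V -> LV).
Hypothesis lf : light_frame U F N.
Let oU := lf_open lf.
Let sF := lf_F lf.
Let sN := lf_N lf.
Let sD v : smooth U (dir v F) := smooth_dir v sF.
Let sDD v w : smooth U (dir v (dir w F)) := smooth_dir v (sD w).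
Let H := second_form F N.

Lemma lf_D2C u x y : U u -> dir x (dir y F) u = dir y (dir x F) u.
Proof. by move=> Uu; exact: (dir_clairaut _ _ has_frame_LV oU sF Uu). Qed.

Lemma lf_dFF u v : U u -> Q (dir v F u) (F u) = 0.
Proof.
move=> Uu; have := derive_Q_cst v oU Uu sF sF (lf_FF lf).
by rewrite (QC (F u)); lra.
Qed.

Lemma lf_D2F u v w : U u -> Q (dir v (dir w F) u) (F u) = - dot w v.
Proof.
move=> Uu; rewrite (derive_Q_cst v oU Uu (sD w) sF (fun u => @lf_dFF u w)).
by rewrite (lf_dF lf).
Qed.

(** The metric is constant, so the expression is antisymmetric in [y], [z] as
    well as symmetric in [x], [y]: the Christoffel symbols of the flat metric
    vanish. *)
Lemma lf_D2dF u x y z : U u -> Q (dir x (dir y F) u) (dir z F u) = 0.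
Proof.
move=> Uu.
have A x' y' z' : Q (dir x' (dir y' F) u) (dir z' F u) = - Q (dir x' (dir z' F) u) (dir y' F u).
  by rewrite (derive_Q_cst x' oU Uu (sD y') (sD z') (fun u => @lf_dF _ _ _ lf u y' z')) QC.
have e1 := A x y z; rewrite (lf_D2C x z Uu) in e1.
have e2 := A z x y; rewrite (lf_D2C z y Uu) in e2.
have e3 := A y z x; rewrite (lf_D2C y x Uu) in e3.
by lra.
Qed.

(** Differentiating [lf_D2dF] and exchanging the third derivatives of [F]. *)
Lemma lf_gauss u x y z w : U u ->
  Q (dir x (dir z F) u) (dir y (dir w F) u) = Q (dir x (dir w F) u) (dir y (dir z F) u).
Proof.
move=> Uu.
have A x' y' : Q (dir y' (dir x' (dir z F)) u) (dir w F u) =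
    - Q (dir x' (dir z F) u) (dir y' (dir w F) u).
  exact: (derive_Q_cst y' oU Uu (sDD x' z) (sD w) (fun u => @lf_D2dF u x' z w)).
have := A x y; rewrite (dir_clairaut _ _ has_frame_LV oU (sD z) Uu) A.
by rewrite (QC (dir x (dir w F) u)); lra.
Qed.

Lemma second_form_sym u : U u -> symform (H u).
Proof.
move=> Uu; split=> [x y|x y z|a x z].
- by rewrite /H /second_form (lf_D2C x y Uu).
- by rewrite /H /second_form (dir_addl _ _ (smooth_diff (sD z) Uu)) qDl.
- by rewrite /H /second_form (dir_scale _ _ (smooth_diff (sD z) Uu)) qZl.
Qed.

(** In orthogonal directions the second derivative of [F] is orthogonal to [F]
    and to the derivatives of [F], hence a combination of [F] and [N] in which
    the coefficient of [N] is minus the second form. The products of such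
    derivatives are then minus the products of entries of the second form. *)
Lemma second_form_gauss u : U u -> gauss_form (H u).
Proof.
move=> Uu x y z w xy xz xw yz yw zw.
have dec v v' : dot v v' = 0 ->
    exists c, dir v (dir v' F) u = c *: F u + (- H u v v') *: N u.
  move=> vv'; have [||v0|c cE] := @lf_span _ _ _ lf u (dir v (dir v' F) u + H u v v' *: N u) Uu.
  - by rewrite qDl qZl lf_D2F// (lf_NF lf)// dotC vv' oppr0 mulr0 addr0.
  - by rewrite qDl qZl (lf_NN lf)// mulrN1 /H /second_form subrr.
  - by rewrite qDl qZl lf_D2dF// (lf_NdF lf)// mulr0 addr0.
  by exists c; rewrite -cE scaleNr addrK.
have prod v v' w' w'' : dot v v' = 0 -> dot w' w'' = 0 ->
    Q (dir v (dir v' F) u) (dir w' (dir w'' F) u) = - (H u v v' * H u w' w'').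
  move=> /dec[c ->] /dec[d ->].
  rewrite !(qDl, qDr, qZl, qZr) (lf_FF lf)// (QC (F u)) (lf_NF lf)// (lf_NN lf)//.
  by ring.
apply: oppr_inj; rewrite -!prod//; exact: lf_gauss.
Qed.

Lemma lf_dNdF u x y : U u -> Q (dir x N u) (dir y F u) = - H u x y.
Proof.
move=> Uu; rewrite (derive_Q_cst x oU Uu sN (sD y) (fun u => @lf_NdF _ _ _ lf u y)).
by rewrite QC.
Qed.

Lemma lf_dNF u x : U u -> Q (dir x N u) (F u) = 0.
Proof.
move=> Uu; rewrite (derive_Q_cst x oU Uu sN sF (lf_NF lf)) (lf_NdF lf)//.
exact: oppr0.
Qed.

Lemma lf_dNN u x : U u -> Q (dir x N u) (N u) = 0.
Proof.
move=> Uu; have := derive_Q_cst x oU Uu sN sN (lf_NN lf).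
by rewrite (QC (N u)); lra.
Qed.

Lemma smooth_second_form x y : smooth U (fun u => H u x y).
Proof. exact: (smooth_Q oU (sDD x y) sN). Qed.

Section CurvatureSphere.
Variables (a b p : V) (n4 : (4 <= n)%N).
Hypotheses (aa : dot a a = 1) (bb : dot b b = 1) (pp : dot p p = 1)
  (ab : dot a b = 0) (ap : dot a p = 0) (bp : dot b p = 0).
Let U1 := [set u | U u /\ [set r : R | r != 0] (H u a b)].
(** The multiple eigenvalue of the second form: the function [r] for which
    [H u x y - r * dot x y] satisfies the rank one relation of [rank_one_form]
    at [p]. *)
Definition principal u := H u p p - H u p a * H u p b / H u a b.
Definition curvature_sphere u : LV := N u + principal u *: F u.
Let Lam := principal.
Let K := curvature_sphere.
Let B u x y := H u x y - Lam u * dot x y.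

Lemma open_second_form_neq0 : open U1.
Proof.
by apply: (smooth_preimage (smooth_second_form a b) oU); exact: open_neq.
Qed.
Let oU1 := open_second_form_neq0.
Let U1U : U1 `<=` U. Proof. by move=> u []. Qed.

Lemma smooth_principal : smooth U1 Lam.
Proof.
have S x y : smooth U1 (fun u => H u x y).
  by move=> k; apply: Ck_sub U1U _; exact: smooth_second_form.
move=> k; rewrite /Lam /principal.
have C1 : Ck k U1 (fun u => (H u a b)^-1).
  by apply: Ck_inv oU1 _ (S a b k) => u [].
have C2 := Ck_bil oU1 cbil_mul (Ck_bil oU1 cbil_mul (S p a k) (S p b k)) C1.
have C3 := CkD oU1 (S p p k) (Ck_bil oU1 cbil_mul (Ck_cst k U1 (-1 : R)) C2).
by apply: Ck_ext C3 => // u _; rewrite mulN1r.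
Qed.

Let sF1 : smooth U1 F. Proof. by move=> k; exact: Ck_sub U1U (sF k). Qed.
Let sN1 : smooth U1 N. Proof. by move=> k; exact: Ck_sub U1U (sN k). Qed.

Lemma smooth_curvature_sphere : smooth U1 K.
Proof.
move=> k; apply: CkD => //; apply: (Ck_bil oU1 (cbil_scale _)) => //.
exact: smooth_principal.
Qed.
Let sK := smooth_curvature_sphere.

Let B_sym u : U1 u -> symform (B u).
Proof.
move=> /U1U Uu; have [HC HD HZ] := second_form_sym Uu.
split=> [x y|x y z|c x z]; rewrite /B.
- by rewrite HC dotC.
- by rewrite HD dotDl; ring.
- by rewrite HZ dotZl; ring.
Qed.

Let B_gauss u : U1 u -> gauss_form (B u).
Proof.
move=> /U1U Uu x y z w xy xz xw yz yw zw.
rewrite /B xz yw xw yz !mulr0 !subr0; exact: second_form_gauss.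
Qed.

Let Bab u : U1 u -> B u a b != 0.
Proof. by move=> [_]; rewrite /B ab mulr0 subr0. Qed.

Let B_rank u : U1 u -> forall y z, B u y z * B u a b = B u y a * B u z b.
Proof.
move=> Uu; have [_ Hab] := Uu; rewrite /= in Hab.
apply: (@rank_one_form _ _ (B u) n4 (B_sym Uu) (B_gauss Uu) a b p) => //.
  exact: Bab.
rewrite /B pp ab (dotC p a) ap (dotC p b) bp !mulr0 !subr0 mulr1 /Lam /principal.
by field.
Qed.

(** [B] is to the curvature hypersphere [K] what the second form is to [N]. *)
Lemma sphere_dF u x y : U1 u -> Q (dir x K u) (dir y F u) = - B u x y.
Proof.
move=> U1u; have Uu := U1U U1u.
have dL : differentiable Lam u by exact: smooth_diff smooth_principal U1u.
have dF : differentiable F u by exact: smooth_diff sF Uu.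
have dN : differentiable N u by exact: smooth_diff sN Uu.
have dLF := differentiable_bil (cbil_scale _) dL dF.
rewrite dirD// (dir_bil _ (cbil_scale _))// !(qDl, qZl) lf_dNdF//.
by rewrite (QC (F u)) lf_dFF// (lf_dF lf)// /B /Lam; ring.
Qed.

Lemma sphere_F u x : U1 u -> Q (dir x K u) (F u) = 0.
Proof.
move=> U1u; have Uu := U1U U1u.
have dL : differentiable Lam u by exact: smooth_diff smooth_principal U1u.
have dF : differentiable F u by exact: smooth_diff sF Uu.
have dN : differentiable N u by exact: smooth_diff sN Uu.
have dLF := differentiable_bil (cbil_scale _) dL dF.
rewrite dirD// (dir_bil _ (cbil_scale _))// !(qDl, qZl) lf_dNF//.
by rewrite lf_dFF// (lf_FF lf)//; ring.
Qed.

Lemma sphere_N u x : U1 u -> Q (dir x K u) (N u) = 0.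
Proof.
move=> U1u; have Uu := U1U U1u.
have dL : differentiable Lam u by exact: smooth_diff smooth_principal U1u.
have dF : differentiable F u by exact: smooth_diff sF Uu.
have dN : differentiable N u by exact: smooth_diff sN Uu.
have dLF := differentiable_bil (cbil_scale _) dL dF.
rewrite dirD// (dir_bil _ (cbil_scale _))// !(qDl, qZl) lf_dNN//.
by rewrite (QC (dir x F u)) (QC (F u)) (lf_NF lf)// (lf_NdF lf)//; ring.
Qed.

Let smoothB x y : smooth U1 (fun u => B u x y).
Proof.
move=> k; have C1 : Ck k U1 (fun u => H u x y).
  by apply: Ck_sub U1U _; exact: smooth_second_form.
have C2 := Ck_bil oU1 cbil_mul (smooth_principal k) (Ck_cst k U1 (- dot x y)).
by apply: Ck_ext (CkD oU1 C1 C2) => // u _; rewrite mulrN.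
Qed.

Let ker u y : U1 u -> B u y a = 0 -> forall z, B u y z = 0.
Proof.
move=> U1u ya z; have := B_rank U1u y z; rewrite ya mul0r => /eqP.
by rewrite mulf_eq0 (negbTE (Bab U1u)) orbF => /eqP.
Qed.

(* For [y], [z] in the kernel of [B u], the factors [B u y z], [B u y a] and
   [B u z b] of the rank one relation vanish, so that its derivative is that of
   [B y z] times [B u a b]. *)
Let dB_ker u x y z : U1 u -> B u y a = 0 -> B u z a = 0 ->
  dir x (fun u => B u y z) u = 0.
Proof.
move=> U1u ya za.
have d y' z' : differentiable (fun u => B u y' z') u.
  exact: smooth_diff (smoothB y' z') U1u.
have := @dir_eq_open _ _ _ _ _ (fun u => B u y a * B u z b) u x oU1 U1u
  (fun u U1u => B_rank U1u y z).
rewrite !(dir_bil _ cbil_mul)// (ker U1u ya z) (ker U1u za b) ya.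
rewrite !mul0r mulr0 !addr0 => /eqP.
by rewrite mulf_eq0 (negbTE (Bab U1u)) orbF => /eqP.
Qed.

(* The left-hand side is the derivative of [- B y z], which vanishes by [dB_ker],
   minus the product of [dir y K] and the second derivative of [F]. *)
Let dK_codazzi u x y z c : U1 u -> B u y a = 0 -> B u z a = 0 ->
  dir y K u = c *: F u -> Q (dir x (dir y K) u) (dir z F u) = c * dot z x.
Proof.
move=> U1u ya za Ky; have Uu := U1U U1u.
have d1 : differentiable (dir y K) u.
  by apply: (@smooth_diff _ _ _ U1) => //; exact: smooth_dir.
have d2 : differentiable (dir z F) u by exact: smooth_diff (sD z) Uu.
have := dir_bil x cbil_Q d1 d2; rewrite Ky qZl (QC (F u)) lf_D2F// mulrN.
have -> : dir x (fun u => Q (dir y K u) (dir z F u)) u = 0.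
  rewrite (@dir_eq_open _ _ _ _ _ (fun u => - B u y z) u x oU1 U1u); last first.
    by move=> v U1v; exact: sphere_dF.
  rewrite dirN; last exact: smooth_diff (smoothB y z) U1u.
  by rewrite dB_ker// oppr0.
by move=> /esym/eqP; rewrite subr_eq0 => /eqP.
Qed.

Let span0 u y : U1 u -> B u y a = 0 -> exists c, dir y K u = c *: F u.
Proof.
move=> U1u ya; have Uu := U1U U1u; apply: (lf_span lf) => //.
- exact: sphere_F.
- exact: sphere_N.
- by move=> v; rewrite sphere_dF// ker// oppr0.
Qed.

(** For [y] in the kernel of [B u], [dir y K u] is a multiple [c *: F u]. Take a
    unit vector [x] of the kernel orthogonal to [y]; it exists from
    dimension three on. The product of the mixed derivative of [K] along [x] and
    [y] with [dir x F u] is [c * dot x x] by one order of derivation and a multiple of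
    [dot x y] by the other, so [c = 0]. *)
Lemma sphere_ker u y : U1 u -> B u y a = 0 -> dir y K u = 0.
Proof.
move=> U1u ya; have [c cE] := span0 U1u ya.
have [g gE] := symform_riesz a (B_sym U1u).
have n2 : (2 < n)%N by exact: leq_trans n4.
have [x xx xg] := exists_orthogonal (fun j : 'I_2 => nth 0 [:: y; g] j) n2.
have xy : dot x y = 0 by exact: (xg ord0).
have xa : B u x a = 0 by rewrite gE; have := xg (inord 1); rewrite inordK.
have [d dE] := span0 U1u xa.
have E1 := dK_codazzi x U1u ya xa cE.
have E2 := dK_codazzi y U1u xa xa dE.
move: E1; rewrite (dir_clairaut _ _ has_frame_LV oU1 sK U1u) E2 xy xx mulr0 mulr1.
by move=> c0; rewrite cE -c0 scale0r.
Qed.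

Lemma sphere_rank1 u y : U1 u -> dir y K u = (B u y a / B u b a) *: dir b K u.
Proof.
move=> U1u; have [BC BD BZ] := B_sym U1u.
have ba : B u b a != 0 by rewrite BC; exact: Bab.
have cD := smooth_diff sK U1u.
set c := _ / _.
have : dir (y + (- c) *: b) K u = 0.
  by apply: sphere_ker => //; rewrite BD BZ /c mulNr mulfVK// subrr.
by rewrite (dir_addl _ _ cD) (dir_scale _ _ cD) scaleNr => /subr0_eq.
Qed.

Let Bbb u : U1 u -> B u b b != 0.
Proof.
move=> U1u; have := B_rank U1u a b; have := Bab U1u.
move=> ab0 E; apply/eqP => b0; move: E; rewrite b0 mulr0 => /eqP.
by rewrite mulf_eq0 orbb (negbTE ab0).
Qed.

Lemma sphere_dbF u : U1 u -> Q (dir b K u) (dir b F u) != 0.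
Proof. by move=> U1u; rewrite sphere_dF// oppr_eq0 Bbb. Qed.

(** If [g] represents the linear form [B u ^~ b], then [dir b K u] is
    [- dir g F u] up to a multiple of [F u], so its norm is that of [g]. *)
Lemma sphere_db_gt0 u : U1 u -> 0 < Q (dir b K u) (dir b K u).
Proof.
move=> U1u; have Uu := U1U U1u; have sB := B_sym U1u.
have [g gE] := symform_riesz b sB.
have [||v|c cE] := @lf_span _ _ _ lf u (dir b K u + dir g F u) Uu.
- by rewrite qDl sphere_F// lf_dFF// addr0.
- by rewrite qDl sphere_N// (QC (dir g F u)) (lf_NdF lf)// addr0.
- rewrite qDl sphere_dF// (lf_dF lf)// (symfC sB) gE dotC addNr//.
have -> : dir b K u = c *: F u + (-1) *: dir g F u by rewrite -cE scaleN1r addrK.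
rewrite !(qDl, qDr, qZl, qZr) (QC (F u)) lf_dFF// (lf_FF lf)// (lf_dF lf)//.
rewrite (_ : _ + _ = dot g g); last by ring.
apply: dot_gt0; apply/eqP => g0; have /eqP := Bbb U1u; apply.
by rewrite gE g0 -(scale0r 0) dotZr mul0r.
Qed.

Lemma sphere_norm u : U1 u -> [/\ Q (K u) (K u) = -1, Q (K u) (F u) = 0 &
  forall v, Q (K u) (dir v F u) = 0].
Proof.
move=> /U1U Uu; split=> [||v].
- rewrite !(qDl, qDr, qZl, qZr) (QC (F u)) (lf_NF lf)// (lf_FF lf)// (lf_NN lf)//.
  by ring.
- by rewrite !(qDl, qZl) (lf_NF lf)// (lf_FF lf)// mulr0 addr0.
by rewrite !(qDl, qZl) (lf_NdF lf)// (QC (F u)) lf_dFF// mulr0 addr0.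
Qed.
End CurvatureSphere.

Lemma curvature_sphere_family u0 : (4 <= n)%N -> U u0 ->
  ~ (exists l, forall x y, H u0 x y = l * dot x y) ->
  exists (b : V) (U1 : set V) (K : V -> LV) (om : V -> V -> R) (lam : V -> R),
    [/\ open U1, U1 u0, U1 `<=` U, smooth U1 K &
     forall u, U1 u -> [/\ K u = N u + lam u *: F u,
      Q (K u) (K u) = -1, Q (K u) (F u) = 0, (forall v, Q (K u) (dir v F u) = 0) &
     [/\ (forall y, dir y K u = om u y *: dir b K u),
       Q (dir b K u) (dir b F u) != 0 & 0 < Q (dir b K u) (dir b K u)]]].
Proof.
move=> n4 Uu nonsc.
have n0 : (0 < n)%N by exact: leq_trans n4.
have n2 : (2 < n)%N by exact: leq_trans n4.
have [a [b [aa bb ab Hab]]] := nonscalar_form n0 (second_form_sym Uu) nonsc.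
have [p pp pg] := exists_orthogonal (fun j : 'I_2 => nth 0 [:: a; b] j) n2.
have ap : dot a p = 0 by rewrite dotC; exact: (pg ord0).
have bp : dot b p = 0 by rewrite dotC; have := pg (inord 1); rewrite inordK.
pose U1 := [set u | U u /\ [set r : R | r != 0] (H u a b)].
exists b, U1, (curvature_sphere a b p).
eexists; exists (principal a b p); split.
- exact: open_second_form_neq0.
- by [].
- by move=> u [].
- exact: smooth_curvature_sphere.
move=> u U1u; have [k1 k2 k3] := sphere_norm p U1u.
split=> //; split.
- by move=> y; exact: (sphere_rank1 n4 aa bb pp ab ap bp y U1u).
- exact: (sphere_dbF n4 aa bb pp ab ap bp U1u).
- exact: (sphere_db_gt0 n4 aa bb pp ab ap bp U1u).
Qed.
End Frame.
End Mobius.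

(** * Maps of rank one depend on one parameter *)
Section Curve.
Context {R : realType}.
Implicit Types V W : normedModType R.

(** Moving along [b] from the point [z.1] to a point where [sg] has the value
    [z.2]. *)
Lemma level_section V (U1 : set V) (sg : V -> R) (u0 b : V) :
  has_frame V -> open U1 -> U1 u0 -> smooth U1 sg -> 'D_b sg u0 != 0 ->
  exists (B : set (V * R)) (tau : V * R -> R),
    [/\ open B, B (u0, sg u0), smooth B tau &
     forall z, B z -> [/\ U1 (z.1 + tau z *: b), 'D_b sg (z.1 + tau z *: b) != 0,
       sg (z.1 + tau z *: b) = z.2 & (sg z.1 = z.2 -> tau z = 0)]].
Proof.
move=> frV oU Uu0 ssg Db.
pose A := [set z : V * R | U1 z.1].
have oA : open A.
  by apply: open_comp => // z _; exact: (clin_continuous (clin_fst _ _)).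
pose Phi (z : V * R) := sg z.1 + (-1) * z.2.
have sPhi : smooth A Phi.
  move=> k; apply: CkD => //.
    apply: (Ck_comp frV oA oU _ _ (ssg k)) => //.
    by apply: Ck_clin; exact: clin_fst.
  apply: Ck_clin; exact: clin_comp (clin_snd _ _) (clin_mulr _).
have DPhi z : A z -> 'D_(b, 0) Phi z = 'D_b sg z.1.
  move=> Az.
  have d1 : differentiable (fst : V * R -> V) z by have [] := clin_diff z (clin_fst V R).
  have d2 : differentiable sg z.1 by exact: smooth_diff ssg Az.
  have c3 : clin (fun z : V * R => -1 * z.2).
    exact: clin_comp (clin_snd _ _) (clin_mulr _).
  have d3 := (clin_diff z c3).1.
  rewrite derive_fctD//; last exact: differentiable_comp.
  rewrite (derive_clin _ _ c3) (derive_comp (f := fst) (g := sg))//.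
  by rewrite (derive_clin _ _ (clin_fst V R)) /= mulr0 addr0.
pose z0 : V * R := (u0, sg u0).
have Phi0 : Phi z0 = 0 by rewrite /Phi /= mulN1r subrr.
have DPhi0 : 'D_(b, 0) Phi z0 != 0 by rewrite DPhi.
have [B [d [tau [oB Bz0 d0 st H]]]] :=
  implicit_function (has_frame_pair frV has_frameR) oA (Uu0 : A z0) sPhi Phi0 DPhi0.
have E z (r : R) : z + r *: ((b, 0) : V * R) = (z.1 + r *: b, z.2).
  by rewrite [LHS](_ : _ = (z.1 + r *: b, z.2 + r *: 0)) // scaler0 addr0.
exists B, tau; split=> // z Bz; have [td Hz] := H _ Bz.
have [Az Dz fz] := Hz _ td; rewrite E in Az Dz fz; split=> //.
- by rewrite -(DPhi (_, z.2)).
- by have := fz.2 erefl; rewrite /Phi /= mulN1r => /eqP; rewrite subr_eq0 => /eqP.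
move=> sz; have [|_ _ [E0 _]] := Hz 0; first by rewrite normr0.
symmetry; apply: E0.
by rewrite E /= scale0r addr0 /Phi /= mulN1r sz subrr.
Qed.

(** The scalar function [sg := l \o K] separates the values of [K]: moving the
    points of a ball along [b] to one level set of [sg] gives a map into the
    level, along which the derivative of [K] is a multiple of ['D_b K] killed by
    [l], hence zero. So [K] is constant on the moved points, and [K u] is its
    value at the point of the line [u0 + t *: b] at the same level. *)
Lemma rank_one_curve V W (U1 : set V) (K : V -> W) (u0 b : V)
    (om : V -> V -> R) (l : W -> R) :
  has_frame V -> has_frame W -> open U1 -> U1 u0 -> smooth U1 K ->
  (forall u y, U1 u -> 'D_y K u = om u y *: 'D_b K u) ->
  clin l -> l ('D_b K u0) != 0 ->
  exists (U2 : set V) (t : V -> R),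
    [/\ open U2, U2 u0, smooth U2 t, t u0 = 0 &
      forall u, U2 u -> [/\ U1 u, U1 (u0 + t u *: b) & K u = K (u0 + t u *: b)]].
Proof.
move=> frV frW oU Uu0 sK DK ll lb.
pose sg u := l (K u).
have ssg : smooth U1 sg by move=> k; exact: Ck_lin.
have Dsg u y : U1 u -> 'D_y sg u = l ('D_y K u).
  by move=> U1u; rewrite (derive_lin _ ll)//; exact: smooth_diff sK U1u.
have Db : 'D_b sg u0 != 0 by rewrite Dsg.
pose z0 : V * R := (u0, sg u0).
have [B [tau [oB Bz0 st H]]] := level_section frV oU Uu0 ssg Db.
have HB z : B z -> [/\ U1 (z.1 + tau z *: b), l ('D_b K (z.1 + tau z *: b)) != 0 &
    sg (z.1 + tau z *: b) = z.2].
  by move=> /H[h1 h2 h3 _]; split=> //; rewrite -Dsg.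
have /nbhs_ballP[r /= r0 rB] : nbhs z0 B by exact: open_nbhs_nbhs.
have inB x c : ball u0 r x -> ball (sg u0) r c -> B (x, c) by move=> ? ?; exact: rB.
have const c : ball (sg u0) r c -> forall x y, ball u0 r x -> ball u0 r y ->
    K (x + tau (x, c) *: b) = K (y + tau (y, c) *: b).
  move=> bc; pose ph x := x + tau (x, c) *: b.
  have dph x : ball u0 r x -> differentiable ph x.
    move=> bx; apply: differentiable_fctD => //.
    apply: (differentiable_bil (cbil_scale _)) => //.
    have dp : differentiable (fun x : V => (x, c)) x by exact: differentiable_pair.
    apply: (@differentiable_comp _ _ _ _ (fun x : V => (x, c)) tau) => //.
    by apply: (smooth_diff st); exact: inB.
  have U1ph x : ball u0 r x -> U1 (ph x) by move=> bx; have [] := HB _ (inB _ _ bx bc).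
  have dKp x : ball u0 r x -> differentiable K (ph x).
    by move=> bx; apply: (smooth_diff sK); exact: U1ph.
  apply: (@derive0_cst _ _ _ u0 r (fun x => K (ph x))) => //.
    move=> x bx; apply: (@differentiable_comp _ _ _ _ ph K); first exact: dph.
    exact: dKp.
  move=> x v bx; rewrite (derive_comp v (dph _ bx) (dKp _ bx)).
  set w := 'D_v ph x.
  have [_ lb1 _] := HB _ (inB _ _ bx bc); rewrite /= -/(ph x) in lb1.
  have : 'D_w sg (ph x) = 0.
    rewrite -(derive_comp v (dph _ bx) (smooth_diff ssg (U1ph _ bx))).
    rewrite (@derive_eq_open _ _ _ (ball u0 r) _ (fun=> c)) ?derive_cst//.
      exact: ball_open.
    by move=> y yb; have [] := HB _ (inB _ _ yb bc).
  have Uph := U1ph _ bx; rewrite (Dsg _ _ Uph) (DK _ _ Uph).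
  rewrite (clinZ ll) => /eqP; rewrite mulf_eq0 (negbTE lb1) orbF => /eqP ->.
  by rewrite scale0r.
pose t u := tau (u0, sg u).
pose U2 := [set u | U1 u /\ ball (sg u0) r (sg u)] `&` ball u0 r.
have oU2' : open [set u | U1 u /\ ball (sg u0) r (sg u)].
  by apply: (smooth_preimage ssg oU); exact: ball_open.
have tz (u : V) : ball (sg u0) r (sg u) -> ball u0 r u -> U1 u -> tau (u, sg u) = 0.
  by move=> bs bu U1u; have [_ _ _] := H _ (inB _ _ bu bs); apply.
exists U2, t; split.
- by apply: openI => //; exact: ball_open.
- by split; [split=> //; exact: ballxx|exact: ballxx].
- move=> k; have oU2 : open U2 by apply: openI => //; exact: ball_open.
  apply: (Ck_comp (has_frame_pair frV has_frameR) oU2 oB _ _ (st k)).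
    by move=> u [[U1u bs] bu]; apply: inB => //; exact: ballxx.
  have C1 : Ck k U2 sg by apply: Ck_sub (ssg k) => u [[]].
  have c2 := clin_inr V R.
  have C2 := CkD oU2 (Ck_cst k U2 ((u0, 0) : V * R)) (Ck_lin oU2 c2 C1).
  apply: Ck_ext C2 => // u _.
  by rewrite [LHS](_ : _ = (u0 + 0, 0 + sg u)) // addr0 add0r.
- by apply: tz => //; exact: ballxx.
move=> u [[U1u bs] bu].
have [U1t _ _] := HB _ (inB _ _ (ballxx u0 r0) bs).
split=> //; rewrite -(const (sg u) bs u u0)//; last exact: ballxx.
by rewrite tz// scale0r addr0.
Qed.
End Curve.

(** * The light-like immersion of a conformal chart *)
Section CkPair.
Context {R : realType}.
Implicit Types V W U : normedModType R.

Lemma Ck_pair V W U k (A : set V) (f : V -> W) (g : V -> U) : open A ->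
  Ck k A f -> Ck k A g -> Ck k A (fun x => (f x, g x)).
Proof.
move=> oA Cf Cg.
have C := CkD oA (Ck_lin oA (clin_inl W U) Cf) (Ck_lin oA (clin_inr W U) Cg).
apply: Ck_ext C => // x _.
by rewrite [LHS](_ : _ = (f x + 0, 0 + g x)) // addr0 add0r.
Qed.

Lemma dir_pair V W U (f : V -> W) (g : V -> U) x v :
  differentiable f x -> differentiable g x ->
  dir v (fun x => (f x, g x)) x = (dir v f x, dir v g x).
Proof.
move=> df dg; rewrite !dirE !deriveE//; last exact: differentiable_pair.
by rewrite diff_pair.
Qed.
End CkPair.

Section Chart.
Context {R : realType} {n : nat}.
Notation V := 'rV[R]_n.
Notation E := 'rV[R]_n.+1.
Notation LV := (polyspherical (R := R) (n := n)).

Lemma smooth_lift (X : normedModType R) (U : set X) (f : X -> E) : open U -> smooth U f ->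
  smooth U (fun u => lift (f u)).
Proof.
move=> oU sf k; apply: Ck_pair => //; last exact: (Ck_bil oU cbil_mink).
by apply: Ck_pair => //; exact: Ck_cst.
Qed.

Lemma smooth_dlift (U : set V) (f g : V -> E) : open U -> smooth U f -> smooth U g ->
  smooth U (fun u => dlift (f u) (g u)).
Proof.
move=> oU sf sg k; apply: Ck_pair => //.
  by apply: Ck_pair => //; exact: Ck_cst.
by apply: (Ck_bil oU cbil_mul (Ck_cst _ _ _)); exact: (Ck_bil oU cbil_mink).
Qed.

Lemma dir_lift (W : normedModType R) (f : W -> E) u v : differentiable f u ->
  dir v (fun u => lift (f u)) u = dlift (f u) (dir v f u).
Proof.
move=> df; have dm := differentiable_bil cbil_mink df df.
have d1 : differentiable (fun u => (1 : R, f u)) u by exact: differentiable_pair.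
rewrite /lift dir_pair// dir_pair// dir_cst (dir_bil _ cbil_mink)//.
by rewrite /dlift (minkC (dir v f u)); congr pair; ring.
Qed.

Lemma dir_dlift (W : normedModType R) (f g : W -> E) u v : differentiable f u ->
  differentiable g u ->
  dir v (fun u => dlift (f u) (g u)) u =
    dlift (f u) (dir v g u) + (0, 0, 2 * mink (dir v f u) (g u)).
Proof.
move=> df dg; have dm := differentiable_bil cbil_mink df dg.
have d2 : differentiable (fun u => 2 * mink (f u) (g u)) u.
  exact: (differentiable_bil cbil_mul (differentiable_cst _ _) dm).
have d1 : differentiable (fun u => (0 : R, g u)) u by exact: differentiable_pair.
rewrite /dlift dir_pair// dir_pair// dir_cst (dir_bil _ cbil_mul)//.
rewrite dir_cst mul0r add0r (dir_bil _ cbil_mink)//.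
rewrite [RHS](_ : _ = (0 + 0, dir v g u + 0,
   2 * mink (f u) (dir v g u) + 2 * mink (dir v f u) (g u))) // !addr0.
by congr pair; ring.
Qed.

Section Conformal.
Variables (U : set V) (f : V -> E) (rho : V -> R).
Hypotheses (n0 : (0 < n)%N) (oU : open U) (sf : smooth U f)
  (rho_gt0 : forall u, U u -> 0 < rho u)
  (conf : forall u v w, U u -> mink (dir v f u) (dir w f u) = rho u * dot v w).

Let sdf v : smooth U (dir v f) := smooth_dir v sf.
Let e0 : V := delta_mx 0 (Ordinal n0).

Lemma smooth_rho : smooth U rho.
Proof.
move=> k; have C := Ck_bil oU cbil_mink (sdf e0 k) (sdf e0 k).
apply: Ck_ext C => // u Uu.
by rewrite conf// dot_delta mxE !eqxx mulr1.
Qed.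

(** The factor that makes the lift of the chart isometric. *)
Definition theta u := (Num.sqrt (rho u))^-1.

Lemma theta_gt0 u : U u -> 0 < theta u.
Proof. by move=> Uu; rewrite invr_gt0 sqrtr_gt0 rho_gt0. Qed.

Lemma theta2 u : U u -> theta u * theta u * rho u = 1.
Proof.
move=> Uu; rewrite -invfM -expr2 sqr_sqrtr ?mulVf//.
  by rewrite gt_eqF// rho_gt0.
by rewrite ltW// rho_gt0.
Qed.

Lemma smooth_theta : smooth U theta.
Proof.
move=> k; apply: Ck_inv => //.
  by move=> u Uu; rewrite gt_eqF// sqrtr_gt0 rho_gt0.
by apply: Ck_sqrt => //; exact: smooth_rho.
Qed.

Let et : E := delta_mx 0 ord_max.
(* Coordinates of the tangential part of the time axis [et], up to the factor
   [theta u * theta u]. *)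
Let g u : V := \row_k mink et (dir (delta_mx 0 k) f u).

Lemma dir_sum (W : normedModType R) (q : V -> W) u v : differentiable q u ->
  dir v q u = \sum_k v ord0 k *: dir (delta_mx 0 k) q u.
Proof.
move=> dq; have cD := clin_derive dq; rewrite !dirE.
rewrite {1}[v]row_sum_delta (clin_sum cD).
by apply: eq_bigr => i _; rewrite (clinZ cD) dirE.
Qed.

Let df u : U u -> differentiable f u.
Proof. by move=> Uu; exact: smooth_diff sf Uu. Qed.

Let gE u v : U u -> mink et (dir v f u) = dot v (g u).
Proof.
move=> Uu; rewrite dir_sum; last exact: df.
rewrite minkC mink_suml; apply: eq_bigr => i _.
by rewrite minkZl mxE minkC.
Qed.

(* The time axis minus its tangential part: since the tangent space is
   space-like, this normal is time-like, and in particular not zero. *)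
Let nu u : E := et + (- (theta u * theta u)) *: dir (g u) f u.

Let smooth_nu : smooth U nu.
Proof.
move=> k; apply: (CkD oU); first exact: Ck_cst.
have st := smooth_theta k.
apply: (Ck_bil oU (cbil_scale _)).
  have C := Ck_bil oU cbil_mul (Ck_cst k U (-1 : R)) (Ck_bil oU cbil_mul st st).
  by apply: Ck_ext C => // u _; rewrite mulN1r.
have C : Ck k U (fun u => \sum_i (g u) ord0 i *: dir (delta_mx 0 i) f u).
  apply: (Ck_sum oU) => i; apply: (Ck_bil oU (cbil_scale _)) (sdf _ k).
  have C' := Ck_bil oU cbil_mink (Ck_cst k U et) (sdf (delta_mx 0 i) k).
  by apply: Ck_ext C' => // u _; rewrite mxE.
by apply: Ck_ext C => // u Uu; rewrite -dir_sum//; exact: df.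
Qed.

Let nu_orth u v : U u -> mink (nu u) (dir v f u) = 0.
Proof.
move=> Uu; rewrite minkDl minkZl gE// conf// (dotC v).
by rewrite mulNr mulrA theta2// mul1r subrr.
Qed.

Let nu_norm u : U u -> mink (nu u) (nu u) < 0.
Proof.
move=> Uu; rewrite {2}/nu minkDr minkZr nu_orth// mulr0 addr0.
rewrite minkC /nu minkDr minkZr gE//.
have -> : mink et et = -1.
  rewrite minkE (bigD1 ord_max)//= big1; last first.
    by move=> i im; rewrite /et !mxE (negbTE im) andbF mul0r mulr0.
  by rewrite /et !mxE !eqxx mulr1 mulr1 addr0.
have := dot_ge0 (g u); have := theta_gt0 Uu => t0 d0.
have : 0 <= theta u * theta u * dot (g u) (g u) by rewrite mulr_ge0// mulr_ge0// ltW.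
by lra.
Qed.

Definition unit_normal u : E := (Num.sqrt (- mink (nu u) (nu u)))^-1 *: nu u.
Let xi := unit_normal.

Lemma smooth_unit_normal : smooth U xi.
Proof.
move=> k; apply: (Ck_bil oU (cbil_scale _)) (smooth_nu k).
have np u : U u -> 0 < - mink (nu u) (nu u) by move=> Uu; rewrite oppr_gt0 nu_norm.
apply: Ck_inv => //; first by move=> u Uu; rewrite gt_eqF// sqrtr_gt0 np.
apply: Ck_sqrt => //.
have C := Ck_bil oU cbil_mul (Ck_cst k U (-1 : R))
  (Ck_bil oU cbil_mink (smooth_nu k) (smooth_nu k)).
by apply: Ck_ext C => // u _; rewrite mulN1r.
Qed.

Lemma unit_normal_orth u v : U u -> mink (xi u) (dir v f u) = 0.
Proof. by move=> Uu; rewrite minkZl nu_orth// mulr0. Qed.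

Lemma unit_normal_norm u : U u -> mink (xi u) (xi u) = -1.
Proof.
move=> Uu; have np : 0 < - mink (nu u) (nu u) by rewrite oppr_gt0 nu_norm.
rewrite minkZl minkZr mulrA -invfM -expr2 sqr_sqrtr ?ltW//.
by rewrite invrN mulNr mulVf// lt_eqF// nu_norm.
Qed.

Lemma chart_nondeg u y : U u -> mink y (xi u) = 0 ->
  (forall v, mink y (dir v f u) = 0) -> y = 0.
Proof.
move=> Uu yx yf; apply: (@conformal_frame_nondeg _ _ (fun v => dir v f u) (xi u) (rho u)) => //.
- by move=> v w; exact: conf.
- by move=> v; rewrite minkC unit_normal_orth.
- exact: unit_normal_norm.
- by rewrite gt_eqF// rho_gt0.
Qed.

Definition cone_lift u : LV := theta u *: lift (f u).
(** The tangent hyperplane of the hypersurface at [f u]. *)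
Definition normal_lift u : LV := dlift (f u) (xi u).
Let F := cone_lift.
Let N := normal_lift.

Let dtheta u : U u -> differentiable theta u.
Proof. by move=> Uu; exact: smooth_diff smooth_theta Uu. Qed.

Lemma dir_cone_lift u v : U u ->
  dir v F u = dir v theta u *: lift (f u) + theta u *: dlift (f u) (dir v f u).
Proof.
move=> Uu.
have dl : differentiable (fun u => lift (f u)) u.
  exact: smooth_diff (smooth_lift oU sf) Uu.
rewrite /F /cone_lift (dir_bil _ (cbil_scale _)) ?dir_lift//; [exact: df|exact: dtheta].
Qed.

Lemma dir_normal_lift u v : U u -> dir v N u = dlift (f u) (dir v xi u).
Proof.
move=> Uu; rewrite /N /normal_lift dir_dlift; [|exact: df|exact: smooth_diff smooth_unit_normal Uu].
by rewrite minkC unit_normal_orth// mulr0 -[(0, 0, 0)]/(0 : LV) addr0.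
Qed.

Lemma light_frame_chart : light_frame (@Q R n) U F N.
Proof.
have Qdl x y : Q (dlift x y) (lift x) = 0 by rewrite QC Q_lift_dlift.
split=> //.
- move=> k; apply: (Ck_bil oU (cbil_scale _)); first exact: smooth_theta.
  exact: smooth_lift.
- exact: (smooth_dlift oU sf smooth_unit_normal).
- by move=> u Uu; rewrite QZl QZr Q_lift0 !mulr0.
- move=> u v w Uu; rewrite !dir_cone_lift// !(QDl, QDr, QZl, QZr).
  rewrite Q_lift0 Q_lift_dlift Qdl Q_dlift conf// !mulr0 !add0r.
  by rewrite !mulrA theta2// mul1r.
- by move=> u Uu; rewrite Q_dlift unit_normal_norm.
- by move=> u Uu; rewrite QZr Qdl mulr0.
- move=> u v Uu; rewrite dir_cone_lift// QDr !QZr Qdl Q_dlift unit_normal_orth//.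
  by rewrite !mulr0 addr0.
move=> u X Uu XF XN XD.
have t0 : theta u != 0 by rewrite gt_eqF// theta_gt0.
have Xl : Q X (lift (f u)) = 0.
  by move: XF; rewrite QZr => /eqP; rewrite mulf_eq0 (negbTE t0) => /eqP.
have Xd v : Q X (dlift (f u) (dir v f u)) = 0.
  have := XD v; rewrite dir_cone_lift// QDr !QZr Xl mulr0 add0r => /eqP.
  by rewrite mulf_eq0 (negbTE t0) => /eqP.
exists (X.1.1 / theta u); rewrite scalerA mulfVK//.
apply: (Q_decomp Xl) => y yX.
by apply: (chart_nondeg Uu) => [|v]; apply: yX.
Qed.

(** The second form of the lift is the one of the hypersurface up to the factor
    [theta], so it is a multiple of the metric at the umbilical points only. *)
Lemma chart_umbilic u l : U u ->
  (forall x y, second_form (@Q R n) F N u x y = l * dot x y) ->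
  forall v, - dir v xi u = (l * theta u) *: dir v f u.
Proof.
move=> Uu HE v.
have lf := light_frame_chart.
apply/eqP; rewrite eq_sym -subr_eq0 opprK; apply/eqP.
have xn : mink (dir v xi u) (xi u) = 0.
  have dx : differentiable xi u by exact: smooth_diff smooth_unit_normal Uu.
  have := dir_eq_open v oU Uu unit_normal_norm; rewrite dir_cst.
  by rewrite (dir_bil _ cbil_mink)// (minkC (xi u)); lra.
have t0 : theta u != 0 by rewrite gt_eqF// theta_gt0.
apply: (chart_nondeg Uu) => [|w].
  by rewrite minkDl minkZl xn (minkC (dir v f u)) unit_normal_orth// mulr0 addr0.
rewrite minkDl minkZl conf//.
have Qdl x y : Q (dlift x y) (lift x) = 0 by rewrite QC Q_lift_dlift.
have := lf_dNdF (@cbil_Q R n) (@QC R n) lf v w Uu; rewrite HE dir_normal_lift//.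
rewrite dir_cone_lift// QDr !QZr Qdl Q_dlift mulr0 add0r => E1.
apply: (mulfI t0); rewrite mulr0 mulrDr E1.
by have := theta2 Uu => /(congr1 ( *%R (l * dot v w))); lra.
Qed.

(** [curvature_sphere_family] in terms of the chart itself. That [dir b K u] is
    also incident to the point [f u] makes the hypersurface a part of the envelope
    of the family; that it is not tangent to it there makes the parameter of the
    family a good function on the hypersurface. *)
Lemma chart_family u0 : (4 <= n)%N -> U u0 ->
  ~ (exists l, forall v, - dir v xi u0 = l *: dir v f u0) ->
  exists (b : V) (U1 : set V) (K : V -> LV) (om : V -> V -> R),
    [/\ open U1, U1 u0, U1 `<=` U, smooth U1 K &
     forall u, U1 u -> [/\ Q (K u) (K u) = -1, Q (K u) (lift (f u)) = 0,
      (forall v, Q (K u) (dlift (f u) (dir v f u)) = 0),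
      (forall y, dir y K u = om u y *: dir b K u) &
      [/\ Q (dir b K u) (lift (f u)) = 0,
        Q (dir b K u) (dlift (f u) (dir b f u)) != 0 &
        0 < Q (dir b K u) (dir b K u)]]].
Proof.
move=> n4 Uu0 numb.
have [|b [U1 [K [om [lam [oU1 U1u0 U1U sK H]]]]]] := curvature_sphere_family
  (@has_frame_polyspherical R n) (@cbil_Q R n) (@QC R n) light_frame_chart n4 Uu0.
  move=> [l Hl]; apply: numb; exists (l * theta u0); exact: chart_umbilic.
have t0 u : U1 u -> theta u != 0 by move=> /U1U Uu; rewrite gt_eqF// theta_gt0.
have Kl u : U1 u -> Q (K u) (lift (f u)) = 0.
  move=> U1u; have [_ _ + _ _] := H _ U1u.
  by rewrite QZr => /eqP; rewrite mulf_eq0 (negbTE (t0 _ U1u)) => /eqP.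
have Kd u v : U1 u -> Q (K u) (dlift (f u) (dir v f u)) = 0.
  move=> U1u; have [_ _ _ /(_ v) + _] := H _ U1u.
  rewrite dir_cone_lift; last exact: U1U.
  rewrite QDr !QZr Kl// mulr0 add0r => /eqP.
  by rewrite mulf_eq0 (negbTE (t0 _ U1u)) => /eqP.
exists b, U1, K, om; split=> // u U1u.
have [_ KK _ _ [KD KF Kb]] := H _ U1u.
have sl1 : smooth U1 (fun u => lift (f u)).
  by move=> k; apply: Ck_sub U1U _; exact: smooth_lift.
have Kbl : Q (dir b K u) (lift (f u)) = 0.
  rewrite (derive_Q_cst (@cbil_Q R n) b oU1 U1u sK sl1 Kl).
  by rewrite dir_lift ?Kd ?oppr0//; apply: df; exact: U1U.
split=> //; [exact: Kl|by move=> v; exact: Kd|].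
split=> //; move: KF; rewrite dir_cone_lift; last exact: U1U.
rewrite QDr !QZr Kbl mulr0 add0r => H0.
by apply: contraNneq H0 => ->; rewrite mulr0.
Qed.
End Conformal.
End Chart.

(** * Envelopes of curves of hyperspheres *)
Lemma parametrization_in {R : realType} {n : nat} (M : set 'rV[R]_n.+1) U f :
  parametrization M U f -> forall u, U u -> M (f u).
Proof.
move=> [oU _ _ _ H] u Uu; have [//|O oO fO] := H _ oU.
by have [] : (M `&` O) (f u) by rewrite -fO; exists u.
Qed.

(** The linear forms vanishing on the image of the injective map [w] make a space
    of dimension one, but non-isotropic orthogonal vectors are independent. *)
Lemma no_two_normals {R : realType} {n : nat} (w : 'rV[R]_n -> 'rV[R]_n.+1) g1 g2 :
  clin w -> (forall v, w v = 0 -> v = 0) ->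
  mink g1 g1 != 0 -> mink g1 g2 = 0 -> mink g2 g2 != 0 ->
  ~ (forall v, mink g1 (w v) = 0 /\ mink g2 (w v) = 0).
Proof.
move=> lw winj g11 g12 g22 wg.
pose A : 'M[R]_(n, n.+1) := \matrix_i w (delta_mx 0 i).
have vA v : v *m A = w v.
  rewrite mulmx_sum_row {2}[v]row_sum_delta (clin_sum lw).
  by apply: eq_bigr => i _; rewrite rowK (clinZ lw).
have rA : \rank A = n.
  by apply/eqP; apply: inj_row_free => v; rewrite vA; exact: winj.
pose e (g : 'rV[R]_n.+1) : 'rV[R]_n.+1 := g *m diag_mx eta.
have me g x : e g *m x^T = (mink g x)%:M.
  apply/matrixP => i j; rewrite !ord1 !mxE mulr1n minkE.
  by apply: eq_bigr => k _; rewrite /e mul_mx_diag !mxE; ring.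
(* The row [e g] represents the linear form [mink g], so the rows of [B] annihilate
   the [n] independent rows of [A]. *)
pose B : 'M[R]_(1 + 1, n.+1) := col_mx (e g1) (e g2).
have rB : \rank B = 2%N.
  apply/eqP; apply: inj_row_free => v.
  rewrite -[v]hsubmxK mul_row_col => vB.
  have E x : mink g1 x *: lsubmx v + mink g2 x *: rsubmx v = 0.
    have := congr1 (mulmx^~ x^T) vB; rewrite mulmxDl -(mulmxA _ (e g1)) -(mulmxA _ (e g2)) !me mul0mx.
    by rewrite !mul_mx_scalar.
  have := E g1; have := E g2; rewrite g12 (minkC g2 g1) g12 !scale0r addr0 add0r.
  move=> /eqP; rewrite scaler_eq0 (negbTE g22) => /eqP ->.
  move=> /eqP; rewrite scaler_eq0 (negbTE g11) => /eqP ->.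
  exact: row_mx0.
have : A *m B^T = 0.
  rewrite -[A *m B^T]trmxK trmx_mul trmxK /B mul_col_mx.
  have z g : (forall v, mink g (w v) = 0) -> e g *m A^T = 0.
    move=> gw; apply/rowP => i; rewrite mxE.
    have := congr1 (fun X : 'M_1 => X 0 0) (me g (w (delta_mx 0 i))).
    rewrite gw !mxE mul0rn => E; rewrite -[RHS]E.
    by apply: eq_bigr => k _; rewrite !mxE.
  rewrite !z ?col_mx0 ?trmx0//; first by move=> v; have [] := wg v.
  by move=> v; have [] := wg v.
move=> /mulmx0_rank_max; rewrite mxrank_tr rA rB.
by rewrite addn2 ltnn.
Qed.

Section Envelope.
Context {R : realType} {n : nat}.
Notation V := 'rV[R]_n.
Notation E := 'rV[R]_n.+1.
Notation LV := (polyspherical (R := R) (n := n)).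
Variables (k : R -> LV) (I : set R) (oI : open I) (sk : smooth I k).
Hypotheses (kk : forall s, I s -> Q (k s) (k s) = -1).
Let k1 : R -> LV := dir (1 : R) k.
Let k2 : R -> LV := dir (1 : R) k1.
Hypotheses (k11 : forall s, I s -> 0 < Q (k1 s) (k1 s)).
Let sk1 : smooth I k1 := smooth_dir (1 : R) sk.

Lemma curve_orth s : I s -> Q (k s) (k1 s) = 0.
Proof.
move=> Is; have := derive_Q_cst (@cbil_Q R n) (1 : R) oI Is sk sk kk.
by rewrite -/k1 (QC (k1 s)); lra.
Qed.

(* Near the point of interest, the derivative of the family has exactly one
   member [sg x] incident to [x]. *)
Variables (Om : set E) (d1 : R) (sg : E -> R).
Hypotheses (oOm : open Om) (ssg : smooth Om sg)
  (sg_lt : forall x, Om x -> `|sg x| < d1)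
  (sgP : forall x r, Om x -> `|r| < d1 ->
     [/\ I r, Q (k2 r) (lift x) != 0 & Q (k1 r) (lift x) = 0 <-> r = sg x]).

Let sgI x : Om x -> I (sg x).
Proof. by move=> Ox; have [] := sgP Ox (sg_lt Ox). Qed.

Let sg1 x : Om x -> Q (k1 (sg x)) (lift x) = 0.
Proof. by move=> Ox; have [_ _ ->] := sgP Ox (sg_lt Ox). Qed.

Lemma smooth_along (q : R -> LV) : smooth I q -> smooth Om (fun x => q (sg x)).
Proof.
move=> sq j; apply: (Ck_comp (@has_frameR R) oOm oI _ (ssg j) (sq j)); exact: sgI.
Qed.

Let slift : smooth Om (fun x : E => lift x).
Proof.
by apply: smooth_lift => // j; apply: Ck_clin; split=> // ?; exact: cvg_id.
Qed.

Let dlift_id x y : dir y (fun x : E => lift x) x = dlift x y.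
Proof.
have dx : differentiable (fun x : E => x) x by [].
rewrite (dir_lift _ dx) dir_clin//.
by split=> // ?; exact: cvg_id.
Qed.

Lemma dir_along (q : R -> LV) x y : smooth I q -> Om x ->
  dir y (fun x => Q (q (sg x)) (lift x)) x =
  dir y sg x * Q (dir (1 : R) q (sg x)) (lift x) + Q (q (sg x)) (dlift x y).
Proof.
move=> sq Ox.
have ds : differentiable sg x by exact: smooth_diff ssg Ox.
have dq : differentiable q (sg x) by exact: smooth_diff sq (sgI Ox).
have dqs : differentiable (fun x => q (sg x)) x.
  exact: smooth_diff (smooth_along sq) Ox.
have dl : differentiable (fun x : E => lift x) x by exact: smooth_diff slift Ox.
rewrite (dir_bil _ (@cbil_Q R n))// dlift_id (dir_comp (f := sg) (g := q))//.
have E1 : dir y sg x = dir y sg x *: (1 : R) by rewrite /GRing.scale /= mulr1.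
by rewrite {1}E1 dir_scale// QZl.
Qed.

(** With the parameter eliminated, the equation of the envelope. Its derivative
    does not see the derivative of [sg], which comes with the factor
    [Q (k1 (sg x)) (lift x)]; so its gradient is the normal of the hypersphere
    with parameter [sg x] ([dir_envelope_eq]). *)
Definition envelope_eq x := Q (k (sg x)) (lift x).
Let G := envelope_eq.

Lemma smooth_envelope_eq : smooth Om G.
Proof. exact: (smooth_Q (@cbil_Q R n) oOm (smooth_along sk) slift). Qed.

Lemma dir_envelope_eq x y : Om x -> dir y G x = mink (grad (k (sg x)) x) y.
Proof. by move=> Ox; rewrite (dir_along _ sk)// sg1// mulr0 add0r Q_dliftE. Qed.

Lemma dir_parameter x y : Om x ->
  mink (grad (k1 (sg x)) x) y = - (dir y sg x * Q (k2 (sg x)) (lift x)).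
Proof.
move=> Ox; have := dir_along y sk1 Ox; rewrite -/k2 Q_dliftE.
rewrite (dir_eq_open _ oOm Ox sg1) dir_cst => /esym/eqP.
by rewrite addrC addr_eq0 => /eqP.
Qed.

(* [T] is a conformal linear chart of the tangent hyperplane at [p], with unit
   normal [nu0]. On each line of direction [nu0] through a point [x] near [p], the
   envelope has exactly one point within [d2] of [x], [x + tau2 x *: nu0]. *)
Variables (p : E) (T : V -> E) (rho0 : R) (nu0 : E).
Hypotheses (lT : clin T) (rho0_gt0 : 0 < rho0)
  (TT : forall v w, mink (T v) (T w) = rho0 * dot v w)
  (Tn : forall v, mink (T v) nu0 = 0) (nn : mink nu0 nu0 = -1).
Variables (B2 : set E) (d2 : R) (tau2 : E -> R) (r0 : R).
Hypotheses (oB2 : open B2) (stau : smooth B2 tau2) (r0_gt0 : 0 < r0)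
  (tau_lt : forall x, B2 x -> `|tau2 x| < d2)
  (tauP : forall x r, B2 x -> `|r| < d2 ->
    Om (x + r *: nu0) /\ (G (x + r *: nu0) = 0 <-> r = tau2 x))
  (inB2 : forall v, ball 0 r0 v -> B2 (p + T v)).

Let nondeg y : (forall v, mink y (T v) = 0) -> mink y nu0 = 0 -> y = 0.
Proof.
by move=> yT; apply: (conformal_frame_nondeg (rho := rho0) TT Tn nn _ yT); rewrite gt_eqF.
Qed.

(* Coordinates adapted to the tangent hyperplane: projection and height. *)
Let pi x : V := \sum_i (rho0^-1 * mink (x - p) (T (delta_mx 0 i))) *: delta_mx 0 i.
Let ht x : R := - mink (x - p) nu0.

Let piE x j : pi x ord0 j = rho0^-1 * mink (x - p) (T (delta_mx 0 j)).
Proof.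
rewrite /pi summxE (bigD1 j)//= big1 ?addr0; first by rewrite !mxE !eqxx mulr1.
by move=> i ij; rewrite !mxE [j == i]eq_sym (negbTE ij) andbF mulr0.
Qed.

Let Tpi x v : mink (T (pi x)) (T v) = mink (x - p) (T v).
Proof.
rewrite TT /dot mulr_sumr {2}[v]row_sum_delta (clin_sum lT) minkC mink_suml.
apply: eq_bigr => i _; rewrite piE (clinZ lT) minkZl (minkC (T _)).
rewrite mulrA mulrA mulfV ?gt_eqF// mul1r mulrC //.
Qed.

Let dec x : x = p + T (pi x) + ht x *: nu0.
Proof.
apply/eqP; rewrite -subr_eq0; apply/eqP; apply: nondeg => [v|].
  rewrite opprD addrA opprD addrA !(minkDl, minkNl, minkZl) Tpi.
  by rewrite (minkC nu0) Tn minkDl minkNl; ring.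
rewrite opprD addrA opprD addrA !(minkDl, minkNl, minkZl) Tn nn /ht.
by rewrite minkDl minkNl; ring.
Qed.

Let chart_inv v r : pi (p + T v + r *: nu0) = v /\ ht (p + T v + r *: nu0) = r.
Proof.
have E0 : p + T v + r *: nu0 - p = T v + r *: nu0.
  by rewrite addrAC [p + T v]addrC addrK.
split; last by rewrite /ht E0 minkDl minkZl Tn nn; ring.
apply/rowP => i; rewrite piE E0 minkDl minkZl (minkC nu0) Tn mulr0 addr0 TT.
by rewrite dot_delta mulrA mulVf ?mul1r// gt_eqF.
Qed.

Let spi : smooth setT pi.
Proof.
move=> j; apply: (Ck_sum openT) => i.
apply: (Ck_bil openT (cbil_scale _)); last exact: Ck_cst.
apply: (Ck_bil openT cbil_mul); first exact: Ck_cst.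
apply: (Ck_bil openT cbil_mink); last exact: Ck_cst.
apply: (CkD openT); last exact: Ck_cst.
by apply: Ck_clin; split=> // ?; exact: cvg_id.
Qed.

Let sht : smooth setT ht.
Proof.
move=> j.
have C : Ck j setT (fun x : E => -1 * mink (x - p) nu0).
  apply: (Ck_bil openT cbil_mul); first exact: Ck_cst.
  apply: (Ck_bil openT cbil_mink); last exact: Ck_cst.
  apply: (CkD openT); last exact: Ck_cst.
  by apply: Ck_clin; split=> // ?; exact: cvg_id.
by apply: Ck_ext C => [|x _]; [exact: openT|rewrite mulN1r].
Qed.

Let Ut : set V := ball 0 r0.
Let oUt : open Ut. Proof. exact: ball_open. Qed.
(** The cylinder [ball 0 r0 * ]-d2, d2[] in the coordinates [pi] and [ht]. *)
Definition envelope_nbhs : set E :=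
  [set x | Ut (\sum_i (rho0^-1 * mink (x - p) (T (delta_mx 0 i))) *: delta_mx 0 i) /\
           `|- mink (x - p) nu0| < d2].
Let W := envelope_nbhs.
Definition envelope : set E := [set x | W x /\ G x = 0].
Let C := envelope.

Lemma open_envelope_nbhs : open W.
Proof.
have o1 := smooth_preimage spi openT oUt.
have o2 := smooth_preimage sht openT (@ball_open _ R^o 0 d2).
have -> : W = [set x | setT x /\ Ut (pi x)] `&` [set x | setT x /\ ball (0 : R^o) d2 (ht x)].
  apply/seteqP; split=> x; rewrite /W /envelope_nbhs /= -/(pi x) -/(ht x) -!ball_normE /=.
    by move=> [h1 h2]; rewrite sub0r normrN.
  by move=> [[_ h1] [_ h2]]; split=> //; move: h2; rewrite sub0r normrN.
exact: openI.
Qed.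

Let WOm x : W x -> Om x.
Proof.
move=> [Ux hx]; rewrite [x]dec; apply: (tauP _ _).1 => //; exact: inB2.
Qed.

(* The envelope as a graph over the tangent hyperplane. *)
Let h v := p + T v + tau2 (p + T v) *: nu0.

Let hC v : Ut v -> C (h v) /\ pi (h v) = v.
Proof.
move=> Uv; have [e1 e2] := chart_inv v (tau2 (p + T v)).
have Bv := inB2 Uv; split=> //; split.
  by split; rewrite /= -/(pi _) -/(ht _) ?e1 ?e2//; exact: tau_lt.
by have [_ ->] := tauP Bv (tau_lt Bv).
Qed.

Let Ch x : C x -> x = h (pi x) /\ Ut (pi x).
Proof.
move=> [[Ux hx] Gx]; split=> //.
have [_ E1] := tauP (inB2 Ux) hx.
rewrite {1}[x]dec /h; congr (_ + _ *: _); apply/E1.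
by rewrite -/(ht x) -dec.
Qed.

Let COm x : C x -> Om x.
Proof. by move=> [/WOm]. Qed.

Let sh : smooth Ut h.
Proof.
have C1 j : Ck j Ut (fun v => p + T v).
  by apply: CkD => //; [exact: Ck_cst|exact: Ck_clin].
move=> j; apply: CkD => //; apply: (Ck_bil oUt (cbil_scale _)); last exact: Ck_cst.
exact: (Ck_comp (@has_frame_rV R _) oUt oB2 inB2 (C1 j) (stau j)).
Qed.

Let gradC x : C x -> [/\ mink (grad (k (sg x)) x) (grad (k (sg x)) x) = -1,
  mink (grad (k (sg x)) x) (grad (k1 (sg x)) x) = 0 &
  0 < mink (grad (k1 (sg x)) x) (grad (k1 (sg x)) x)].
Proof.
move=> Cx; have Ox := COm Cx; have [_ Gx] := Cx; rewrite /G /envelope_eq in Gx.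
have Is := sgI Ox.
by rewrite !mink_grad !Gx !sg1// kk// curve_orth// !mulr0 !subr0; split=> //; exact: k11.
Qed.

(** [envelope_eq] vanishes on the envelope, and [grad (k (sg x)) x] is its
    gradient. *)
Lemma envelope_param_grad U f u v : parametrization C U f -> U u ->
  mink (grad (k (sg (f u))) (f u)) (dir v f u) = 0.
Proof.
move=> Pf Uu; have [oU sf _ _ _] := Pf.
have fC := parametrization_in Pf.
have Ou := COm (fC _ Uu).
have dfu : differentiable f u by exact: smooth_diff sf Uu.
have dG : differentiable G (f u) by exact: smooth_diff smooth_envelope_eq Ou.
rewrite -dir_envelope_eq// -(dir_comp _ dfu dG).
rewrite (dir_eq_open v oU Uu (g := fun=> 0)) ?dir_cst// => u' Uu'.
by have [] := fC _ Uu'.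
Qed.

(** At a critical point of the parameter, the hyperspheres [k] and [k1] would both
    be tangent to the envelope ([dir_parameter]), although their normals are
    orthogonal and not isotropic. *)
Lemma envelope_noncritical U f u : parametrization C U f -> U u ->
  exists v, dir v (fun u => sg (f u)) u != 0.
Proof.
move=> Pf Uu; have [oU sf finj _ _] := Pf.
have Cu := parametrization_in Pf Uu; have Ou := COm Cu.
have [g11 g12 g22] := gradC Cu.
have dfu : differentiable f u by exact: smooth_diff sf Uu.
have ds : differentiable sg (f u) by exact: smooth_diff ssg Ou.
apply: contrapT => nex.
have cf : clin (fun v => dir v f u).
  have -> : (fun v => dir v f u) = (fun v => 'D_v f u) by apply/funext => v; rewrite dirE.
  exact: clin_derive.
apply: (@no_two_normals _ _ (fun v => dir v f u) _ _ cf _ _ g12) => [v|||v].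
- by rewrite dirE; exact: finj.
- by rewrite g11 oppr_eq0 oner_eq0.
- by rewrite gt_eqF.
split; first exact: (envelope_param_grad _ Pf Uu).
rewrite dir_parameter// -(dir_comp _ dfu ds).
have -> : dir v (fun u => sg (f u)) u = 0.
  by apply: contrapT => /eqP H; apply: nex; exists v.
by rewrite mul0r oppr0.
Qed.

Lemma envelope_hypersurface : parametrization C Ut h /\ h @` Ut = C.
Proof.
split; last first.
  apply/seteqP; split=> [x [v Uv <-]|x Cx]; first by have [] := hC Uv.
  by have [e Up] := Ch Cx; exists (pi x).
split.
- exact: oUt.
- exact: sh.
- move=> u v Uu Dh.
  have dh : differentiable h u by exact: smooth_diff sh Uu.
  have dp : differentiable pi (h u) by exact: smooth_diff spi _.
  have Dh' : dir v h u = 0 by rewrite dirEx.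
  have := dir_comp v dh dp; rewrite Dh'.
  have -> : dir 0 pi (h u) = 0.
    by rewrite dirE; exact: derive0.
  rewrite (dir_eq_open v oUt Uu (g := id)); last by move=> w /hC[].
  by rewrite dir_clin//; split=> // ?; exact: cvg_id.
- move=> u v; rewrite !inE => Uu Uv huv.
  by have [_ <-] := hC Uu; have [_ <-] := hC Uv; rewrite huv.
move=> X oX XU; exists [set x | setT x /\ X (pi x)].
  exact: (smooth_preimage spi openT oX).
apply/seteqP; split=> [x [v Xv <-]|x [Cx [_ Xx]]].
  by have [Cv e] := hC (XU _ Xv); split=> //; split=> //; rewrite e.
by have [e _] := Ch Cx; exists (pi x).
Qed.

Lemma envelope_spacelike : spacelike_hypersurface C.
Proof.
have [Ph hUt] := envelope_hypersurface.
split=> [x Cx|x w [U [f [u [v [Pf Uu fu wE]]]]] w0].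
  by exists Ut, h; split=> //; rewrite hUt.
have Cx : C x by rewrite -fu; exact: (parametrization_in Pf).
have [g11 _ _] := gradC Cx.
apply: (mink_timelike_orth (v := grad (k (sg x)) x)) => //.
  by rewrite g11 ltrN10.
by rewrite wE -fu -dirEx; exact: (envelope_param_grad _ Pf Uu).
Qed.

Lemma envelope_smooth_parameter U f : parametrization C U f ->
  smooth U (fun u => sg (f u)).
Proof.
move=> Pf j; have [oU sf _ _ _] := Pf.
apply: (Ck_comp (@has_frame_rV R _) oU oOm _ (sf j) (ssg j)) => u Uu.
exact: COm (parametrization_in Pf Uu).
Qed.

Let q v := sg (h v).
Let sq : smooth Ut q.
Proof. exact: envelope_smooth_parameter envelope_hypersurface.1. Qed.

Let imE : sg @` C = q @` Ut.
Proof.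
rewrite -envelope_hypersurface.2; apply/seteqP; split=> x.
  by move=> [_ [v Uv <-] <-]; exists v.
by move=> [v Uv <-]; exists (h v) => //; exists v.
Qed.

Lemma envelope_image_open : open (sg @` C).
Proof.
rewrite imE openE => _ [v Uv <-].
have [y Dy] := envelope_noncritical envelope_hypersurface.1 Uv.
rewrite dirE in Dy.
have [B [tau [oB Bv _ HB]]] := level_section (@has_frame_rV R n) oUt Uv sq Dy.
have /nbhs_ballP[r /= r_gt0 rB] : nbhs (v, q v) B by exact: open_nbhs_nbhs.
apply/nbhs_ballP; exists r => // c bc.
have [U1 _ e _] := HB (v, c) (rB (v, c) (conj (ballxx v r_gt0) bc)).
by exists (v + tau (v, c) *: y).
Qed.

Lemma envelope_image_interval : is_interval (sg @` C).
Proof.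
rewrite imE => _ _ [v Uv <-] [w Uw <-] z /andP[vz zw].
have inU (t : R) : 0 <= t <= 1 -> Ut (v + t *: (w - v)) by exact: ball_line.
have [||t] := @IVT R (fun t => q (v + t *: (w - v))) 0 1 z ler01.
- apply: derivable_within_continuous => t; rewrite in_itv/= => t01.
  have [] // : is_derive t 1 (fun t : R => q (v + t *: (w - v)))
    ('D_(w - v) q (v + t *: (w - v))).
  by apply: is_derive_line; exact: smooth_diff sq (inU _ t01).
- rewrite scale0r addr0 scale1r [v + _]addrC subrK.
  by rewrite ge_min le_max vz zw orbT.
by rewrite in_itv/= => t01 <-; exists (v + t *: (w - v)) => //; exact: inU.
Qed.

(** The generator with parameter [s] is cut out of the envelope by the equations
    of [k s] and [k1 s], since [sg x] is the only solution of the second one; the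
    normals along it are those of [k s]. *)
Lemma envelope_canal : canal_hypersurface C.
Proof.
split; first exact: envelope_spacelike.
exists (sg @` C), (fun s => pencil_sphere (k s) (k1 s)), sg; split => //.
- exact: envelope_image_open.
- exact: envelope_image_interval.
- move=> U f Pf; split; first exact: envelope_smooth_parameter.
  by move=> u Uu; have [v Dv] := envelope_noncritical Pf Uu; exists v; rewrite -dirEx.
move=> s [y Cy sy] G0.
have sd : `|s| < d1 by rewrite -sy; exact: sg_lt (COm Cy).
have Is : I s by rewrite -sy; exact: sgI (COm Cy).
have GE : G0 = pencil_sphere (k s) (k1 s) `&` W.
  apply/seteqP; split=> x.
    move=> [Cx sx]; have [Wx Gx] := Cx; rewrite /= in sx.
    by split=> //; rewrite -sx; split=> //; exact: sg1 (COm Cx).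
  move=> [[e1 e2] Wx]; have Ox := WOm Wx.
  have [_ _ H] := sgP Ox sd; have sx := H.1 e2.
  by split=> //; split=> //; rewrite /G /envelope_eq -sx.
split; first by exists W => //; exact: open_envelope_nbhs.
have ne : exists x, pencil_sphere (k s) (k1 s) x.
  by exists y; have [] : (pencil_sphere (k s) (k1 s) `&` W) y by rewrite -GE; split.
have nrm x : G0 x -> normal_vector C x (grad (k s) x).
  move=> [Cx sx] w [U [f [u [v [Pf Uu fu ->]]]]].
  by rewrite -sx -fu -dirEx; exact: (envelope_param_grad _ Pf Uu).
have nsc x (c : R) (g : E) : normal_vector C x g -> normal_vector C x (c *: g).
  by move=> ng w Tw; rewrite minkZl ng// mulr0.
have P := pencil_codim2 (kk Is) (curve_orth Is) (k11 Is) ne.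
have [l0|l0] := eqVneq (k s).1.1 0; last first.
  left; split; first by case: P => // -[l0' _]; rewrite l0' eqxx in l0.
  exists ((k s).1.1^-1 *: (k s).1.2) => x Gx.
  have -> : (k s).1.1^-1 *: (k s).1.2 - x = (k s).1.1^-1 *: grad (k s) x.
    by rewrite /grad scalerBr scalerA mulVf// scale1r.
  by apply: nsc; exact: nrm.
right; split; first by case: P => [|[_]]; [left|right].
exists (k s).1.2 => [k0|x Gx].
  have := kk Is; rewrite /Q l0 k0 mink0l => H; move: H; rewrite mul0r mulr0 addr0 mulr0 subr0.
  by move=> /eqP; rewrite eq_sym oppr_eq0 oner_eq0.
by have := nrm _ Gx; rewrite /grad l0 scale0r subr0.
Qed.

Lemma envelope_in x s : W x -> `|s| < d1 -> Q (k s) (lift x) = 0 ->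
  Q (k1 s) (lift x) = 0 -> C x.
Proof.
move=> Wx sd e1 e2; have Ox := WOm Wx; split=> //.
by have [_ _ H] := sgP Ox sd; rewrite /G /envelope_eq -(H.1 e2).
Qed.

Lemma envelope_nbhs_center : 0 < d2 -> W p.
Proof.
move=> d2_gt0; have [e1 e2] := chart_inv 0 0.
rewrite (clin0 lT) scale0r !addr0 in e1 e2.
by split; rewrite /= -/(pi p) -/(ht p) ?e1 ?e2 ?normr0//; exact: ballxx.
Qed.
End Envelope.

(** * The hypersurface as a part of the envelope *)
Section CanalFromCurve.
Context {R : realType} {n : nat}.
Notation V := 'rV[R]_n.
Notation E := 'rV[R]_n.+1.
Notation LV := (polyspherical (R := R) (n := n)).

(** The implicit function theorem is used twice: for the parameter as a function
    of the point, then for the envelope as a graph over the hyperplane orthogonal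
    to [grad (k 0) p]. *)
Lemma canal_from_curve (k : R -> LV) (I : set R) (p : E) (T : V -> E) (rho0 : R)
    (k1 := dir (1 : R) k) (k2 := dir (1 : R) k1) :
  open I -> I 0 -> smooth I k ->
  (forall s, I s -> Q (k s) (k s) = -1) -> (forall s, I s -> 0 < Q (k1 s) (k1 s)) ->
  Q (k 0) (lift p) = 0 -> Q (k1 0) (lift p) = 0 -> Q (k2 0) (lift p) != 0 ->
  clin T -> 0 < rho0 -> (forall v w, mink (T v) (T w) = rho0 * dot v w) ->
  (forall v, mink (T v) (grad (k 0) p) = 0) ->
  exists (C W : set E) (d : R), [/\ canal_hypersurface C, open W, W p, 0 < d &
    forall x s, W x -> `|s| < d -> Q (k s) (lift x) = 0 -> Q (k1 s) (lift x) = 0 ->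
      C x].
Proof.
move=> oI I0 sk kk k11 hp0 hp1 hp2 lT r0p TT Tn.
have sk1 : smooth I k1 by exact: smooth_dir.
pose X := (E * R)%type : normedModType R.
pose D := [set z : X | I z.2].
have oD : open D.
  by apply: open_comp => // z _; exact: (clin_continuous (clin_snd _ _)).
pose Phi (z : X) := Q (k1 z.2) (lift z.1).
have sa : smooth D (fun z : X => k1 z.2).
  move=> j; apply: (Ck_comp (@has_frameR R) oD oI _ _ (sk1 j)) => //.
  by apply: Ck_clin; exact: clin_snd.
have sb : smooth D (fun z : X => lift z.1).
  by apply: smooth_lift => // j; apply: Ck_clin; exact: clin_fst.
have sPhi : smooth D Phi by exact: (smooth_Q (@cbil_Q R n) oD sa sb).
have DPhi z : D z -> 'D_(0, 1) Phi z = Q (k2 z.2) (lift z.1).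
  move=> Dz; rewrite -dirEx (dir_bil _ (@cbil_Q R n)); last 2 first.
  - exact: smooth_diff sa Dz.
  - exact: smooth_diff sb Dz.
  have [d1 _] := clin_diff z (clin_fst E R); have [d2 _] := clin_diff z (clin_snd E R).
  rewrite (dir_lift _ d1) (dir_clin _ _ (clin_fst E R)) /= Q_dliftE mink0r addr0.
  rewrite (dir_comp (f := snd) (g := k1))//; last exact: smooth_diff sk1 Dz.
  by rewrite (dir_clin _ _ (clin_snd E R)).
have frX : has_frame X by apply: has_frame_pair; [exact: has_frame_rV|exact: has_frameR].
have De : 'D_(0, 1) Phi (p, 0) != 0 by rewrite DPhi.
have [B1 [d1 [tau1 [oB1 B1p d1_gt0 st1 H1]]]] :=
  implicit_function frX oD (I0 : D (p, 0)) sPhi hp1 De.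
have Ez x (r : R) : (x, 0) + r *: ((0, 1) : X) = (x, r).
  by rewrite [LHS](_ : _ = (x + r *: 0, 0 + r * 1)) // scaler0 addr0 add0r mulr1.
pose Om := [set x : E | B1 (x, 0)].
pose sg (x : E) := tau1 (x, 0).
have oOm : open Om.
  by apply: open_comp => // z _; exact: (clin_continuous (clin_inl E R)).
have ssg : smooth Om sg.
  move=> j; apply: (Ck_comp frX oOm oB1 _ _ (st1 j)) => //.
  by apply: Ck_clin; exact: clin_inl.
have sg_lt x : Om x -> `|sg x| < d1 by move=> /H1[].
have sgP x r : Om x -> `|r| < d1 ->
    [/\ I r, Q (k2 r) (lift x) != 0 & Q (k1 r) (lift x) = 0 <-> r = sg x].
  move=> /H1[_ /(_ r)] H rd; have [Dr Dn f0] := H rd.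
  by rewrite Ez in Dr Dn f0; rewrite DPhi in Dn.
have sgp : sg p = 0.
  have [|_ _ H] := sgP p 0 B1p; first by rewrite normr0.
  by symmetry; apply: H.1.
pose nu0 := grad (k 0) p.
have nn : mink nu0 nu0 = -1 by rewrite mink_grad kk// hp0 !mulr0 !subr0.
pose G := envelope_eq k sg.
have sG : smooth Om G by exact: (smooth_envelope_eq oI sk oOm ssg sg_lt sgP).
have G0 : G p = 0 by rewrite /G /envelope_eq sgp.
have DG : 'D_nu0 G p != 0.
  rewrite -dirEx (dir_envelope_eq oI sk oOm ssg sg_lt sgP)// sgp -/nu0 nn.
  by rewrite oppr_eq0 oner_eq0.
have [B2 [d2 [tau2 [oB2 B2p d2_gt0 st2 H2]]]] :=
  implicit_function (@has_frame_rV R n.+1) oOm (B1p : Om p) sG G0 DG.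
have oBT : open [set v : V | setT v /\ B2 (p + T v)].
  have sT : smooth setT (fun v => p + T v).
    by move=> j; apply: (CkD openT); [exact: Ck_cst|exact: Ck_clin].
  exact: (smooth_preimage sT openT oB2).
have /nbhs_ballP[r0 /= r0_gt0 rB] : nbhs (0 : V) [set v : V | setT v /\ B2 (p + T v)].
  by apply: open_nbhs_nbhs; split=> //; split=> //; rewrite (clin0 lT) addr0.
have inB2 v : ball 0 r0 v -> B2 (p + T v) by move=> /rB[].
have tau_lt x : B2 x -> `|tau2 x| < d2 by move=> /H2[].
have tauP x r : B2 x -> `|r| < d2 ->
    Om (x + r *: nu0) /\ (G (x + r *: nu0) = 0 <-> r = tau2 x).
  by move=> /H2[_ /(_ r)] H rd; have [] := H rd.
exists (envelope k sg p T rho0 nu0 d2 r0), (envelope_nbhs p T rho0 nu0 d2 r0), d1.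
split=> //.
- exact: (envelope_canal oI sk kk k11 oOm ssg sg_lt sgP lT r0p TT Tn nn oB2 st2
    tau_lt tauP inB2).
- by apply: open_envelope_nbhs.
- exact: (envelope_nbhs_center p lT r0p TT Tn nn r0_gt0 d2_gt0).
move=> x s Wx sd e1 e2.
exact: (envelope_in sgP lT r0p TT Tn nn tauP inB2 Wx sd e1 e2).
Qed.

(** Around a point that is not umbilical, the curvature hyperspheres [K u] form a
    curve [k], the values of [K] on the line [u0 + s *: b], and the hypersurface
    is a part of its envelope. *)
Lemma canal_through_chart (U : set V) (f : V -> E) (rho : V -> R) (u0 : V) :
  (4 <= n)%N -> open U -> U u0 -> smooth U f -> (forall u, U u -> 0 < rho u) ->
  (forall u v w, U u -> mink (dir v f u) (dir w f u) = rho u * dot v w) ->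
  ~ (exists l, forall v, - dir v (unit_normal f rho) u0 = l *: dir v f u0) ->
  exists (C : set E) (N : set V), [/\ canal_hypersurface C, open N, N u0, N `<=` U &
    forall u, N u -> C (f u)].
Proof.
move=> n4 oU Uu0 sf rho_gt0 conf numb.
have n0 : (0 < n)%N by exact: leq_trans n4.
have [b [U1 [K [om [oU1 U1u0 U1U sK H]]]]] := chart_family n0 oU sf rho_gt0 conf n4 Uu0 numb.
pose p := f u0; pose X0 := dlift p (dir b f u0).
have lQ : clin (fun X : LV => Q X X0).
  split; first by move=> a x y; rewrite QDl QZl.
  have CQ : Ck 0 setT (fun X : LV => Q X X0).
    apply: (Ck_bil openT (@cbil_Q R n)); last exact: Ck_cst.
    by apply: Ck_clin; split=> // ?; exact: cvg_id.
  by move=> X; exact: CQ.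
have DK u y : U1 u -> 'D_y K u = om u y *: 'D_b K u.
  by move=> U1u; rewrite -!dirEx; have [_ _ _ + _] := H _ U1u; apply.
have X0n : Q ('D_b K u0) X0 != 0.
  by rewrite -dirEx; have [_ _ _ _ []] := H _ U1u0.
have [U2 [t [oU2 U2u0 st t0 HU2]]] :=
  rank_one_curve (@has_frame_rV R n) (@has_frame_polyspherical R n) oU1 U1u0 sK DK lQ X0n.
pose ln (s : R) := u0 + s *: b.
have cln : clin (fun s : R => s *: b).
  split=> [a s s'|s]; first by rewrite scalerDl scalerA.
  by apply: scalel_continuous.
have sln : smooth setT ln.
  by move=> j; apply: (CkD openT); [exact: Ck_cst|exact: Ck_clin].
pose I := [set s | setT s /\ U1 (ln s)].
have oI : open I by apply: (smooth_preimage sln) => //; exact: openT.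
pose k s := K (ln s).
have sk : smooth I k.
  move=> j; apply: (Ck_comp (@has_frame_rV R n) oI oU1 _ _ (sK j)) => [s []//|].
  by apply: Ck_sub (sln j).
have I0 : I 0 by split=> //; rewrite /ln scale0r addr0.
pose k1 := dir (1 : R) k; pose k2 := dir (1 : R) k1.
have sk1 : smooth I k1 by exact: smooth_dir.
have k1E s : I s -> k1 s = dir b K (ln s).
  move=> [_ Us].
  have dl : differentiable ln s by exact: (smooth_diff sln).
  rewrite /k1 (dir_comp (f := ln) (g := K))//; last exact: smooth_diff sK Us.
  have [dc _] := clin_diff s cln.
  by congr (dir _ K _); rewrite dirEx derive_fctD// derive_cst add0r derive_clin// scale1r.
have kk s : I s -> Q (k s) (k s) = -1 by move=> [_ /H[]].
have k11 s : I s -> 0 < Q (k1 s) (k1 s).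
  by move=> Is; rewrite k1E//; have [_ /H[_ _ _ _ []]] := Is.
have ln0 : ln 0 = u0 by rewrite /ln scale0r addr0.
have hp0 : Q (k 0) (lift p) = 0 by rewrite /k ln0; have [] := H _ U1u0.
have hp1 : Q (k1 0) (lift p) = 0.
  by rewrite k1E// ln0; have [_ _ _ _ []] := H _ U1u0.
have It u : U2 u -> I (t u) by move=> /HU2[_ ? _].
have tb u : U2 u -> dir b K u = dir b t u *: k1 (t u).
  move=> U2u.
  have dt : differentiable t u by exact: smooth_diff st U2u.
  have dk : differentiable k (t u) by exact: smooth_diff sk (It _ U2u).
  rewrite (dir_eq_open b oU2 U2u (g := fun u => k (t u))); last by move=> w /HU2[].
  rewrite (dir_comp _ dt dk) -(dir_scale _ _ dk); congr (dir _ k _).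
  by rewrite /GRing.scale /= mulr1.
have Q1 u : U2 u -> Q (k1 (t u)) (lift (f u)) = 0.
  move=> U2u; have [U1u _ _] := HU2 _ U2u.
  have [_ _ _ _ [Kl _ Kb]] := H _ U1u.
  have : dir b t u * Q (k1 (t u)) (lift (f u)) = 0 by rewrite -QZl -tb.
  move=> /eqP; rewrite mulf_eq0 => /orP[/eqP t00|/eqP//].
  by move: Kb; rewrite tb// t00 scale0r Q0l ltxx.
(* Differentiate [Q1] along [b]: the product of [k2] with the point, times the
   derivative of [t], is minus the product of [k1] with the tangent vector
   [dir b f u0], which is not zero by [X0n]. *)
have hp2 : Q (k2 0) (lift p) != 0.
  have sf2 : smooth (U2 `&` U1) f by move=> j; apply: Ck_sub (sf j) => u [_ /U1U].
  have o12 : open (U2 `&` U1) by exact: openI.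
  have st2 : smooth (U2 `&` U1) t by move=> j; apply: Ck_sub (st j) => u [].
  have skt : smooth (U2 `&` U1) (fun u => k1 (t u)).
    move=> j; apply: (Ck_comp (@has_frameR R) o12 oI _ (st2 j) (sk1 j)).
    by move=> u [U2u _]; exact: It.
  have slf := smooth_lift o12 sf2.
  have U12 : (U2 `&` U1) u0 by [].
  have dt : differentiable t u0 by exact: smooth_diff st U2u0.
  have dk1 : differentiable k1 (t u0) by exact: smooth_diff sk1 (It _ U2u0).
  have := derive_Q_cst (@cbil_Q R n) b o12 U12 skt slf (c := 0).
  move=> /(_ (fun u (h : (U2 `&` U1) u) => Q1 u h.1)).
  rewrite (dir_lift _ (smooth_diff sf2 U12)) (dir_comp _ dt dk1) t0 k1E// ln0 -/p.
  have -> : dir (dir b t u0) k1 0 = dir b t u0 *: k2 0.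
    rewrite t0 in dk1; rewrite -(dir_scale _ _ dk1); congr (dir _ k1 _).
    by rewrite /GRing.scale /= mulr1.
  rewrite QZl => E1; have [_ _ _ _ [_ X1 _]] := H _ U1u0.
  by apply: contraNneq X1 => k20; move: E1; rewrite k20 mulr0 => /esym/eqP; rewrite oppr_eq0.
have cT : clin (fun v => dir v f u0).
  have -> : (fun v => dir v f u0) = (fun v => 'D_v f u0) by apply/funext => v; rewrite dirE.
  by apply: clin_derive; exact: smooth_diff sf Uu0.
have [|C [W [d [canC oW Wp d_gt0 HC]]]] := canal_from_curve oI I0 sk kk k11 hp0 hp1 hp2
  cT (rho_gt0 _ Uu0) (fun v w => conf u0 v w Uu0).
  move=> v; rewrite minkC -Q_dliftE /k ln0; have [_ _ + _ _] := H _ U1u0.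
  exact.
pose N1 := [set u | U2 u /\ ball (0 : R) d (t u)].
pose N2 := [set u | U u /\ W (f u)].
have oN1 : open N1 by apply: (smooth_preimage st oU2); exact: ball_open.
have oN2 : open N2 by exact: (smooth_preimage sf oU).
exists C, (N1 `&` N2); split=> //.
- exact: openI.
- by split; split=> //; rewrite t0; exact: ballxx.
- by move=> u [_ []].
move=> u [[U2u bt] [Uu Wu]]; have [U1u U1t Kt] := HU2 _ U2u.
apply: (HC _ (t u)) => //.
- by move: bt; rewrite -ball_normE/= sub0r normrN.
- by rewrite /k /ln -Kt; have [] := H _ U1u.
exact: Q1.
Qed.
End CanalFromCurve.

Theorem theorem5p7 (R : realType) (n : nat) (hn : (4 <= n)%N)
    (M : set 'rV[R]_n.+1)
    (M_spacelike : spacelike_hypersurface M)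
    (M_conformally_flat : conformally_flat M)
    (M_no_umbilics : forall p, M p -> ~ umbilical M p) :
  forall p, M p ->
    exists O C : set 'rV[R]_n.+1,
      [/\ open O, O p, canal_hypersurface C & M `&` O `<=` C].
Proof.
move=> p Mp.
have [U [f [Pf [u0 Uu0 fu0] [rho Hrho]]]] := M_conformally_flat p Mp.
have [oU sf finj _ fopen] := Pf.
have n0 : (0 < n)%N by exact: leq_trans hn.
have rho_gt0 u : U u -> 0 < rho u by move=> /Hrho[].
have conf u v w : U u -> mink (dir v f u) (dir w f u) = rho u * dot v w.
  by move=> Uu; rewrite !dirEx; have [_] := Hrho _ Uu; apply.
have [|C [N [canC oN Nu0 NU HC]]] := canal_through_chart hn oU Uu0 sf rho_gt0 conf.
  move=> [l Hl]; apply: (M_no_umbilics p Mp).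
  exists U, f, (unit_normal f rho), u0, l; split=> //.
    split; first exact: (smooth_unit_normal n0 oU sf rho_gt0 conf).
    move=> u Uu; split; first exact: (unit_normal_norm sf rho_gt0 conf Uu).
    by move=> v; rewrite -dirEx; exact: (unit_normal_orth sf rho_gt0 conf v Uu).
  by move=> v; rewrite -!dirEx; exact: Hl.
have [P oP fP] := fopen N oN NU.
have pP : (M `&` P) p by rewrite -fP; exists u0.
exists P, C; split=> //; first by have [] := pP.
by rewrite -fP => _ [u Nu <-]; exact: HC.
Qed.
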